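(* Let $p/q\in(0,1/2)$ be a rational number with $\gcd(p,q)=1$, and let $\Gamma_\epsilon$, $\epsilon\in[-\epsilon_0,\epsilon_0]$, be a deformation of the unit circle with smooth support function $h(\psi;\epsilon)\asymp 1+\sum_{k\ge1}\epsilon^k h_k(\psi)$ as $\epsilon\to0$. The high-order persistence (in the sense defined in the context) of the $p/q$-resonant caustic of the unit circle under $\Gamma_\epsilon$ is determined as follows. (a) It $\mathrm O(\epsilon)$-persists if and only if $\mu_{q\mathbb Z^\star}\{h_1\}=0$. (b) It $\mathrm O(\epsilon^2)$-persists if and only if it $\mathrm O(\epsilon)$-persists and $\mu_{q\mathbb Z^\star}\{h_2+\theta_1^2/2\}=0$, where $$\theta_1(t)=\sum_{l\notin q\mathbb Z\cup\{-1,1\}}\nu_l(p/q)\,\hat h_{1,l}\,e^{ilt}\quad\text{if}\quad h_1(\psi)=\sum_{l\in\mathbb Z}\hat h_{1,l}\,e^{il\psi}.$$ (c) Let $m\ge3$. It $\mathrm O(\epsilon^m)$-persists if and only if it $\mathrm O(\epsilon^{m-1})$-persists and $\mu_{q\mathbb Z^\star}\{h_m+\zeta_m\}=0$, where $\zeta_m$ is a smooth $2\pi$-periodic function, depending only on $h_1,\dots,h_{m-1}$, that is explicitly computed (when the caustic $\mathrm O(\epsilon^{m-1})$-persists) by the recurrences given in the context.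
   Context: Smooth means $C^\infty$; $\mathbb T=\mathbb R/2\pi\mathbb Z$; $\mathbb Z^\star=\mathbb Z\setminus\{0\}$. The symbol $\asymp$ denotes an asymptotic (Taylor) expansion as $\epsilon\to0$. Harmonics. For a smooth $2\pi$-periodic $a(t)=\sum_{l\in\mathbb Z}\hat a_l e^{ilt}$ and $R\subset\mathbb Z$, $\mu_R\{a\}=\sum_{l\in R}\hat a_l e^{ilt}$. Factors. For $|l|\ge2$ and $\rho\in(0,1/2)$: $\nu_l(\rho)=\nu_{-l}(\rho)=\dfrac{\tan(l\pi\rho)-l\tan(\pi\rho)}{\tan(\pi\rho)\tan(l\pi\rho)}$ if $2l\rho\notin\mathbb Z$; $\nu_l(\rho)=1/\tan(\pi\rho)$ if $2l\rho\in\mathbb Z$ but $l\rho\notin\mathbb Z$ (and $\nu_l(\rho)=\infty$ if $l\rho\in\mathbb Z$, which never occurs in the statement). Billiards. Let $\Gamma$ be a smooth strictly convex closed curve in $\mathbb R^2\simeq\mathbb C$, oriented counterclockwise, with the origin in its interior. Its support function $h$ is the positive smooth $2\pi$-periodic function such that $z(\psi)=h(\psi)e^{i\psi}+h'(\psi)e^{i(\psi+\pi/2)}$ parametrizes $\Gamma$, where $\psi$ is the angle of the outer normal at $z(\psi)$. An oriented line $\cos\varphi\cdot x+\sin\varphi\cdot y=\lambda$ has coordinates $(\varphi,\lambda)\in\mathbb A=\mathbb T\times\mathbb R$, where $\varphi$ is the direction of its right normal. The lines meeting the interior of $\Gamma$ form $\mathbb A_\Gamma=\{(\varphi,\lambda):-h(\varphi+\pi)<\lambda<h(\varphi)\}$.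 The billiard map $f:\mathbb A_\Gamma\to\mathbb A_\Gamma$ sends an oriented line to its reflection with respect to the tangent to $\Gamma$ at the second intersection of the line with $\Gamma$. Equivalently, with $\psi=(\varphi_1+\varphi)/2$, $\theta=(\varphi_1-\varphi)/2\in(0,\pi)$: $f(\varphi,\lambda)=(\varphi_1,\lambda_1)$ iff $\lambda=h(\psi)\cos\theta-h'(\psi)\sin\theta$ and $\lambda_1=h(\psi)\cos\theta+h'(\psi)\sin\theta$. A caustic is a curve such that any billiard trajectory, once tangent to it, stays tangent after every reflection. A convex caustic is $p/q$-resonant when all its (counterclockwise oriented) tangent trajectories form closed polygons with $q$ sides making $p$ turns around it. For the unit circle it is the concentric circle of radius $\cos(\pi p/q)$. Operators. $\omega=2\pi p/q$; acting on functions of $t$ (and possibly $\epsilon$): $\tau\{a\}(t)=a(t+\omega)$, $\sigma\{a\}=\tau\{a\}+a$, $\delta\{a\}=\tau\{a\}-a$, $\mu\{a\}(t)=\frac1q\sum_{j=0}^{q-1}a(t+j\omega)$. Deformation. $h(\psi;\epsilon)$ is smooth in $(\psi,\epsilon)\in\mathbb T\times[-\epsilon_0,\epsilon_0]$, with $h(\psi;0)=1$ and $\epsilon_0>0$ small enough; $f_\epsilon$ is the billiard map in $\Gamma_\epsilon$. A prime denotes the derivative with respect to $\psi$ or $t$; $h\circ\psi$ denotes $h(\psi(t;\epsilon);\epsilon)$, and similarly for $h'\circ\psi$. Persistence. For $m\in\mathbb N\cup\{0\}$ the $p/q$-resonant caustic $\mathrm O(\epsilon^m)$-persists under $\Gamma_\epsilon$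 iff the following three conditions hold. (F)$_m$ There are smooth functions $\varphi(t;\epsilon),\psi(t;\epsilon),\theta(t;\epsilon)$ with $\varphi-t$, $\psi-t$, $\theta$ $2\pi$-periodic in $t$, related by $\psi=\varphi+\theta=\sigma\{\varphi\}/2$, $2\theta=\delta\{\varphi\}$, $\mu\{\psi-t\}=0$, $\mu\{t-\varphi\}=\omega/2=\mu\{\theta\}$, such that $\varphi'(t;\epsilon)>0$ and $\sigma\{h'\circ\psi\cdot\sin\theta\}-\delta\{h\circ\psi\cdot\cos\theta\}=\mathrm O(\epsilon^{m+1})$ as $\epsilon\to0$. (P)$_m$ There are smooth parametrizations $c_\epsilon:\mathbb T\to\mathbb A_{\Gamma_\epsilon}$, $c_\epsilon(t)=(\varphi(t;\epsilon),\lambda(t;\epsilon))$, of graphs $G_\epsilon=c_\epsilon(\mathbb T)$ such that $f_\epsilon\circ c_\epsilon-\tau\{c_\epsilon\}=(0,\mathrm O(\epsilon^{m+1}))$ as $\epsilon\to0$. (A)$_m$ There is $L(\epsilon)>0$ such that $A_\epsilon\{\varphi\}:=2q\,\mu\{h\circ\psi\cdot\sin\theta\}$ satisfies $A_\epsilon\{\varphi\}-L(\epsilon)=\mathrm O(\epsilon^{m+1})$ as $\epsilon\to0$. Recurrences defining $\zeta_m$. Let $c=\cos(\omega/2)$, $s=\sin(\omega/2)$, $\varphi_0(t)=t-\omega/2$, $\psi_0(t)=t$, $\theta_0=\omega/2$. Given $\psi_j,\theta_j$ for $j<k$, put $\psi_{<k}=\sum_{j<k}\epsilon^j\psi_j$,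 $\theta_{<k}=\sum_{j<k}\epsilon^j\theta_j$, and let $\mathcal Q_k$ and $\tilde{\mathcal R}_k$ be the coefficients of $\epsilon^k$ in the expansions of $h'\circ\psi_{<k}\cdot\sin\theta_{<k}$ and $h\circ\psi_{<k}\cdot\cos\theta_{<k}$, respectively. For $k=1,\dots,m-1$, $\theta_k$ is the unique smooth $2\pi$-periodic solution of $s\,\delta\{\theta_k\}=\delta\{\tilde{\mathcal R}_k\}-\sigma\{\mathcal Q_k\}$, $\mu\{\theta_k\}=0$; then $\varphi_k$ is the unique smooth $2\pi$-periodic solution of $\delta\{\varphi_k\}=2\theta_k$, $\mu\{\varphi_k\}=0$; and $\psi_k=\varphi_k+\theta_k$. Finally $\tilde{\mathcal Q}_m:=\mathcal Q_m-s\,h_m'$ depends only on $h_j,\psi_j,\theta_j$ with $j<m$ (and their derivatives), and $\zeta_m$ is a smooth $2\pi$-periodic function (unique up to an irrelevant additive constant) with $s\,\zeta_m'=\tilde{\mathcal Q}_m$. *)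

(* Defs.v *)
From Stdlib Require Import Reals ZArith ClassicalEpsilon.
From Coquelicot Require Export Coquelicot.
Open Scope R_scope.

(* Functions on the circle R / 2 pi Z are 2 pi-periodic functions on R, and
   angles are represented by real lifts.  A function of (t, eps) is a curried
   function [R -> R -> R] with [eps] as its last argument; its values for eps
   outside the interval under consideration are irrelevant. *)

Definition periodic (a : R -> R) : Prop := forall t, a (t + 2 * PI) = a t.

Definition smooth_periodic (a : R -> R) : Prop :=
  periodic a /\ forall n t, ex_derive_n a n t.

(* C^oo on the closed strip R x [-e0, e0]: there is a C^oo extension to an
   open neighbourhood of it. *)
Definition smooth_strip (e0 : R) (a : R -> R -> R) : Prop :=
  exists (e1 : R) (b : R -> R -> R), e0 < e1 /\
    (forall t e, Rabs e <= e0 -> b t e = a t e) /\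
    (forall n t e, Rabs e < e1 -> ex_diff_n b n t e).

Definition periodic_strip (e0 : R) (a : R -> R -> R) : Prop :=
  forall t e, Rabs e <= e0 -> a (t + 2 * PI) e = a t e.

(* a(t; eps) = O(eps^n) as eps -> 0, uniformly in t. *)
Definition bigO_eps (n : nat) (a : R -> R -> R) : Prop :=
  exists K d : R, 0 < d /\
    forall t e, Rabs e <= d -> Rabs (a t e) <= K * Rabs e ^ n.

(* Coefficient of eps^k in the expansion of a(t; eps) as eps -> 0. *)
Definition taylor_coef (a : R -> R -> R) (k : nat) (t : R) : R :=
  Derive_n (fun e => a t e) k 0 / INR (fact k).

(** * Harmonics *)

Definition expi (x : R) : C := (cos x, sin x).

Definition fourier_coef (a : R -> C) (l : Z) : C :=
  (RInt (V := C_R_CompleteNormedModule)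
     (fun t => a t * expi (- (IZR l * t)))%C 0 (2 * PI) / RtoC (2 * PI))%C.

Definition Clim_seq (u : nat -> C) : C :=
  (real (Lim_seq (fun n => Re (u n))), real (Lim_seq (fun n => Im (u n)))).

(* sum_{l in A} c_l e^{ilt}, as the limit of its partial sums over |l| <= N. *)
Definition fourier_sum (A : Z -> Prop) (c : Z -> C) (t : R) : C :=
  Clim_seq (fun N =>
    sum_n (fun j : nat =>
      let l := (Z.of_nat j - Z.of_nat N)%Z in
      if excluded_middle_informative (A l)
      then (c l * expi (IZR l * t))%C else RtoC 0) (2 * N)).

Definition mu_harm (A : Z -> Prop) (a : R -> C) : R -> C :=
  fourier_sum A (fourier_coef a).

(* q Z^star *)
Definition qZstar (q : nat) (l : Z) : Prop := (Z.of_nat q | l)%Z /\ l <> 0%Z.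

Definition is_integer (x : R) : Prop := exists k : Z, x = IZR k.

Definition nu (l : Z) (rho : R) : Rbar :=
  if excluded_middle_informative (is_integer (IZR l * rho)) then p_infty
  else if excluded_middle_informative (is_integer (2 * IZR l * rho)) then
    Finite (1 / tan (PI * rho))
  else
    Finite ((tan (IZR l * PI * rho) - IZR l * tan (PI * rho))
            / (tan (PI * rho) * tan (IZR l * PI * rho))).

Definition theta1_series (p q : nat) (h1 : R -> R) : R -> C :=
  fourier_sum
    (fun l => ~ (Z.of_nat q | l)%Z /\ l <> 1%Z /\ l <> (-1)%Z)
    (fun l => (RtoC (real (nu l (INR p / INR q)))
               * fourier_coef (fun t => RtoC (h1 t)) l)%C).

(** * Operators *)

Definition omega (p q : nat) : R := 2 * PI * INR p / INR q.

Definition tau (p q : nat) (a : R -> R) (t : R) : R := a (t + omega p q).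
Definition sigma (p q : nat) (a : R -> R) (t : R) : R := tau p q a t + a t.
Definition delta (p q : nat) (a : R -> R) (t : R) : R := tau p q a t - a t.
Definition mu (p q : nat) (a : R -> R) (t : R) : R :=
  / INR q * sum_n (fun j : nat => a (t + INR j * omega p q)) (pred q).

(** * Billiards *)

(* The curve with support function g, parametrized by the angle of its outer
   normal. *)
Definition curve (g : R -> R) (psi : R) : C :=
  (RtoC (g psi) * expi psi + RtoC (Derive g psi) * expi (psi + PI / 2))%C.

(* The oriented line with coordinates (phi, lambda), parametrized by arc length;
   its direction is i e^{i phi}, so that e^{i phi} is its right normal. *)
Definition line_dir (x : R * R) : C := expi (fst x + PI / 2).
Definition line_point (x : R * R) (s : R) : C :=
  (RtoC (snd x) * expi (fst x) + RtoC s * line_dir x)%C.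

Definition annulus (g : R -> R) (x : R * R) : Prop :=
  - g (fst x + PI) < snd x < g (fst x).

(* Reflection of the vector v with respect to the line orthogonal to the unit
   vector n. *)
Definition reflect (n v : C) : C := (v - RtoC (2 * Re (v * Cconj n)) * n)%C.

(* Graph of the billiard map: the line x meets the curve at two points, the
   second one being z(psi), and y is the reflection of x with respect to the
   tangent at z(psi).  The angle [fst y] is only determined modulo 2 pi. *)
Definition billiard_map (g : R -> R) (x y : R * R) : Prop :=
  annulus g x /\
  exists psi0 psi s0 s s1 : R, s0 < s /\
    curve g psi0 = line_point x s0 /\
    curve g psi = line_point x s /\
    line_dir y = reflect (expi psi) (line_dir x) /\
    curve g psi = line_point y s1.

(* Strict convexity is expressed by the positivity of the radius of curvature
   h + h'': both the curve and its support function are smooth, so the curvature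
   is finite and does not vanish. *)
Definition circle_deformation (e0 : R) (h : R -> R -> R) : Prop :=
  0 < e0 /\ smooth_strip e0 h /\ periodic_strip e0 h /\
  (forall psi, h psi 0 = 1) /\
  (forall psi e, Rabs e <= e0 ->
     0 < h psi e /\ 0 < h psi e + Derive_n (fun x => h x e) 2 psi).

(** * Persistence *)

(* h o psi and h' o psi, the latter with the derivative with respect to the
   first variable. *)
Definition hcomp (h psi : R -> R -> R) (t e : R) : R := h (psi t e) e.
Definition dhcomp (h psi : R -> R -> R) (t e : R) : R :=
  Derive (fun x => h x e) (psi t e).

Definition cond_F (p q : nat) (h : R -> R -> R) (e1 : R) (m : nat)
    (phi psi theta : R -> R -> R) : Prop :=
  smooth_strip e1 phi /\ smooth_strip e1 psi /\ smooth_strip e1 theta /\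
  periodic_strip e1 (fun t e => phi t e - t) /\
  periodic_strip e1 (fun t e => psi t e - t) /\
  periodic_strip e1 theta /\
  (forall t e, Rabs e <= e1 ->
     psi t e = phi t e + theta t e /\
     psi t e = sigma p q (fun x => phi x e) t / 2 /\
     2 * theta t e = delta p q (fun x => phi x e) t /\
     mu p q (fun x => psi x e - x) t = 0 /\
     mu p q (fun x => x - phi x e) t = omega p q / 2 /\
     mu p q (fun x => theta x e) t = omega p q / 2 /\
     0 < Derive (fun x => phi x e) t) /\
  bigO_eps (S m) (fun t e =>
    sigma p q (fun x => dhcomp h psi x e * sin (theta x e)) t
    - delta p q (fun x => hcomp h psi x e * cos (theta x e)) t).

(* c_eps(t) = (phi(t; eps), lambda(t; eps)) parametrizes a graph because phi' > 0
   is part of [cond_F]; (phi(t + omega; eps), lambda1(t; eps)) is f_eps(c_eps(t)). *)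
Definition cond_P (p q : nat) (h : R -> R -> R) (e1 : R) (m : nat)
    (phi lambda : R -> R -> R) : Prop :=
  smooth_strip e1 phi /\ smooth_strip e1 lambda /\
  periodic_strip e1 (fun t e => phi t e - t) /\
  periodic_strip e1 lambda /\
  (forall t e, Rabs e <= e1 ->
     annulus (fun x => h x e) (phi t e, lambda t e)) /\
  exists lambda1 : R -> R -> R,
    (forall t e, Rabs e <= e1 ->
       billiard_map (fun x => h x e) (phi t e, lambda t e)
         (tau p q (fun x => phi x e) t, lambda1 t e)) /\
    bigO_eps (S m) (fun t e =>
      lambda1 t e - tau p q (fun x => lambda x e) t).

Definition cond_A (p q : nat) (h : R -> R -> R) (e1 : R) (m : nat)
    (psi theta : R -> R -> R) : Prop :=
  exists L : R -> R, (forall e, Rabs e <= e1 -> 0 < L e) /\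
    bigO_eps (S m) (fun t e =>
      2 * INR q * mu p q (fun x => hcomp h psi x e * sin (theta x e)) t - L e).

(* The p/q-resonant caustic O(eps^m)-persists.  The conditions are about
   eps -> 0, so that the interval of perturbative parameters may shrink. *)
Definition persists (p q : nat) (e0 : R) (h : R -> R -> R) (m : nat) : Prop :=
  exists (e1 : R) (phi psi theta : R -> R -> R),
    0 < e1 <= e0 /\
    cond_F p q h e1 m phi psi theta /\
    (exists lambda : R -> R -> R, cond_P p q h e1 m phi lambda) /\
    cond_A p q h e1 m psi theta.

(** * Recurrences *)

(* a_{<k} = sum_{j < k} eps^j a_j, for k >= 1. *)
Definition truncation (a : nat -> R -> R) (k : nat) (t e : R) : R :=
  sum_n (fun j => e ^ j * a j t) (pred k).

Definition Qcoef (h : R -> R -> R) (psi theta : nat -> R -> R) (k : nat)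
    : R -> R :=
  taylor_coef (fun t e =>
    dhcomp h (truncation psi k) t e * sin (truncation theta k t e)) k.

Definition Rcoef (h : R -> R -> R) (psi theta : nat -> R -> R) (k : nat)
    : R -> R :=
  taylor_coef (fun t e =>
    hcomp h (truncation psi k) t e * cos (truncation theta k t e)) k.

Definition recurrences (p q : nat) (h : R -> R -> R) (m : nat)
    (phi psi theta : nat -> R -> R) : Prop :=
  (forall t, phi 0%nat t = t - omega p q / 2 /\ psi 0%nat t = t /\
     theta 0%nat t = omega p q / 2) /\
  forall k : nat, (1 <= k < m)%nat ->
    unique (fun a : R -> R => smooth_periodic a /\
        forall t, sin (omega p q / 2) * delta p q a t
          = delta p q (Rcoef h psi theta k) t - sigma p q (Qcoef h psi theta k) t
          /\ mu p q a t = 0)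
      (theta k) /\
    unique (fun a : R -> R => smooth_periodic a /\
        forall t, delta p q a t = 2 * theta k t /\ mu p q a t = 0)
      (phi k) /\
    (forall t, psi k t = phi k t + theta k t).

(* zeta is computed at order m by the recurrences: s zeta' = Q_m - s h_m'. *)
Definition zeta_by_recurrences (p q : nat) (h : R -> R -> R) (m : nat)
    (zeta : R -> R) : Prop :=
  exists phi psi theta : nat -> R -> R,
    recurrences p q h m phi psi theta /\
    forall t, sin (omega p q / 2) * Derive zeta t
      = Qcoef h psi theta m t
        - sin (omega p q / 2) * Derive (taylor_coef h m) t.

(* Main.v *)
(* Write E = sigma{h' o psi sin theta} - delta{h o psi cos theta} and let E_k be its
   eps^k coefficient.  Because h(.;0) = 1, inserting the coefficients psi_k, theta_k on top
   of the truncations psi_{<k}, theta_{<k} changes the integrand of E by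
   O(eps^(k+1)), except for the contribution -s theta_k eps^k to h o psi cos theta, so
   E_k = sigma Q_k - delta R_k + s delta theta_k.  As tau^q = id on periodic functions,
   delta a = g is solvable exactly when mu g = 0; hence the only obstruction to improving
   O(eps^m) to O(eps^(m+1)) is mu Q_(m+1) = 0, and the lower coefficients are forced
   by the recurrences.  Moreover (d/dt) mu{h o psi sin theta} = mu{E tau phi'} / 2, which gives
   both (A) from (F) and the vanishing of the mean of Q_m, so that zeta_m is
   periodic.  Finally mu is the projection onto the harmonics in q Z, by pointwise
   convergence of Fourier series, proved with Bessel's inequality for the
   functions sin((n + 1/2) u). *)

(* Estimates O(eps^n) are uniform in t, whereas a coefficient is a derivative at eps = 0 for one t.
   Periodicity bridges the two: remainders are bounded by compactness of a period. Coefficients of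
   composites are read off from estimates rather than from iterated chain rules, since expansions
   agreeing up to O(eps^(k+1)) have the same coefficients up to order k. The recurrences start from
   phi_0 = t - omega/2 and theta_0 = omega/2, which (F) does not impose. They are forced: at eps = 0
   the equation says that cos theta is invariant under tau, and phi' > 0 confines theta to (0, PI),
   where cosine is injective. Persistence reduces to (F), because the billiard map is known exactly
   along the curve (phi, h cos theta - h' sin theta); strict convexity tells which of the two
   intersections is the second. zeta_m has to be a function of h_1, ..., h_(m-1), although the
   recurrences take the whole of h. Two deformations with the same lower coefficients have Q_m
   differing by s times the derivative of the difference of their h_m, so that Q_m - s h_m' is the
   same for both. *)
From Stdlib Require Import Reals ZArith Lra Lia Nsatz FunctionalExtensionality
  PropExtensionality ClassicalEpsilon.
Require Import Defs.
Open Scope R_scope.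

(** * Smooth functions on a strip *)

(* Coquelicot leaves equations typed in [AbelianMonoid.sort _], which ring and lra do not
   recognize as equations in R. *)
Ltac req := match goal with |- ?x = ?y => change (@eq R x y) end.

(* Agrees with [ex_diff_n] at all points of the strip; carrying the partial derivatives as
   witnesses lets the product and chain rules go through by induction on n. *)
Fixpoint cn_strip (d : R) (n : nat) (a : R -> R -> R) : Prop :=
  (forall t e, Rabs e < d -> continuity_2d_pt a t e) /\
  match n with
  | O => True
  | S n => exists a1 a2 : R -> R -> R,
      (forall t e, Rabs e < d ->
         is_derive (fun z => a z e) t (a1 t e) /\
         is_derive (fun z => a t z) e (a2 t e)) /\
      cn_strip d n a1 /\ cn_strip d n a2
  end.

(** The strip is open and no extension is involved, unlike in [smooth_strip]. All operations stay on
    the same strip; only the return to a closed strip costs some width. *)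
Definition smooth_on (d : R) (a : R -> R -> R) : Prop :=
  forall n, cn_strip d n a.

Definition D1 (a : R -> R -> R) (t e : R) : R := Derive (fun z => a z e) t.
Definition D2 (a : R -> R -> R) (t e : R) : R := Derive (fun z => a t z) e.

Lemma locally_lt_abs (d e : R) : Rabs e < d -> locally e (fun z => Rabs z < d).
Proof.
  intros H. assert (0 < d - Rabs e) as Hp by lra.
  exists (mkposreal _ Hp). intros z Hz.
  change (Rabs (z - e) < d - Rabs e) in Hz.
  replace z with (e + (z - e)) by ring.
  eapply Rle_lt_trans. apply Rabs_triang. lra.
Qed.

Lemma locally_2d_strip (d t e : R) (P : R -> R -> Prop) :
  Rabs e < d -> (forall u v, Rabs v < d -> P u v) -> locally_2d P t e.
Proof.
  intros H HP. assert (0 < d - Rabs e) as Hp by lra.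
  exists (mkposreal _ Hp). intros u v _ Hv. simpl in Hv. apply HP.
  replace v with (e + (v - e)) by ring.
  eapply Rle_lt_trans. apply Rabs_triang. lra.
Qed.

Lemma cn_strip_continuity (d : R) (n : nat) (a : R -> R -> R) :
  cn_strip d n a -> forall t e, Rabs e < d -> continuity_2d_pt a t e.
Proof. destruct n; intros H; apply H. Qed.

Lemma cn_strip_S (d : R) (n : nat) : forall a, cn_strip d (S n) a -> cn_strip d n a.
Proof.
  induction n as [|n IH]; intros a [Hc [a1 [a2 [Hd [H1 H2]]]]].
  - now split.
  - split; [exact Hc|]. exists a1, a2. auto.
Qed.

Lemma cn_strip_ext (d : R) (n : nat) (a b : R -> R -> R) :
  (forall t e, Rabs e < d -> a t e = b t e) -> cn_strip d n a -> cn_strip d n b.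
Proof.
  intros E. destruct n as [|n]; intros [Hc Hn];
  (split; [intros t e He; apply continuity_2d_pt_ext_loc with a;
           [apply (locally_2d_strip d); auto | now apply Hc] |]); [exact I|].
  destruct Hn as [a1 [a2 [Hd [H1 H2]]]]. exists a1, a2.
  split; [|now split]. intros t e He. destruct (Hd t e He) as [D D'].
  split.
  - eapply is_derive_ext; [|exact D]. intros z. simpl. now apply E.
  - eapply is_derive_ext_loc; [|exact D'].
    eapply filter_imp; [|apply (locally_lt_abs d e He)]. intros z Hz. now apply E.
Qed.

Lemma cn_strip_le (d d' : R) (n : nat) : d' <= d ->
  forall a, cn_strip d n a -> cn_strip d' n a.
Proof.
  intros Hd. induction n as [|n IH]; intros a [Hc Hn].
  - split; [|exact I]. intros. apply Hc. lra.
  - destruct Hn as [a1 [a2 [H [H1 H2]]]]. split.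
    + intros. apply Hc. lra.
    + exists a1, a2. split; [|split; auto]. intros. apply H. lra.
Qed.

Lemma cn_strip_const (d : R) (n : nat) : forall c, cn_strip d n (fun _ _ => c).
Proof.
  induction n as [|n IH]; intros c.
  - split; [|exact I]. intros. apply continuity_2d_pt_const.
  - split; [intros; apply continuity_2d_pt_const|].
    exists (fun _ _ => 0), (fun _ _ => 0).
    split; [|split; apply IH]. intros; split; apply @is_derive_const.
Qed.

Lemma cn_strip_fst (d : R) (n : nat) : cn_strip d n (fun t _ => t).
Proof.
  destruct n as [|n]; (split; [intros; apply continuity_2d_pt_id1|]); [exact I|].
  exists (fun _ _ => 1), (fun _ _ => 0).
  split; [|split; apply cn_strip_const].
  intros; split; [apply @is_derive_id|apply @is_derive_const].
Qed.

Lemma cn_strip_snd (d : R) (n : nat) : cn_strip d n (fun _ e => e).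
Proof.
  destruct n as [|n]; (split; [intros; apply continuity_2d_pt_id2|]); [exact I|].
  exists (fun _ _ => 0), (fun _ _ => 1).
  split; [|split; apply cn_strip_const].
  intros; split; [apply @is_derive_const|apply @is_derive_id].
Qed.

Lemma cn_strip_plus (d : R) (n : nat) : forall a b,
  cn_strip d n a -> cn_strip d n b -> cn_strip d n (fun t e => a t e + b t e).
Proof.
  induction n as [|n IH]; intros a b [Ca Ha] [Cb Hb];
    (split; [intros; apply continuity_2d_pt_plus; auto|]); [exact I|].
  destruct Ha as [a1 [a2 [Da [Ha1 Ha2]]]]. destruct Hb as [b1 [b2 [Db [Hb1 Hb2]]]].
  exists (fun t e => a1 t e + b1 t e), (fun t e => a2 t e + b2 t e).
  split; [|split; apply IH; assumption]. intros t e He.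
  destruct (Da t e He), (Db t e He).
  split; now apply (is_derive_plus (K := R_AbsRing) (V := R_NormedModule)).
Qed.

Lemma cn_strip_mult (d : R) (n : nat) : forall a b,
  cn_strip d n a -> cn_strip d n b -> cn_strip d n (fun t e => a t e * b t e).
Proof.
  induction n as [|n IH]; intros a b Ha0 Hb0.
  - split; [|exact I]. intros; apply continuity_2d_pt_mult;
      [now apply (cn_strip_continuity d 0)|now apply (cn_strip_continuity d 0)].
  - pose proof (cn_strip_S _ _ _ Ha0) as Ha'. pose proof (cn_strip_S _ _ _ Hb0) as Hb'.
    destruct Ha0 as [Ca [a1 [a2 [Da [Ha1 Ha2]]]]].
    destruct Hb0 as [Cb [b1 [b2 [Db [Hb1 Hb2]]]]].
    split; [intros; apply continuity_2d_pt_mult; auto|].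
    exists (fun t e => a1 t e * b t e + a t e * b1 t e),
           (fun t e => a2 t e * b t e + a t e * b2 t e).
    split; [|split; apply cn_strip_plus; apply IH; assumption].
    intros t e He. destruct (Da t e He), (Db t e He).
    split.
    + apply (is_derive_mult (fun z => a z e) (fun z => b z e)); auto. exact Rmult_comm.
    + apply (is_derive_mult (fun z => a t z) (fun z => b t z)); auto. exact Rmult_comm.
Qed.

(** Two partial derivatives, the first of them continuous, give total differentiability, which the
    two-variable chain rule asks for. *)
Lemma cn_strip_differentiable (d : R) (a a1 a2 : R -> R -> R) (t e : R) :
  Rabs e < d ->
  (forall t e, Rabs e < d ->
     is_derive (fun z => a z e) t (a1 t e) /\ is_derive (fun z => a t z) e (a2 t e)) ->
  continuity_2d_pt a1 t e ->
  differentiable_pt_lim a t e (a1 t e) (a2 t e).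
Proof.
  intros He Hd Hc. apply filterdiff_differentiable_pt_lim.
  apply (is_derive_filterdiff a t e a1 (a2 t e)).
  - apply (proj1 (locally_2d_locally
      (fun u v => is_derive (fun z => a z v) u (a1 u v)) t e)).
    apply (locally_2d_strip d); [exact He|]. intros u v Hv. now apply Hd.
  - now apply Hd.
  - apply continuity_2d_pt_filterlim in Hc. exact Hc.
Qed.

(** The parameter stays in its slot, as in h o psi. The class of such composites, closed under sums
    and products, contains its own partial derivatives, so induction on n applies to f1, f2, a1 and
    a2. *)
Lemma cn_strip_comp (d : R) (n : nat) : forall f a,
  cn_strip d n f -> cn_strip d n a -> cn_strip d n (fun t e => f (a t e) e).
Proof.
  assert (Hcc : forall f a : R -> R -> R,
    (forall t e, Rabs e < d -> continuity_2d_pt f t e) ->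
    (forall t e, Rabs e < d -> continuity_2d_pt a t e) ->
    forall t e, Rabs e < d -> continuity_2d_pt (fun t e => f (a t e) e) t e).
  { intros f a Cf Ca t e He eps. destruct (Cf (a t e) e He eps) as [d1 H1].
    destruct (Ca t e He d1) as [d2 H2].
    assert (0 < Rmin d1 d2) as Hp by (apply Rmin_pos; apply cond_pos).
    exists (mkposreal _ Hp). simpl. intros u v Hu Hv.
    apply H1.
    - apply H2; (eapply Rlt_le_trans; [eassumption | apply Rmin_r]).
    - eapply Rlt_le_trans; [eassumption | apply Rmin_l]. }
  induction n as [|n IH]; intros f a Hf0 Ha0.
  - split; [|exact I]. apply Hcc; now apply (cn_strip_continuity d 0).
  - pose proof (cn_strip_S _ _ _ Hf0) as Hf'. pose proof (cn_strip_S _ _ _ Ha0) as Ha'.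
    destruct Hf0 as [Cf [f1 [f2 [Df [Hf1 Hf2]]]]].
    destruct Ha0 as [Ca [a1 [a2 [Da [Ha1 Ha2]]]]].
    split; [now apply Hcc|].
    exists (fun t e => f1 (a t e) e * a1 t e),
           (fun t e => f1 (a t e) e * a2 t e + f2 (a t e) e).
    split; [|split].
    + intros t e He. destruct (Da t e He) as [A1 A2].
      pose proof (cn_strip_differentiable d f f1 f2 (a t e) e He Df
                    (cn_strip_continuity _ _ _ Hf1 _ _ He)) as Hdf.
      split.
      * apply is_derive_Reals.
        pose proof (derivable_pt_lim_comp_2d f (fun z => a z e) (fun _ => e) t
          (f1 (a t e) e) (f2 (a t e) e) (a1 t e) 0 Hdf) as Q.
        replace (f1 (a t e) e * a1 t e)
          with (f1 (a t e) e * a1 t e + f2 (a t e) e * 0) by ring.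
        apply Q; apply is_derive_Reals; [exact A1 | apply @is_derive_const].
      * apply is_derive_Reals.
        pose proof (derivable_pt_lim_comp_2d f (fun z => a t z) (fun z => z) e
          (f1 (a t e) e) (f2 (a t e) e) (a2 t e) 1 Hdf) as Q.
        replace (f1 (a t e) e * a2 t e + f2 (a t e) e)
          with (f1 (a t e) e * a2 t e + f2 (a t e) e * 1) by ring.
        apply Q; apply is_derive_Reals; [exact A2 | apply @is_derive_id].
    + apply cn_strip_mult; auto.
    + apply cn_strip_plus; [apply cn_strip_mult|]; auto.
Qed.

Lemma cn_strip_lift (d : R) (n : nat) : forall f : R -> R,
  (forall k t, ex_derive_n f k t) -> cn_strip d n (fun t _ => f t).
Proof.
  assert (Hc : forall f : R -> R, (forall t, ex_derive f t) ->
    forall t e : R, continuity_2d_pt (fun t _ => f t) t e).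
  { intros f Hf t e. apply (continuity_1d_2d_pt_comp f (fun t _ => t)).
    - apply continuity_pt_filterlim. apply (ex_derive_continuous f t (Hf t)).
    - apply continuity_2d_pt_id1. }
  induction n as [|n IH]; intros f Hf;
    (split; [intros; apply Hc; intros; apply (Hf 1%nat)|]); [exact I|].
  exists (fun t _ => Derive f t), (fun _ _ => 0). split; [|split].
  - intros t e He. split.
    + apply Derive_correct. apply (Hf 1%nat).
    + apply @is_derive_const.
  - apply IH. intros [|k] t; [exact I|].
    specialize (Hf (S (S k)) t). simpl in Hf |- *.
    eapply ex_derive_ext; [|exact Hf]. intros z.
    pose proof (Derive_n_comp f k 1 z) as E. rewrite Nat.add_comm in E.
    symmetry. exact E.
  - apply cn_strip_const.
Qed.

Lemma cn_strip_D1 (d : R) (n : nat) (a : R -> R -> R) :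
  cn_strip d (S n) a -> cn_strip d n (D1 a).
Proof.
  intros [_ [a1 [a2 [Hd [H1 _]]]]]. eapply cn_strip_ext; [|exact H1].
  intros t e He. symmetry. apply is_derive_unique. now apply Hd.
Qed.

Lemma cn_strip_D2 (d : R) (n : nat) (a : R -> R -> R) :
  cn_strip d (S n) a -> cn_strip d n (D2 a).
Proof.
  intros [_ [a1 [a2 [Hd [_ H2]]]]]. eapply cn_strip_ext; [|exact H2].
  intros t e He. symmetry. apply is_derive_unique. now apply Hd.
Qed.

Lemma cn_strip_ex_diff (d : R) (n : nat) : forall a,
  cn_strip d n a -> forall t e, Rabs e < d -> ex_diff_n a n t e.
Proof.
  induction n as [|n IH]; intros a Ha t e He.
  - split; [now apply (cn_strip_continuity d 0)|exact I].
  - split; [now apply (cn_strip_continuity d (S n))|].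
    split; [|split; [|split]].
    + destruct Ha as [_ [a1 [a2 [Hd _]]]]. exists (a1 t e). now apply Hd.
    + destruct Ha as [_ [a1 [a2 [Hd _]]]]. exists (a2 t e). now apply Hd.
    + apply (IH (D1 a)); auto. now apply cn_strip_D1.
    + apply (IH (D2 a)); auto. now apply cn_strip_D2.
Qed.

Lemma ex_diff_cn_strip (d : R) (n : nat) : forall a,
  (forall t e, Rabs e < d -> ex_diff_n a n t e) -> cn_strip d n a.
Proof.
  induction n as [|n IH]; intros a Ha;
    (split; [intros t e He; now apply (Ha t e He)|]); [exact I|].
  exists (D1 a), (D2 a). split; [|split].
  - intros t e He. destruct (Ha t e He) as [_ [H1 [H2 _]]].
    split; now apply Derive_correct.
  - apply IH. intros t e He. now apply (Ha t e He).
  - apply IH. intros t e He. now apply (Ha t e He).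
Qed.

Lemma smooth_on_ext (d : R) (a b : R -> R -> R) :
  (forall t e, Rabs e < d -> a t e = b t e) -> smooth_on d a -> smooth_on d b.
Proof. intros E H n. now apply cn_strip_ext with a. Qed.

Lemma smooth_on_le (d d' : R) (a : R -> R -> R) :
  d' <= d -> smooth_on d a -> smooth_on d' a.
Proof. intros E H n. now apply cn_strip_le with d. Qed.

Lemma smooth_on_const (d c : R) : smooth_on d (fun _ _ => c).
Proof. intros n. apply cn_strip_const. Qed.

Lemma smooth_on_fst (d : R) : smooth_on d (fun t _ => t).
Proof. intros n. apply cn_strip_fst. Qed.

Lemma smooth_on_snd (d : R) : smooth_on d (fun _ e => e).
Proof. intros n. apply cn_strip_snd. Qed.

Lemma smooth_on_plus (d : R) (a b : R -> R -> R) :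
  smooth_on d a -> smooth_on d b -> smooth_on d (fun t e => a t e + b t e).
Proof. intros Ha Hb n. now apply cn_strip_plus. Qed.

Lemma smooth_on_mult (d : R) (a b : R -> R -> R) :
  smooth_on d a -> smooth_on d b -> smooth_on d (fun t e => a t e * b t e).
Proof. intros Ha Hb n. now apply cn_strip_mult. Qed.

Lemma smooth_on_scal (d c : R) (a : R -> R -> R) :
  smooth_on d a -> smooth_on d (fun t e => c * a t e).
Proof. intros Ha. apply smooth_on_mult; [apply smooth_on_const|exact Ha]. Qed.

Lemma smooth_on_minus (d : R) (a b : R -> R -> R) :
  smooth_on d a -> smooth_on d b -> smooth_on d (fun t e => a t e - b t e).
Proof.
  intros Ha Hb. apply smooth_on_ext with (fun t e => a t e + (-1) * b t e).
  - intros; ring.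
  - apply smooth_on_plus; [|apply smooth_on_scal]; assumption.
Qed.

Lemma smooth_on_comp (d : R) (f a : R -> R -> R) :
  smooth_on d f -> smooth_on d a -> smooth_on d (fun t e => f (a t e) e).
Proof. intros Ha Hb n. now apply cn_strip_comp. Qed.

Lemma smooth_on_lift (d : R) (f : R -> R) :
  (forall k t, ex_derive_n f k t) -> smooth_on d (fun t _ => f t).
Proof. intros H n. now apply cn_strip_lift. Qed.

Lemma smooth_on_shift (d c : R) (a : R -> R -> R) :
  smooth_on d a -> smooth_on d (fun t e => a (t + c) e).
Proof.
  intros H. apply (smooth_on_comp d a (fun t _ => t + c)); [exact H|].
  apply smooth_on_plus; [apply smooth_on_fst|apply smooth_on_const].
Qed.

Lemma smooth_on_D1 (d : R) (a : R -> R -> R) : smooth_on d a -> smooth_on d (D1 a).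
Proof. intros H n. apply cn_strip_D1, H. Qed.

Lemma smooth_on_D2 (d : R) (a : R -> R -> R) : smooth_on d a -> smooth_on d (D2 a).
Proof. intros H n. apply cn_strip_D2, H. Qed.

Lemma smooth_on_pow (d : R) (k : nat) : smooth_on d (fun _ e => e ^ k).
Proof.
  induction k as [|k IH]; simpl; [apply smooth_on_const|].
  apply smooth_on_mult; [apply smooth_on_snd|exact IH].
Qed.

(** All derivatives stay in the span of sine and cosine; differentiation turns the coefficients (a,
    b) into (-b, a). *)
Lemma ex_derive_n_sin_cos (k : nat) :
  (forall t, ex_derive_n sin k t) /\ (forall t, ex_derive_n cos k t).
Proof.
  assert (H : forall k, exists a b : R,
    (forall t, Derive_n sin k t = a * sin t + b * cos t) /\
    (forall t, Derive_n cos k t = a * cos t - b * sin t)).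
  { clear k. induction k as [|k [a [b [Hs Hc]]]].
    - exists 1, 0. split; intros t; simpl; ring.
    - exists (-b), a. split; intros t; simpl.
      + rewrite (Derive_ext _ _ t Hs). apply is_derive_unique. auto_derive; [exact I|ring].
      + rewrite (Derive_ext _ _ t Hc). apply is_derive_unique. auto_derive; [exact I|ring]. }
  destruct k as [|k]; [now split|].
  destruct (H k) as [a [b [Hs Hc]]]. split; intros t; simpl.
  - eapply ex_derive_ext; [intros z; symmetry; apply Hs|]. auto_derive; exact I.
  - eapply ex_derive_ext; [intros z; symmetry; apply Hc|]. auto_derive; exact I.
Qed.

Lemma smooth_on_sin (d : R) (a : R -> R -> R) :
  smooth_on d a -> smooth_on d (fun t e => sin (a t e)).
Proof.
  intros H. apply (smooth_on_comp d (fun x _ => sin x)); [|exact H].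
  apply smooth_on_lift. intros k. apply ex_derive_n_sin_cos.
Qed.

Lemma smooth_on_cos (d : R) (a : R -> R -> R) :
  smooth_on d a -> smooth_on d (fun t e => cos (a t e)).
Proof.
  intros H. apply (smooth_on_comp d (fun x _ => cos x)); [|exact H].
  apply smooth_on_lift. intros k. apply ex_derive_n_sin_cos.
Qed.

Lemma smooth_on_sum (d : R) (a : nat -> R -> R -> R) (n : nat) :
  (forall j, (j <= n)%nat -> smooth_on d (a j)) ->
  smooth_on d (fun t e => sum_n (fun j => a j t e) n).
Proof.
  induction n as [|n IH]; intros H.
  - apply smooth_on_ext with (a 0%nat); [|apply H; lia].
    intros. now rewrite sum_O.
  - apply smooth_on_ext with (fun t e => sum_n (fun j => a j t e) n + a (S n) t e).
    + intros. now rewrite sum_Sn.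
    + apply smooth_on_plus; [apply IH; intros; apply H; lia|apply H; lia].
Qed.

Lemma smooth_strip_on (d : R) (a : R -> R -> R) : smooth_strip d a -> smooth_on d a.
Proof.
  intros [d' [b [Hd [E Hb]]]]. apply smooth_on_ext with b.
  - intros; apply E; lra.
  - apply smooth_on_le with d'; [lra|]. intros n. apply ex_diff_cn_strip. auto.
Qed.

Lemma smooth_on_strip (d d' : R) (a : R -> R -> R) :
  d' < d -> smooth_on d a -> smooth_strip d' a.
Proof.
  intros Hd H. exists d, a. split; [exact Hd|]. split; [auto|].
  intros n t e He. now apply (cn_strip_ex_diff d).
Qed.

Lemma smooth_on_ex_derive_1 (d : R) (a : R -> R -> R) (t e : R) :
  smooth_on d a -> Rabs e < d -> ex_derive (fun z => a z e) t.
Proof.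
  intros H He. destruct (H 1%nat) as [_ [a1 [a2 [Hd _]]]]. exists (a1 t e). now apply Hd.
Qed.

Lemma smooth_on_is_derive_1 (d : R) (a : R -> R -> R) (t e : R) :
  smooth_on d a -> Rabs e < d -> is_derive (fun z => a z e) t (D1 a t e).
Proof. intros H He. apply Derive_correct. now apply (smooth_on_ex_derive_1 d). Qed.

Lemma smooth_on_ex_derive_2 (d : R) (a : R -> R -> R) (t e : R) :
  smooth_on d a -> Rabs e < d -> ex_derive (fun z => a t z) e.
Proof.
  intros H He. destruct (H 1%nat) as [_ [a1 [a2 [Hd _]]]]. exists (a2 t e). now apply Hd.
Qed.

Lemma smooth_on_Derive_n_1 (d : R) (a : R -> R -> R) (k : nat) :
  smooth_on d a -> smooth_on d (fun t e => Derive_n (fun z => a z e) k t).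
Proof.
  intros H. induction k as [|k IH]; [exact H|]. simpl. now apply (smooth_on_D1 d) in IH.
Qed.

Lemma smooth_on_Derive_n_2 (d : R) (a : R -> R -> R) (k : nat) :
  smooth_on d a -> smooth_on d (fun t e => Derive_n (fun z => a t z) k e).
Proof.
  intros H. induction k as [|k IH]; [exact H|]. simpl. now apply (smooth_on_D2 d) in IH.
Qed.

Lemma smooth_on_ex_derive_n_1 (d : R) (a : R -> R -> R) (k : nat) (t e : R) :
  smooth_on d a -> Rabs e < d -> ex_derive_n (fun z => a z e) k t.
Proof.
  intros H He. destruct k as [|k]; [exact I|]. simpl.
  apply (smooth_on_ex_derive_1 d (fun t e => Derive_n (fun z => a z e) k t)); [|exact He].
  now apply smooth_on_Derive_n_1.
Qed.

Lemma smooth_on_ex_derive_n_2 (d : R) (a : R -> R -> R) (k : nat) (t e : R) :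
  smooth_on d a -> Rabs e < d -> ex_derive_n (fun z => a t z) k e.
Proof.
  intros H He. destruct k as [|k]; [exact I|]. simpl.
  apply (smooth_on_ex_derive_2 d (fun t e => Derive_n (fun z => a t z) k e)); [|exact He].
  now apply smooth_on_Derive_n_2.
Qed.

Lemma smooth_on_D1_D2 (d : R) (a : R -> R -> R) (t e : R) :
  smooth_on d a -> Rabs e < d -> D1 (D2 a) t e = D2 (D1 a) t e.
Proof.
  intros H He. apply (Schwarz a t e).
  - apply (locally_2d_strip d); [exact He|]. intros u v Hv. repeat split.
    + now apply (smooth_on_ex_derive_1 d).
    + now apply (smooth_on_ex_derive_2 d).
    + apply (smooth_on_ex_derive_1 d (D2 a)); [now apply smooth_on_D2|exact Hv].
    + apply (smooth_on_ex_derive_2 d (D1 a)); [now apply smooth_on_D1|exact Hv].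
  - apply (cn_strip_continuity d 0 (D1 (D2 a))); [|exact He].
    apply smooth_on_D1. now apply smooth_on_D2.
  - apply (cn_strip_continuity d 0 (D2 (D1 a))); [|exact He].
    apply smooth_on_D2. now apply smooth_on_D1.
Qed.

Lemma smooth_on_D1_Derive_n_2 (d : R) (a : R -> R -> R) (k : nat) : smooth_on d a ->
  forall t e, Rabs e < d ->
  Derive (fun t => Derive_n (fun z => a t z) k e) t
  = Derive_n (fun z => D1 a t z) k e.
Proof.
  intros H. induction k as [|k IH]; intros t e He; [reflexivity|].
  pose proof (smooth_on_D1_D2 d (fun t e => Derive_n (fun z => a t z) k e) t e
    (smooth_on_Derive_n_2 d a k H) He) as Hs.
  etransitivity; [exact Hs|].
  apply Derive_ext_loc. eapply filter_imp; [|apply (locally_lt_abs d e He)].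
  intros z Hz. now apply IH.
Qed.

(** * Taylor expansions in the parameter *)

Lemma bigO_eps_intro (n : nat) (a : R -> R -> R) (K d : R) : 0 < d ->
  (forall t e, Rabs e < d -> Rabs (a t e) <= K * Rabs e ^ n) -> bigO_eps n a.
Proof.
  intros Hd H. exists K, (d / 2). split; [lra|]. intros t e He. apply H. lra.
Qed.

(** Normalized constants: K >= 0 allows bounds to be multiplied, and d <= 1 makes powers of |eps|
    decrease with the exponent. *)
Lemma bigO_eps_elim (n : nat) (a : R -> R -> R) : bigO_eps n a ->
  exists K d, 0 <= K /\ 0 < d /\ d <= 1 /\
    forall t e, Rabs e < d -> Rabs (a t e) <= K * Rabs e ^ n.
Proof.
  intros [K [d [Hd H]]]. exists (Rabs K), (Rmin d 1).
  split; [apply Rabs_pos|]. split; [apply Rmin_pos; lra|]. split; [apply Rmin_r|].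
  intros t e He. assert (Rabs e <= d) as He' by (pose proof (Rmin_l d 1); lra).
  eapply Rle_trans; [now apply H|]. apply Rmult_le_compat_r.
  - apply pow_le, Rabs_pos.
  - apply Rle_abs.
Qed.

Lemma bigO_eps_ext (n : nat) (d : R) (a b : R -> R -> R) : 0 < d ->
  (forall t e, Rabs e < d -> a t e = b t e) -> bigO_eps n a -> bigO_eps n b.
Proof.
  intros Hd E Ha. destruct (bigO_eps_elim _ _ Ha) as [K [d' [HK [Hd' [_ H]]]]].
  apply bigO_eps_intro with K (Rmin d d'); [now apply Rmin_pos|].
  intros t e He. pose proof (Rmin_l d d'). pose proof (Rmin_r d d').
  rewrite <- E by lra. apply H. lra.
Qed.

Lemma bigO_eps_plus (n : nat) (a b : R -> R -> R) :
  bigO_eps n a -> bigO_eps n b -> bigO_eps n (fun t e => a t e + b t e).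
Proof.
  intros Ha Hb. destruct (bigO_eps_elim _ _ Ha) as [K [d [HK [Hd [_ H]]]]].
  destruct (bigO_eps_elim _ _ Hb) as [K' [d' [HK' [Hd' [_ H']]]]].
  apply bigO_eps_intro with (K + K') (Rmin d d'); [now apply Rmin_pos|].
  intros t e He. pose proof (Rmin_l d d'). pose proof (Rmin_r d d').
  eapply Rle_trans; [apply Rabs_triang|]. rewrite Rmult_plus_distr_r.
  apply Rplus_le_compat; [apply H|apply H']; lra.
Qed.

Lemma bigO_eps_mult (n m : nat) (a b : R -> R -> R) :
  bigO_eps n a -> bigO_eps m b -> bigO_eps (n + m) (fun t e => a t e * b t e).
Proof.
  intros Ha Hb. destruct (bigO_eps_elim _ _ Ha) as [K [d [HK [Hd [_ H]]]]].
  destruct (bigO_eps_elim _ _ Hb) as [K' [d' [HK' [Hd' [_ H']]]]].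
  apply bigO_eps_intro with (K * K') (Rmin d d'); [now apply Rmin_pos|].
  intros t e He. pose proof (Rmin_l d d'). pose proof (Rmin_r d d').
  rewrite Rabs_mult, pow_add.
  replace (K * K' * (Rabs e ^ n * Rabs e ^ m))
    with ((K * Rabs e ^ n) * (K' * Rabs e ^ m)) by ring.
  apply Rmult_le_compat; try apply Rabs_pos; [apply H|apply H']; lra.
Qed.

Lemma bigO_eps_const (c : R) : bigO_eps 0 (fun _ _ => c).
Proof.
  apply bigO_eps_intro with (Rabs c) 1; [lra|]. intros. simpl. lra.
Qed.

Lemma bigO_eps_scal (n : nat) (c : R) (a : R -> R -> R) :
  bigO_eps n a -> bigO_eps n (fun t e => c * a t e).
Proof. intros Ha. apply (bigO_eps_mult 0 n); [apply bigO_eps_const|exact Ha]. Qed.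

Lemma bigO_eps_minus (n : nat) (a b : R -> R -> R) :
  bigO_eps n a -> bigO_eps n b -> bigO_eps n (fun t e => a t e - b t e).
Proof.
  intros Ha Hb. apply bigO_eps_ext with 1 (fun t e => a t e + (-1) * b t e); [lra| |].
  - intros; ring.
  - apply bigO_eps_plus; [|apply bigO_eps_scal]; assumption.
Qed.

Lemma bigO_eps_le (n m : nat) (a : R -> R -> R) :
  (n <= m)%nat -> bigO_eps m a -> bigO_eps n a.
Proof.
  intros Hnm Ha. destruct (bigO_eps_elim _ _ Ha) as [K [d [HK [Hd [Hd1 H]]]]].
  apply bigO_eps_intro with K d; [exact Hd|]. intros t e He.
  eapply Rle_trans; [now apply H|]. apply Rmult_le_compat_l; [exact HK|].
  replace m with (n + (m - n))%nat by lia. rewrite pow_add.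
  rewrite <- (Rmult_1_r (Rabs e ^ n)) at 2.
  apply Rmult_le_compat_l; [apply pow_le, Rabs_pos|].
  rewrite <- (pow1 (m - n)). apply pow_incr. split; [apply Rabs_pos|lra].
Qed.

Lemma bigO_eps_dom (n : nat) (C : R) (a b : R -> R -> R) :
  (forall t e, Rabs (b t e) <= C * Rabs (a t e)) -> bigO_eps n a -> bigO_eps n b.
Proof.
  intros Hab Ha. destruct (bigO_eps_elim _ _ Ha) as [K [d [HK [Hd [_ H]]]]].
  apply bigO_eps_intro with (Rabs C * K) d; [exact Hd|]. intros t e He.
  eapply Rle_trans; [apply Hab|]. rewrite Rmult_assoc.
  apply Rle_trans with (Rabs C * Rabs (a t e)).
  - apply Rmult_le_compat_r; [apply Rabs_pos|apply Rle_abs].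
  - apply Rmult_le_compat_l; [apply Rabs_pos|now apply H].
Qed.

Lemma bigO_eps_pow (n : nat) : bigO_eps n (fun _ e => e ^ n).
Proof.
  apply bigO_eps_intro with 1 1; [lra|]. intros. rewrite <- RPow_abs. lra.
Qed.

Lemma bigO_eps_slice (n : nat) (a : R -> R -> R) (t : R) :
  bigO_eps n a -> bigO_eps n (fun _ e => a t e).
Proof. intros [K [d [Hd H]]]. exists K, d. split; auto. Qed.

(** Uniformity in t allows any substitution for t, in particular t = psi(t; eps). *)
Lemma bigO_eps_reparam (n : nat) (a x : R -> R -> R) :
  bigO_eps n a -> bigO_eps n (fun t e => a (x t e) e).
Proof. intros [K [d [Hd H]]]. exists K, d. split; auto. Qed.

Lemma bigO_eps_sum (n m : nat) (a : nat -> R -> R -> R) :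
  (forall j, (j <= m)%nat -> bigO_eps n (a j)) ->
  bigO_eps n (fun t e => sum_n (fun j => a j t e) m).
Proof.
  induction m as [|m IH]; intros H.
  - apply bigO_eps_ext with 1 (a 0%nat); [lra| |apply H; lia].
    intros. now rewrite sum_O.
  - apply bigO_eps_ext with 1 (fun t e => sum_n (fun j => a j t e) m + a (S m) t e);
      [lra| |].
    + intros. now rewrite sum_Sn.
    + apply bigO_eps_plus; [apply IH; intros; apply H; lia|apply H; lia].
Qed.

Lemma sum_n_Sr (a : nat -> R) (n : nat) : sum_n a (S n) = sum_n a n + a (S n).
Proof. rewrite sum_Sn. reflexivity. Qed.

(** * Periodic functions and bounds uniform in t *)

Lemma periodic_mult (f : R -> R) (n : nat) (t : R) :
  periodic f -> f (t + 2 * PI * INR n) = f t.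
Proof.
  intros H. induction n as [|n IH].
  - simpl. f_equal. ring.
  - rewrite S_INR. rewrite <- IH. rewrite <- (H (t + 2 * PI * INR n)). f_equal. ring.
Qed.

Lemma periodic_mult_Z (f : R -> R) (n : Z) (t : R) :
  periodic f -> f (t + 2 * PI * IZR n) = f t.
Proof.
  intros H. destruct (Z.le_gt_cases 0 n) as [Hn|Hn].
  - rewrite <- (Z2Nat.id n Hn), <- INR_IZR_INZ. now apply periodic_mult.
  - rewrite <- (periodic_mult f (Z.to_nat (- n)) _ H). f_equal.
    rewrite INR_IZR_INZ, Z2Nat.id by lia. rewrite opp_IZR. ring.
Qed.

(** The representative u of t modulo 2 pi is independent of f, so it serves every slice a(.; e). *)
Lemma periodic_reduce (t : R) :
  exists u, 0 <= u <= 2 * PI /\ forall f, periodic f -> f t = f u.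
Proof.
  pose proof PI_RGT_0 as HP.
  exists (t - 2 * PI * IZR (Int_part (t / (2 * PI)))). split.
  - destruct (base_Int_part (t / (2 * PI))) as [H1 H2].
    assert (t = 2 * PI * (t / (2 * PI))) as E by (field; lra).
    split.
    + rewrite E at 1. nra.
    + rewrite E at 1. nra.
  - intros f Hf. rewrite <- (periodic_mult_Z f (Int_part (t / (2 * PI))) (_ - _) Hf).
    f_equal. ring.
Qed.

Lemma smooth_on_continuous_1 (d : R) (a : R -> R -> R) (t e : R) :
  smooth_on d a -> Rabs e < d -> continuity_pt (fun z => a z e) t.
Proof.
  intros H He. apply continuity_pt_filterlim.
  apply (ex_derive_continuous (fun z => a z e)). now apply (smooth_on_ex_derive_1 d).
Qed.

(** Compactness of a period: for small e the value a(t; e) is within 1 of a(t; 0), which is bounded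
    on [0, 2 pi]. *)
Lemma smooth_periodic_bounded (d : R) (a : R -> R -> R) : 0 < d -> smooth_on d a ->
  (forall t e, Rabs e < d -> a (t + 2 * PI) e = a t e) -> bigO_eps 0 a.
Proof.
  intros Hd Ha Hp. pose proof PI_RGT_0 as HP.
  assert (Rabs 0 < d) as H0 by (rewrite Rabs_R0; exact Hd).
  destruct (uniform_continuity_2d_1d a 0 (2 * PI) 0) with (eps := mkposreal 1 Rlt_0_1)
    as [del Hdel].
  { intros x _. now apply (cn_strip_continuity d 0). }
  destruct (continuity_ab_maj (fun t => Rabs (a t 0)) 0 (2 * PI)) as [M [HM _]]; [lra| |].
  { intros c _. apply (continuity_pt_comp (fun t => a t 0) Rabs).
    - now apply (smooth_on_continuous_1 d).
    - apply Rcontinuity_abs. }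
  apply bigO_eps_intro with (Rabs (a M 0) + 1) (Rmin d del).
  { apply Rmin_pos; [exact Hd|apply cond_pos]. }
  intros t e He. pose proof (Rmin_l d del). pose proof (Rmin_r d del).
  destruct (periodic_reduce t) as [u [Hu Ru]].
  rewrite (Ru (fun t => a t e)) by (intros s; apply Hp; lra).
  specialize (HM u Hu). specialize (Hdel u 0 u e Hu).
  assert (Rabs (a u e - a u 0) < 1).
  { apply Hdel; try (split; assert (K := cond_pos del); lra); auto.
    - assert (Rabs e < del) as He' by lra. apply Rabs_def2 in He'. lra.
    - replace (u - u) with 0 by ring. rewrite Rabs_R0. apply cond_pos. }
  replace (a u e) with ((a u e - a u 0) + a u 0) by ring.
  eapply Rle_trans; [apply Rabs_triang|]. simpl. lra.
Qed.

Lemma sum_n_pow_0 (c : nat -> R) (k : nat) :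
  sum_n (fun j => 0 ^ j * c j) k = c 0%nat.
Proof.
  induction k as [|k IH].
  - rewrite sum_O. simpl. ring.
  - rewrite sum_Sn, IH. unfold plus; simpl. ring.
Qed.

(** Lagrange remainder to the right of 0, with the factor 1/(k+1)! bounded by 1. *)
Lemma taylor_bound_pos (f : R -> R) (k : nat) (d M e : R) :
  (forall j x, Rabs x < d -> ex_derive_n f j x) ->
  (forall x, Rabs x < d -> Rabs (Derive_n f (S k) x) <= M) ->
  0 < e < d ->
  Rabs (f e - sum_n (fun j => e ^ j * (Derive_n f j 0 / INR (fact j))) k)
    <= M * Rabs e ^ S k.
Proof.
  intros Hs HM He.
  destruct (Taylor_Lagrange f k 0 e) as [z [Hz E]]; [lra| |].
  { intros x Hx j _. apply Hs. rewrite Rabs_pos_eq; lra. }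
  rewrite E, sum_n_Reals.
  rewrite (sum_eq (fun m => (e - 0) ^ m / INR (fact m) * Derive_n f m 0)
    (fun j => e ^ j * (Derive_n f j 0 / INR (fact j))) k).
  2: { intros i _. rewrite Rminus_0_r. field. apply INR_fact_neq_0. }
  match goal with |- Rabs (?x + ?y - ?x) <= _ => replace (x + y - x) with y by ring end.
  rewrite Rminus_0_r, Rabs_mult, Rmult_comm. unfold Rdiv.
  rewrite Rabs_mult, <- RPow_abs.
  assert (0 <= Rabs e ^ S k) as Hp by (apply pow_le, Rabs_pos).
  assert (Rabs (/ INR (fact (S k))) <= 1) as Hf.
  { rewrite Rabs_pos_eq.
    - rewrite <- Rinv_1. apply Rinv_le_contravar; [lra|].
      change 1 with (INR 1). apply le_INR, lt_O_fact.
    - left. apply Rinv_0_lt_compat, INR_fact_lt_0. }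
  apply Rmult_le_compat.
  - apply Rabs_pos.
  - apply Rmult_le_pos; [exact Hp|apply Rabs_pos].
  - apply HM. rewrite Rabs_pos_eq; lra.
  - rewrite <- (Rmult_1_r (Rabs e ^ S k)) at 2.
    now apply Rmult_le_compat_l.
Qed.

(** The side e < 0 follows from the side e > 0 applied to y |-> f(-y), whose j-th derivative carries
    the sign (-1)^j. *)
Lemma taylor_bound (f : R -> R) (k : nat) (d M e : R) :
  (forall j x, Rabs x < d -> ex_derive_n f j x) ->
  (forall x, Rabs x < d -> Rabs (Derive_n f (S k) x) <= M) ->
  Rabs e < d ->
  Rabs (f e - sum_n (fun j => e ^ j * (Derive_n f j 0 / INR (fact j))) k)
    <= M * Rabs e ^ S k.
Proof.
  intros Hs HM He. destruct (Rtotal_order e 0) as [Hn|[H0|Hp]].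
  - assert (forall j x, Rabs x < d ->
      Derive_n (fun y => f (- y)) j x = (-1) ^ j * Derive_n f j (- x)) as Ho.
    { intros j x Hx. apply Derive_n_comp_opp.
      eapply filter_imp; [|apply (locally_lt_abs d (- x)); now rewrite Rabs_Ropp].
      intros z Hz i _. now apply Hs. }
    pose proof (taylor_bound_pos (fun y => f (- y)) k d M (- e)) as T.
    rewrite Rabs_Ropp, Ropp_involutive in T.
    replace (f e - sum_n (fun j => e ^ j * (Derive_n f j 0 / INR (fact j))) k)
      with (f e - sum_n (fun j => (- e) ^ j *
             (Derive_n (fun y => f (- y)) j 0 / INR (fact j))) k).
    + apply T.
      * intros j x Hx. apply ex_derive_n_comp_opp.
        eapply filter_imp; [|apply (locally_lt_abs d (- x)); now rewrite Rabs_Ropp].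
        intros z Hz i _. now apply Hs.
      * intros x Hx. rewrite Ho by exact Hx. rewrite Rabs_mult, <- RPow_abs.
        rewrite Rabs_m1, pow1, Rmult_1_l. apply HM. now rewrite Rabs_Ropp.
      * rewrite Rabs_left in He by exact Hn. lra.
    + f_equal. apply sum_n_ext. intros j. rewrite Ho.
      * rewrite Ropp_0.
        assert ((- e) ^ j * (-1) ^ j = e ^ j) as <-
          by (rewrite <- Rpow_mult_distr; f_equal; ring).
        unfold Rdiv. req. ring.
      * rewrite Rabs_R0. pose proof (Rabs_pos e). lra.
  - subst e. rewrite (sum_n_pow_0 (fun j => Derive_n f j 0 / INR (fact j))).
    simpl. rewrite Rdiv_1_r, Rminus_diag, Rabs_R0, Rmult_0_l, Rmult_0_r. lra.
  - apply taylor_bound_pos with d; auto. rewrite Rabs_pos_eq in He; lra.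
Qed.

(** The eps-derivative of order k + 1 is again smooth and periodic, hence bounded uniformly in t,
    and it controls the remainder. *)
Lemma taylor_expansion (d : R) (a : R -> R -> R) (k : nat) : 0 < d -> smooth_on d a ->
  (forall t e, Rabs e < d -> a (t + 2 * PI) e = a t e) ->
  bigO_eps (S k) (fun t e => a t e - sum_n (fun j => e ^ j * taylor_coef a j t) k).
Proof.
  intros Hd Ha Hp.
  destruct (bigO_eps_elim 0 (fun t e => Derive_n (fun z => a t z) (S k) e))
    as [K [d' [HK [Hd' [_ H]]]]].
  { apply (smooth_periodic_bounded d); [exact Hd|now apply smooth_on_Derive_n_2|].
    intros t e He. apply Derive_n_ext_loc.
    eapply filter_imp; [|apply (locally_lt_abs d e He)]. intros z Hz. now apply Hp. }
  apply bigO_eps_intro with K (Rmin d d'); [now apply Rmin_pos|].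
  intros t e He. pose proof (Rmin_l d d'). pose proof (Rmin_r d d').
  apply taylor_bound with (d := Rmin d d').
  - intros j x Hx. apply (smooth_on_ex_derive_n_2 d); [exact Ha|lra].
  - intros x Hx. specialize (H t x). simpl pow in H. rewrite Rmult_1_r in H.
    apply H. lra.
  - exact He.
Qed.

Lemma smooth_on_slice (d : R) (a : R -> R -> R) (t : R) :
  smooth_on d a -> smooth_on d (fun _ e => a t e).
Proof.
  intros H. apply (smooth_on_comp d a (fun _ _ => t)); [exact H|apply smooth_on_const].
Qed.

(** At a fixed t a slice is constant in its first variable, hence periodic. This form serves [phi]
    and [psi], which grow by 2 pi over a period. *)
Lemma taylor_expansion_slice (d : R) (a : R -> R -> R) (k : nat) (t : R) :
  0 < d -> smooth_on d a ->
  bigO_eps (S k) (fun _ e => a t e - sum_n (fun j => e ^ j * taylor_coef a j t) k).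
Proof.
  intros Hd Ha. apply (taylor_expansion d (fun _ e => a t e) k Hd).
  - now apply smooth_on_slice.
  - reflexivity.
Qed.

Lemma bigO_eps_monomial_zero (c : R) (k : nat) :
  bigO_eps (S k) (fun _ e => e ^ k * c) -> c = 0.
Proof.
  intros H. destruct (bigO_eps_elim _ _ H) as [K [d [HK [Hd [Hd1 Hb]]]]].
  apply NNPP. intros Hc.
  assert (0 < Rabs c) as Hc' by now apply Rabs_pos_lt.
  (* At this e the estimate gives |c| <= K e, while 2 (K + 1) e <= |c| by the choice of e: a
     contradiction. Adding 1 to K avoids dividing by 0. *)
  set (e := Rmin (d / 2) (Rabs c / (2 * (K + 1)))).
  assert (0 < e) as He.
  { apply Rmin_pos; [lra|]. apply Rdiv_lt_0_compat; lra. }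
  assert (e <= d / 2) by apply Rmin_l.
  assert (e <= Rabs c / (2 * (K + 1))) as He2 by apply Rmin_r.
  specialize (Hb 0 e). rewrite Rabs_mult, <- RPow_abs in Hb.
  rewrite (Rabs_pos_eq e) in Hb by lra.
  specialize (Hb ltac:(lra)). simpl in Hb.
  assert (0 < e ^ k) as Hek by now apply pow_lt.
  assert (Rabs c <= K * e) as H1 by nra.
  assert (e * (2 * (K + 1)) <= Rabs c) as H2.
  { apply Rmult_le_compat_r with (r := 2 * (K + 1)) in He2; [|lra].
    unfold Rdiv in He2. rewrite Rmult_assoc, Rinv_l in He2 by lra. lra. }
  nra.
Qed.

(** The top term costs only one order, so the induction hypothesis kills the lower coefficients, and
    what remains is a single monomial. *)
Lemma bigO_eps_poly (c : nat -> R) (k : nat) :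
  bigO_eps (S k) (fun _ e => sum_n (fun j => e ^ j * c j) k) ->
  forall j, (j <= k)%nat -> c j = 0.
Proof.
  induction k as [|k IH]; intros H j Hj.
  - replace j with 0%nat by lia. apply (bigO_eps_monomial_zero _ 0).
    eapply bigO_eps_ext; [apply Rlt_0_1| |exact H]. intros. simpl. now rewrite sum_O.
  - assert (forall j, (j <= k)%nat -> c j = 0) as Hlt.
    { apply IH. apply bigO_eps_ext with 1
        (fun _ e => sum_n (fun j => e ^ j * c j) (S k) - c (S k) * e ^ (S k)); [lra| |].
      - intros. rewrite sum_Sn. unfold plus; simpl. ring.
      - apply bigO_eps_minus; [now apply bigO_eps_le with (S (S k)); [lia|]|].
        apply bigO_eps_scal, bigO_eps_pow. }
    destruct (Nat.eq_dec j (S k)) as [->|Hne]; [|apply Hlt; lia].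
    apply (bigO_eps_monomial_zero _ (S k)).
    eapply bigO_eps_ext; [apply Rlt_0_1| |exact H]. intros t e _. cbv beta.
    rewrite sum_Sn. rewrite (sum_n_ext_loc _ (fun _ => 0) k).
    + rewrite sum_n_const. unfold plus; simpl. ring.
    + intros i Hi. rewrite Hlt by exact Hi. req. ring.
Qed.

(** Converts an estimate into identities between coefficients: the difference of the two Taylor
    polynomials and of c eps^k is a polynomial of degree k that is O(eps^(k+1)). *)
Lemma taylor_coef_compare (d : R) (a b : R -> R -> R) (k : nat) (t c : R) :
  0 < d -> smooth_on d a -> smooth_on d b ->
  bigO_eps (S k) (fun _ e => a t e - b t e - e ^ k * c) ->
  taylor_coef a k t = taylor_coef b k t + c /\
  (forall j, (j < k)%nat -> taylor_coef a j t = taylor_coef b j t).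
Proof.
  intros Hd Ha Hb H.
  pose proof (taylor_expansion_slice d a k t Hd Ha) as Ta.
  pose proof (taylor_expansion_slice d b k t Hd Hb) as Tb.
  assert (forall j, (j <= k)%nat ->
    taylor_coef a j t - taylor_coef b j t - (if Nat.eqb j k then c else 0) = 0) as Hj.
  { apply bigO_eps_poly.
    eapply bigO_eps_ext; [apply Rlt_0_1| |exact (bigO_eps_plus _ _ _ H
      (bigO_eps_minus _ _ _ Tb Ta))].
    intros t' e _. cbv beta.
    assert (sum_n (fun j => e ^ j * (taylor_coef a j t - taylor_coef b j t
       - (if Nat.eqb j k then c else 0))) k
      = sum_n (fun j => e ^ j * taylor_coef a j t) k
        - sum_n (fun j => e ^ j * taylor_coef b j t) k - e ^ k * c) as ->; [|ring].
    (* The upper bound of the sum is freed from k for the induction; the term in c enters once n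
       reaches k. *)
    assert (forall n, sum_n (fun j => e ^ j * (taylor_coef a j t - taylor_coef b j t
       - (if Nat.eqb j k then c else 0))) n
      = sum_n (fun j => e ^ j * taylor_coef a j t) n
        - sum_n (fun j => e ^ j * taylor_coef b j t) n
        - (if Nat.leb k n then e ^ k * c else 0)) as Hs.
    { induction n as [|n IH].
      - rewrite !sum_O. destruct k; simpl; ring.
      - rewrite !sum_n_Sr, IH.
        destruct (Nat.eqb_spec (S n) k) as [<-|Hne].
        + rewrite (proj2 (Nat.leb_gt (S n) n)) by lia. rewrite Nat.leb_refl.
          simpl. ring.
        + destruct (Nat.leb_spec k n), (Nat.leb_spec k (S n)); try lia; simpl; ring. }
    rewrite Hs, Nat.leb_refl. reflexivity. }
  split.
  - specialize (Hj k (Nat.le_refl k)). rewrite Nat.eqb_refl in Hj. lra.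
  - intros j Hlt. specialize (Hj j ltac:(lia)).
    rewrite (proj2 (Nat.eqb_neq j k)) in Hj by lia. lra.
Qed.

Lemma bigO_eps_taylor_coef (d : R) (a : R -> R -> R) (k : nat) (t : R) :
  0 < d -> smooth_on d a -> bigO_eps (S k) (fun _ e => a t e) ->
  forall j, (j <= k)%nat -> taylor_coef a j t = 0.
Proof.
  intros Hd Ha H j Hj.
  apply (bigO_eps_poly (fun j => taylor_coef a j t) k); [|exact Hj].
  eapply bigO_eps_ext; [apply Rlt_0_1| |exact (bigO_eps_minus _ _ _ H
    (taylor_expansion_slice d a k t Hd Ha))].
  intros. simpl. ring.
Qed.

Lemma taylor_coef_bigO_eps (d : R) (a : R -> R -> R) (k : nat) :
  0 < d -> smooth_on d a ->
  (forall t e, Rabs e < d -> a (t + 2 * PI) e = a t e) ->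
  (forall j t, (j < k)%nat -> taylor_coef a j t = 0) ->
  bigO_eps (S k) (fun t e => a t e - e ^ k * taylor_coef a k t).
Proof.
  intros Hd Ha Hp Hc.
  eapply bigO_eps_ext; [apply Rlt_0_1| |exact (taylor_expansion d a k Hd Ha Hp)].
  intros t e _. cbv beta. f_equal. destruct k as [|k].
  - now rewrite sum_O.
  - rewrite sum_Sn. rewrite (sum_n_ext_loc _ (fun _ => 0) k).
    + rewrite sum_n_const. unfold plus; simpl. ring.
    + intros i Hi. rewrite Hc by lia. req. ring.
Qed.

Lemma taylor_coef_smooth (d : R) (a : R -> R -> R) (k : nat) : 0 < d -> smooth_on d a ->
  forall n t, ex_derive_n (taylor_coef a k) n t.
Proof.
  intros Hd Ha n t. unfold taylor_coef.
  apply (smooth_on_ex_derive_n_1 d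
    (fun t e => Derive_n (fun e => a t e) k e / INR (fact k)) n t 0).
  - apply smooth_on_mult; [now apply smooth_on_Derive_n_2|apply smooth_on_const].
  - now rewrite Rabs_R0.
Qed.

Lemma taylor_coef_D1 (d : R) (a : R -> R -> R) (k : nat) (t : R) : 0 < d -> smooth_on d a ->
  taylor_coef (D1 a) k t = Derive (taylor_coef a k) t.
Proof.
  intros Hd Ha. unfold taylor_coef, Rdiv.
  rewrite <- (smooth_on_D1_Derive_n_2 d a k Ha t 0) by now rewrite Rabs_R0.
  rewrite Derive_scal_l. reflexivity.
Qed.

Lemma taylor_coef_0 (a : R -> R -> R) (t : R) : taylor_coef a 0 t = a t 0.
Proof. unfold taylor_coef. simpl. field. Qed.

Lemma taylor_coef_ext (d : R) (a b : R -> R -> R) (k : nat) (t t' : R) : 0 < d ->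
  (forall e, Rabs e < d -> a t e = b t' e) -> taylor_coef a k t = taylor_coef b k t'.
Proof.
  intros Hd E. unfold taylor_coef. f_equal. apply Derive_n_ext_loc.
  eapply filter_imp; [|apply (locally_lt_abs d 0); now rewrite Rabs_R0]. exact E.
Qed.

Lemma taylor_coef_plus (d : R) (a b : R -> R -> R) (k : nat) (t : R) :
  0 < d -> smooth_on d a -> smooth_on d b ->
  taylor_coef (fun t e => a t e + b t e) k t = taylor_coef a k t + taylor_coef b k t.
Proof.
  intros Hd Ha Hb. unfold taylor_coef. rewrite Derive_n_plus.
  - apply Rmult_plus_distr_r.
  - eapply filter_imp; [|apply (locally_lt_abs d 0); now rewrite Rabs_R0].
    intros z Hz i _. now apply (smooth_on_ex_derive_n_2 d).
  - eapply filter_imp; [|apply (locally_lt_abs d 0); now rewrite Rabs_R0].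
    intros z Hz i _. now apply (smooth_on_ex_derive_n_2 d).
Qed.

Lemma taylor_coef_scal (a : R -> R -> R) (c : R) (k : nat) (t : R) :
  taylor_coef (fun t e => c * a t e) k t = c * taylor_coef a k t.
Proof. unfold taylor_coef. rewrite Derive_n_scal_l. apply Rmult_assoc. Qed.

Lemma taylor_coef_minus (d : R) (a b : R -> R -> R) (k : nat) (t : R) :
  0 < d -> smooth_on d a -> smooth_on d b ->
  taylor_coef (fun t e => a t e - b t e) k t = taylor_coef a k t - taylor_coef b k t.
Proof.
  intros Hd Ha Hb.
  rewrite (taylor_coef_ext d _ (fun t e => a t e + (-1) * b t e) k t t Hd)
    by (intros; ring).
  rewrite (taylor_coef_plus d a (fun t e => (-1) * b t e)); auto.
  - rewrite taylor_coef_scal. ring.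
  - now apply smooth_on_scal.
Qed.

Lemma taylor_coef_const (c : R -> R) (k : nat) (t : R) :
  (1 <= k)%nat -> taylor_coef (fun t _ => c t) k t = 0.
Proof.
  intros Hk. unfold taylor_coef. destruct k as [|k]; [lia|].
  rewrite Derive_n_const. unfold Rdiv. ring.
Qed.

Lemma taylor_coef_sum (d : R) (a : nat -> R -> R -> R) (n k : nat) (t : R) : 0 < d ->
  (forall j, (j <= n)%nat -> smooth_on d (a j)) ->
  taylor_coef (fun t e => sum_n (fun j => a j t e) n) k t
  = sum_n (fun j => taylor_coef (a j) k t) n.
Proof.
  intros Hd. induction n as [|n IH]; intros H.
  - rewrite sum_O. apply (taylor_coef_ext d); [exact Hd|]. intros. now rewrite sum_O.
  - rewrite sum_Sn, <- IH by (intros; apply H; lia).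
    rewrite (taylor_coef_ext d _
      (fun t e => sum_n (fun j => a j t e) n + a (S n) t e) k t t Hd)
      by (intros; now rewrite sum_Sn).
    rewrite (taylor_coef_plus d); auto.
    apply smooth_on_sum. auto.
Qed.

Lemma taylor_coef_periodic (d : R) (a : R -> R -> R) (k : nat) : 0 < d ->
  (forall t e, Rabs e < d -> a (t + 2 * PI) e = a t e) -> periodic (taylor_coef a k).
Proof. intros Hd Hp t. apply (taylor_coef_ext d); [exact Hd|]. intros; now apply Hp. Qed.

(** * The operators of the circle shift *)

(** Regards a function of t as one constant in eps, so that the calculus on strips applies; the
    width 1 is arbitrary. *)
Lemma smooth_periodic_iff (a : R -> R) :
  smooth_periodic a <-> periodic a /\ smooth_on 1 (fun t _ => a t).
Proof.
  split; intros [Hp Hs]; (split; [exact Hp|]).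
  - apply smooth_on_lift. intros k t. apply Hs.
  - intros n t. apply (smooth_on_ex_derive_n_1 1 (fun t _ => a t) n t 0 Hs).
    rewrite Rabs_R0. lra.
Qed.

Lemma smooth_periodic_plus (a b : R -> R) :
  smooth_periodic a -> smooth_periodic b -> smooth_periodic (fun t => a t + b t).
Proof.
  rewrite !smooth_periodic_iff. intros [Pa Sa] [Pb Sb]. split.
  - intros t. now rewrite Pa, Pb.
  - now apply smooth_on_plus.
Qed.

Lemma smooth_periodic_mult (a b : R -> R) :
  smooth_periodic a -> smooth_periodic b -> smooth_periodic (fun t => a t * b t).
Proof.
  rewrite !smooth_periodic_iff. intros [Pa Sa] [Pb Sb]. split.
  - intros t. now rewrite Pa, Pb.
  - now apply (smooth_on_mult 1 (fun t _ => a t) (fun t _ => b t)).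
Qed.

Lemma smooth_periodic_const (c : R) : smooth_periodic (fun _ => c).
Proof.
  rewrite smooth_periodic_iff. split; [now intros t|]. apply smooth_on_const.
Qed.

Lemma smooth_periodic_scal (c : R) (a : R -> R) :
  smooth_periodic a -> smooth_periodic (fun t => c * a t).
Proof. intros H. apply smooth_periodic_mult; [apply smooth_periodic_const|exact H]. Qed.

Lemma smooth_periodic_minus (a b : R -> R) :
  smooth_periodic a -> smooth_periodic b -> smooth_periodic (fun t => a t - b t).
Proof.
  rewrite !smooth_periodic_iff. intros [Pa Sa] [Pb Sb]. split.
  - intros t. now rewrite Pa, Pb.
  - now apply (smooth_on_minus 1 (fun t _ => a t) (fun t _ => b t)).
Qed.

Lemma smooth_periodic_shift (c : R) (a : R -> R) :
  smooth_periodic a -> smooth_periodic (fun t => a (t + c)).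
Proof.
  rewrite !smooth_periodic_iff. intros [Pa Sa]. split.
  - intros t. rewrite <- (Pa (t + c)). f_equal. ring.
  - now apply (smooth_on_shift 1 c (fun t _ => a t)).
Qed.

Lemma smooth_periodic_sum (a : nat -> R -> R) (n : nat) :
  (forall j, smooth_periodic (a j)) ->
  smooth_periodic (fun t => sum_n (fun j => a j t) n).
Proof.
  intros H. rewrite smooth_periodic_iff. split.
  - intros t. apply sum_n_ext. intros j. apply (H j).
  - apply (smooth_on_sum 1 (fun j t _ => a j t)). intros j _.
    apply (proj1 (smooth_periodic_iff (a j)) (H j)).
Qed.

Lemma smooth_periodic_Derive (a : R -> R) :
  smooth_periodic a -> smooth_periodic (Derive a).
Proof.
  rewrite !smooth_periodic_iff. intros [Pa Sa]. split.
  - intros t. rewrite <- (Derive_ext (fun x => a (x + 2 * PI)) a t Pa).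
    pose proof (smooth_on_ex_derive_1 1 (fun t _ => a t) (t + 2 * PI) 0 Sa) as E.
    rewrite Rabs_R0 in E. specialize (E Rlt_0_1).
    symmetry. apply is_derive_unique.
    rewrite <- (Rmult_1_l (Derive a (t + 2 * PI))).
    apply (is_derive_comp a (fun x => x + 2 * PI) t (Derive a (t + 2 * PI)) 1).
    + now apply Derive_correct.
    + auto_derive; [exact I|ring].
  - now apply (smooth_on_D1 1 (fun t _ => a t)).
Qed.

Lemma smooth_periodic_ex_derive (a : R -> R) (t : R) : smooth_periodic a -> ex_derive a t.
Proof. intros [_ H]. apply (H 1%nat). Qed.

Lemma sum_n_plus_r (a b : nat -> R) (n : nat) :
  sum_n (fun j => a j + b j) n = sum_n a n + sum_n b n.
Proof. apply (sum_n_plus a b n). Qed.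

Lemma sum_n_scal_r (c : R) (a : nat -> R) (n : nat) :
  sum_n (fun j => c * a j) n = c * sum_n a n.
Proof. apply (sum_n_scal_l c a n). Qed.

Lemma sum_n_ext_r (a b : nat -> R) (n : nat) :
  (forall j, a j = b j) -> sum_n a n = sum_n b n.
Proof. apply sum_n_ext. Qed.

Lemma sum_n_const_r (c : R) (n : nat) : sum_n (fun _ => c) n = INR (S n) * c.
Proof. apply sum_n_const. Qed.

Lemma sum_n_shift_r (a : nat -> R) (n : nat) :
  sum_n (fun j => a (S j)) n = sum_n a n + a (S n) - a 0%nat.
Proof.
  induction n as [|n IH].
  - rewrite !sum_O. req. ring.
  - rewrite !sum_n_Sr, IH. req. ring.
Qed.

Lemma mu_ext (p q : nat) (a b : R -> R) (t : R) :
  (forall t, a t = b t) -> mu p q a t = mu p q b t.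
Proof. intros H. unfold mu. f_equal. apply sum_n_ext_r. intros; apply H. Qed.

Lemma mu_plus (p q : nat) (a b : R -> R) (t : R) :
  mu p q (fun x => a x + b x) t = mu p q a t + mu p q b t.
Proof. unfold mu. rewrite sum_n_plus_r. ring. Qed.

Lemma mu_scal (p q : nat) (c : R) (a : R -> R) (t : R) :
  mu p q (fun x => c * a x) t = c * mu p q a t.
Proof. unfold mu. rewrite sum_n_scal_r. ring. Qed.

Lemma mu_minus (p q : nat) (a b : R -> R) (t : R) :
  mu p q (fun x => a x - b x) t = mu p q a t - mu p q b t.
Proof.
  rewrite (mu_ext p q _ (fun x => a x + (-1) * b x)) by (intros; ring).
  rewrite mu_plus, mu_scal. ring.
Qed.

Lemma mu_const (p q : nat) (c t : R) : (0 < q)%nat -> mu p q (fun _ => c) t = c.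
Proof.
  intros Hq. unfold mu. rewrite sum_n_const_r. replace (S (pred q)) with q by lia.
  field. apply not_0_INR. lia.
Qed.

Lemma omega_mult (p q : nat) : (0 < q)%nat -> INR q * omega p q = 2 * PI * INR p.
Proof. intros Hq. unfold omega. field. apply not_0_INR. lia. Qed.

(** The shift permutes the q points cyclically: the last one lands on t + q omega = t + 2 pi p,
    where a takes its value at t. *)
Lemma mu_tau (p q : nat) (a : R -> R) (t : R) : (0 < q)%nat -> periodic a ->
  mu p q (fun x => a (x + omega p q)) t = mu p q a t.
Proof.
  intros Hq Ha. unfold mu. f_equal.
  rewrite (sum_n_ext_r _ (fun j => a (t + INR (S j) * omega p q))).
  2: { intros j. f_equal. rewrite S_INR. ring. }
  rewrite (sum_n_shift_r (fun j => a (t + INR j * omega p q))).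
  replace (S (pred q)) with q by lia. rewrite omega_mult by exact Hq.
  rewrite (periodic_mult a p t Ha). simpl. rewrite Rmult_0_l, Rplus_0_r. ring.
Qed.

Lemma mu_shift (p q : nat) (a : R -> R) (t : R) : (0 < q)%nat -> periodic a ->
  mu p q a (t + omega p q) = mu p q a t.
Proof.
  intros Hq Ha. rewrite <- (mu_tau p q a t Hq Ha). unfold mu. f_equal.
  apply sum_n_ext_r. intros j. f_equal. ring.
Qed.

Lemma mu_delta (p q : nat) (a : R -> R) (t : R) : (0 < q)%nat -> periodic a ->
  mu p q (delta p q a) t = 0.
Proof.
  intros Hq Ha. unfold delta, tau. rewrite mu_minus, mu_tau by assumption. ring.
Qed.

Lemma mu_sigma (p q : nat) (a : R -> R) (t : R) : (0 < q)%nat -> periodic a ->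
  mu p q (sigma p q a) t = 2 * mu p q a t.
Proof.
  intros Hq Ha. unfold sigma, tau. rewrite mu_plus, mu_tau by assumption. ring.
Qed.

Lemma mu_invariant (p q : nat) (a : R -> R) (t : R) : (0 < q)%nat ->
  (forall t, delta p q a t = 0) -> mu p q a t = a t.
Proof.
  intros Hq Ha. unfold mu. rewrite (sum_n_ext_r _ (fun _ => a t)).
  - rewrite sum_n_const_r. replace (S (pred q)) with q by lia. field.
    apply not_0_INR. lia.
  - intros j. induction j as [|j IH].
    + f_equal. simpl. ring.
    + rewrite <- IH. specialize (Ha (t + INR j * omega p q)). unfold delta, tau in Ha.
      rewrite S_INR.
      replace (t + (INR j + 1) * omega p q) with (t + INR j * omega p q + omega p q)
        by ring. lra.
Qed.

(** A function in the kernel of delta equals its own mu-mean, so delta and mu together determine a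
    function. *)
Lemma delta_unique (p q : nat) (a b : R -> R) (t : R) : (0 < q)%nat ->
  (forall t, delta p q a t = delta p q b t) ->
  (forall t, mu p q a t = mu p q b t) -> a t = b t.
Proof.
  intros Hq Hd Hm.
  assert (mu p q (fun x => a x - b x) t = a t - b t) as E.
  { apply (mu_invariant p q (fun x => a x - b x)); [exact Hq|]. intros u.
    specialize (Hd u). unfold delta, tau in *. lra. }
  rewrite mu_minus, Hm in E. lra.
Qed.

Lemma mu_smooth_periodic (p q : nat) (a : R -> R) :
  smooth_periodic a -> smooth_periodic (mu p q a).
Proof.
  intros H. apply smooth_periodic_scal.
  apply (smooth_periodic_sum (fun j t => a (t + INR j * omega p q))).
  intros j. now apply smooth_periodic_shift.
Qed.

Lemma Derive_shift (a : R -> R) (c t : R) : ex_derive a (t + c) ->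
  is_derive (fun x => a (x + c)) t (Derive a (t + c)).
Proof.
  intros H. rewrite <- (Rmult_1_l (Derive a (t + c))).
  apply (is_derive_comp a (fun x => x + c) t (Derive a (t + c)) 1).
  - now apply Derive_correct.
  - auto_derive; [exact I|ring].
Qed.

Lemma is_derive_sum_r (a : nat -> R -> R) (a' : nat -> R) (n : nat) (t : R) :
  (forall j, is_derive (a j) t (a' j)) ->
  is_derive (fun x => sum_n (fun j => a j x) n) t (sum_n a' n).
Proof.
  intros H. induction n as [|n IH].
  - rewrite sum_O. apply is_derive_ext with (a 0%nat); [|apply H].
    intros x. now rewrite sum_O.
  - rewrite sum_n_Sr.
    apply is_derive_ext with (fun x => sum_n (fun j => a j x) n + a (S n) x).
    + intros x. now rewrite sum_n_Sr.
    + apply (is_derive_plus (K := R_AbsRing) (V := R_NormedModule)); [exact IH|apply H].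
Qed.

Lemma mu_is_derive (p q : nat) (a : R -> R) (t : R) :
  (forall t, ex_derive a t) -> is_derive (mu p q a) t (mu p q (Derive a) t).
Proof.
  intros H. unfold mu. apply is_derive_scal.
  apply (is_derive_sum_r (fun j x => a (x + INR j * omega p q))).
  intros j. apply Derive_shift. apply H.
Qed.

(* Since tau^q = id on 2 pi-periodic functions, sum_j j tau^j g telescopes under delta. *)
Lemma delta_solve (p q : nat) (g : R -> R) : (0 < q)%nat -> smooth_periodic g ->
  (forall t, mu p q g t = 0) ->
  exists a, smooth_periodic a /\
    (forall t, delta p q a t = g t) /\ (forall t, mu p q a t = 0).
Proof.
  intros Hq Hg Hm. assert (INR q <> 0) as Hq' by (apply not_0_INR; lia).
  assert (periodic g) as Pg by apply Hg.
  exists (fun t => / INR q * sum_n (fun j => INR j * g (t + INR j * omega p q)) (pred q)).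
  split; [|split].
  - apply smooth_periodic_scal.
    apply (smooth_periodic_sum (fun j t => INR j * g (t + INR j * omega p q))).
    intros j. apply smooth_periodic_scal. now apply smooth_periodic_shift.
  - intros t. unfold delta, tau.
    rewrite (sum_n_ext_r (fun j => INR j * g (t + omega p q + INR j * omega p q))
      (fun j => INR (S j) * g (t + INR (S j) * omega p q)
                + (-1) * g (t + omega p q + INR j * omega p q))).
    2: { intros j. rewrite S_INR.
         replace (t + (INR j + 1) * omega p q) with (t + omega p q + INR j * omega p q)
           by ring. ring. }
    rewrite sum_n_plus_r, sum_n_scal_r.
    (* What survives the telescoping is the last term, of weight q, at t + q omega, which is q g(t)
       by periodicity. The sum of weight one vanishes as mu g = 0. *)
    rewrite (sum_n_shift_r (fun j => INR j * g (t + INR j * omega p q))).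
    pose proof (Hm (t + omega p q)) as E. unfold mu in E.
    assert (sum_n (fun j => g (t + omega p q + INR j * omega p q)) (pred q) = 0) as ->.
    { apply Rmult_eq_reg_l with (/ INR q); [lra|]. now apply Rinv_neq_0_compat. }
    replace (S (pred q)) with q by lia. rewrite omega_mult by exact Hq.
    rewrite (periodic_mult g p t Pg). simpl (INR 0). field. exact Hq'.
  - intros t. rewrite mu_scal.
    enough (mu p q (fun x => sum_n (fun j => INR j * g (x + INR j * omega p q)) (pred q)) t
            = 0) as -> by ring.
    induction (pred q) as [|n IH].
    + rewrite (mu_ext p q _ (fun _ => 0)).
      * now apply mu_const.
      * intros. rewrite sum_O. simpl. ring.
    + rewrite (mu_ext p q _ (fun x =>
        sum_n (fun j => INR j * g (x + INR j * omega p q)) n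
        + INR (S n) * g (x + INR (S n) * omega p q)))
        by (intros; apply sum_n_Sr).
      rewrite mu_plus, mu_scal, IH.
      enough (mu p q (fun x => g (x + INR (S n) * omega p q)) t = 0) as -> by ring.
      rewrite <- (Hm (t + INR (S n) * omega p q)). unfold mu. f_equal.
      apply sum_n_ext_r. intros j. f_equal. ring.
Qed.

(** * Increments of lifts and rigidity at order 0 *)

Lemma half_omega_bounds (p q : nat) : (0 < p)%nat -> (2 * p < q)%nat ->
  0 < omega p q / 2 < PI / 2.
Proof.
  intros Hp Hq. pose proof PI_RGT_0. apply lt_INR in Hp, Hq.
  rewrite mult_INR in Hq. simpl in Hp, Hq.
  assert (omega p q / 2 * INR q = PI * INR p) as E by (unfold omega; field; lra).
  split; nra.
Qed.

Lemma sin_half_omega_pos (p q : nat) : (0 < p)%nat -> (2 * p < q)%nat ->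
  0 < sin (omega p q / 2).
Proof.
  intros Hp Hq. pose proof (half_omega_bounds p q Hp Hq). pose proof PI_RGT_0.
  apply sin_gt_0; lra.
Qed.

Lemma derive_pos_increasing (f : R -> R) (x y : R) :
  (forall t, ex_derive f t /\ 0 < Derive f t) -> x < y -> f x < f y.
Proof.
  intros H Hxy.
  destruct (MVT_gen f x y (Derive f)) as [c [_ E]].
  - intros t _. apply Derive_correct, H.
  - intros t _. apply continuity_pt_filterlim. apply (ex_derive_continuous f t), H.
  - destruct (H c). nra.
Qed.

(** For f = phi the increment is 2 theta, so this is the origin of 0 < theta < PI: an increasing
    lift of degree one cannot stretch a step omega < 2 pi to a full turn. *)
Lemma lift_increment_bounds (p q : nat) (f : R -> R) (t : R) :
  (0 < p)%nat -> (2 * p < q)%nat ->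
  (forall t, ex_derive f t /\ 0 < Derive f t) ->
  (forall t, f (t + 2 * PI) = f t + 2 * PI) ->
  0 < f (t + omega p q) - f t < 2 * PI.
Proof.
  intros Hp Hq Hf Hper. destruct (half_omega_bounds p q Hp Hq). pose proof PI_RGT_0.
  pose proof (derive_pos_increasing f t (t + omega p q) Hf ltac:(lra)).
  pose proof (derive_pos_increasing f (t + omega p q) (t + 2 * PI) Hf ltac:(lra)) as Hr.
  rewrite Hper in Hr. lra.
Qed.

(** Cosine is injective on (0, PI), so invariance of cos theta passes to theta, which then equals
    its mean omega/2. Then delta phi = omega, so phi - t is invariant too and equals its mean. *)
Lemma order_0_rigid (p q : nat) (phi theta : R -> R) :
  (0 < p)%nat -> (2 * p < q)%nat ->
  (forall t, ex_derive phi t /\ 0 < Derive phi t) ->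
  (forall t, phi (t + 2 * PI) = phi t + 2 * PI) ->
  (forall t, 2 * theta t = delta p q phi t) ->
  (forall t, mu p q theta t = omega p q / 2) ->
  (forall t, mu p q (fun x => x - phi x) t = omega p q / 2) ->
  (forall t, cos (theta (t + omega p q)) = cos (theta t)) ->
  forall t, theta t = omega p q / 2 /\ phi t = t - omega p q / 2.
Proof.
  intros Hp Hq Hphi Hper Hth Hmth Hmphi Hcos.
  assert (forall t, 0 < theta t < PI) as Hb.
  { intros t. pose proof (lift_increment_bounds p q phi t Hp Hq Hphi Hper) as B.
    specialize (Hth t). unfold delta, tau in Hth. lra. }
  assert (forall t, theta t = omega p q / 2) as T.
  { intros t. rewrite <- (Hmth t). symmetry. apply mu_invariant; [lia|].
    intros u. unfold delta, tau.
    rewrite <- (acos_cos (theta u)), <- (acos_cos (theta (u + omega p q))).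
    - rewrite Hcos. ring.
    - destruct (Hb (u + omega p q)). lra.
    - destruct (Hb u). lra. }
  intros t. split; [apply T|].
  pose proof (mu_invariant p q (fun x => x - phi x) t ltac:(lia)) as M.
  rewrite Hmphi in M. enough (omega p q / 2 = t - phi t) by lra.
  apply M. intros u. specialize (Hth u). rewrite T in Hth.
  unfold delta, tau in *. lra.
Qed.

(** * Comparison of the billiard expressions *)

Lemma mvt_bound (f : R -> R) (M x y : R) :
  (forall z, ex_derive f z) -> (forall z, Rabs (Derive f z) <= M) ->
  Rabs (f x - f y) <= M * Rabs (x - y).
Proof.
  intros Hd HM. destruct (MVT_gen f y x (Derive f)) as [c [_ E]].
  - intros z _. apply Derive_correct, Hd.
  - intros z _. apply continuity_pt_filterlim. apply (ex_derive_continuous f z), Hd.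
  - rewrite E, Rabs_mult. apply Rmult_le_compat_r; [apply Rabs_pos|apply HM].
Qed.

Lemma sin_lipschitz (x y : R) : Rabs (sin x - sin y) <= Rabs (x - y).
Proof.
  rewrite <- (Rmult_1_l (Rabs (x - y))). apply mvt_bound.
  - intros z. auto_derive. exact I.
  - intros z. rewrite (is_derive_unique _ _ (cos z)) by (auto_derive; [exact I|ring]).
    apply Rabs_le, COS_bound.
Qed.

Lemma cos_lipschitz (x y : R) : Rabs (cos x - cos y) <= Rabs (x - y).
Proof.
  rewrite <- (Rmult_1_l (Rabs (x - y))). apply mvt_bound.
  - intros z. auto_derive. exact I.
  - intros z. rewrite (is_derive_unique _ _ (- sin z)) by (auto_derive; [exact I|ring]).
    rewrite Rabs_Ropp. apply Rabs_le, SIN_bound.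
Qed.

(** The slope is taken at the fixed angle al, not at y. By the mean value theorem the error is (sin
    al - sin c)(x - y) with c between x and y. In use, x - y = O(eps^k) and y - al = O(eps). *)
Lemma cos_first_order (x y al : R) :
  Rabs (cos x - cos y + sin al * (x - y))
  <= Rabs (x - y) * (Rabs (x - y) + Rabs (y - al)).
Proof.
  destruct (MVT_gen cos y x (fun z => - sin z)) as [c [Hc E]].
  - intros z _. auto_derive; [exact I|ring].
  - intros z _. apply continuity_cos.
  - replace (cos x - cos y + sin al * (x - y)) with ((sin al - sin c) * (x - y))
      by (rewrite E; ring).
    rewrite Rabs_mult, Rmult_comm. apply Rmult_le_compat_l; [apply Rabs_pos|].
    eapply Rle_trans; [apply sin_lipschitz|].
    replace (al - c) with ((y - c) + (al - y)) by ring.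
    eapply Rle_trans; [apply Rabs_triang|]. rewrite (Rabs_minus_sym al y).
    apply Rplus_le_compat_r.
    unfold Rmin, Rmax in Hc. destruct (Rle_dec y x);
      unfold Rabs; repeat destruct Rcase_abs; lra.
Qed.

(** A Lipschitz constant that is O(eps) gains one order over the difference of the arguments. This
    makes psi_k invisible at order eps^k. *)
Lemma bigO_eps_lipschitz (d : R) (k : nat) (g x y : R -> R -> R) :
  0 < d -> smooth_on d g -> bigO_eps 1 (D1 g) ->
  bigO_eps k (fun t e => x t e - y t e) ->
  bigO_eps (S k) (fun t e => g (x t e) e - g (y t e) e).
Proof.
  intros Hd Hg H1 H2.
  destruct (bigO_eps_elim _ _ H1) as [K [d1 [HK [Hd1 [_ B1]]]]].
  destruct (bigO_eps_elim _ _ H2) as [L [d2 [HL [Hd2 [_ B2]]]]].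
  apply bigO_eps_intro with (K * L) (Rmin d (Rmin d1 d2)).
  { repeat apply Rmin_pos; assumption. }
  intros t e He. pose proof (Rmin_l d (Rmin d1 d2)). pose proof (Rmin_r d (Rmin d1 d2)).
  pose proof (Rmin_l d1 d2). pose proof (Rmin_r d1 d2).
  eapply Rle_trans.
  - apply (mvt_bound (fun z => g z e) (K * Rabs e)).
    + intros z. apply (smooth_on_ex_derive_1 d); [exact Hg|lra].
    + intros z. rewrite <- (pow_1 (Rabs e)). apply (B1 z e). lra.
  - replace (K * L * Rabs e ^ S k) with (K * Rabs e * (L * Rabs e ^ k)) by (simpl; ring).
    apply Rmult_le_compat_l; [apply Rmult_le_pos; [exact HK|apply Rabs_pos]|].
    apply B2. lra.
Qed.

Lemma bigO_eps_bounded (a : R -> R -> R) (M : R) :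
  (forall t e, Rabs (a t e) <= M) -> bigO_eps 0 a.
Proof.
  intros H. apply bigO_eps_intro with M 1; [lra|]. intros. simpl. rewrite Rmult_1_r. apply H.
Qed.

Lemma D1_periodic (d : R) (a : R -> R -> R) : smooth_on d a ->
  (forall t e, Rabs e < d -> a (t + 2 * PI) e = a t e) ->
  forall t e, Rabs e < d -> D1 a (t + 2 * PI) e = D1 a t e.
Proof.
  intros Ha Hp t e He. unfold D1.
  rewrite <- (Derive_ext (fun z => a (z + 2 * PI) e) (fun z => a z e) t)
    by (intros; now apply Hp).
  symmetry. apply is_derive_unique. apply (Derive_shift (fun z => a z e)).
  now apply (smooth_on_ex_derive_1 d).
Qed.

Lemma bigO_eps_1_of_zero (d : R) (a : R -> R -> R) : 0 < d -> smooth_on d a ->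
  (forall t e, Rabs e < d -> a (t + 2 * PI) e = a t e) ->
  (forall t, a t 0 = 0) -> bigO_eps 1 a.
Proof.
  intros Hd Ha Hp H0.
  apply bigO_eps_ext with d (fun t e => a t e - e ^ 0 * taylor_coef a 0 t); [exact Hd| |].
  - intros t e _. rewrite taylor_coef_0, H0. ring.
  - apply (taylor_coef_bigO_eps d); auto. intros j t Hj. lia.
Qed.

(** The data on which the expansions rest, in a form that passes to narrower strips. Positivity and
    convexity are called upon for the billiard map. *)
Definition deformation_on (d : R) (h : R -> R -> R) : Prop :=
  0 < d /\ smooth_on d h /\ (forall t e, Rabs e < d -> h (t + 2 * PI) e = h t e) /\
  (forall t, h t 0 = 1).

Lemma circle_deformation_on (e0 : R) (h : R -> R -> R) :
  circle_deformation e0 h -> deformation_on e0 h.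
Proof.
  intros [H0 [Hs [Hp [H1 _]]]]. split; [exact H0|]. split; [now apply smooth_strip_on|].
  split; [|exact H1]. intros t e He. apply Hp. lra.
Qed.

Lemma D1_at_0 (h : R -> R -> R) (c : R) : (forall t, h t 0 = c) ->
  forall t, D1 h t 0 = 0.
Proof.
  intros H t. unfold D1. rewrite (Derive_ext _ (fun _ => c) t H). apply Derive_const.
Qed.

Lemma deformation_bigO (d : R) (h : R -> R -> R) : deformation_on d h ->
  bigO_eps 1 (fun t e => h t e - 1) /\ bigO_eps 1 (D1 h) /\ bigO_eps 1 (D1 (D1 h)).
Proof.
  intros [Hd [Hs [Hp H1]]]. pose proof (D1_at_0 h 1 H1) as H2.
  pose proof (D1_at_0 (D1 h) 0 H2) as H3.
  pose proof (smooth_on_D1 d h Hs) as S1. pose proof (smooth_on_D1 d _ S1) as S2.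
  pose proof (D1_periodic d h Hs Hp) as P1. pose proof (D1_periodic d _ S1 P1) as P2.
  split; [|split]; apply (bigO_eps_1_of_zero d); auto.
  - apply smooth_on_minus; [exact Hs|apply smooth_on_const].
  - intros t e He. now rewrite Hp.
  - intros t. rewrite H1. ring.
Qed.

(** Stated for two arbitrary pairs because it has two uses: comparing a family with its truncations,
    and measuring the effect of adding a correction of order eps^k to a family. *)
Lemma billiard_compare (d : R) (h : R -> R -> R) (k : nat) (al : R)
    (x1 x2 y1 y2 : R -> R -> R) (c : R -> R) :
  deformation_on d h -> (1 <= k)%nat ->
  bigO_eps 0 (fun t _ => c t) ->
  bigO_eps k (fun t e => x1 t e - x2 t e) ->
  bigO_eps (S k) (fun t e => y1 t e - y2 t e - e ^ k * c t) ->
  bigO_eps 1 (fun t e => y2 t e - al) ->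
  bigO_eps (S k) (fun t e => dhcomp h x1 t e * sin (y1 t e)
                             - dhcomp h x2 t e * sin (y2 t e)) /\
  bigO_eps (S k) (fun t e => hcomp h x1 t e * cos (y1 t e)
                             - hcomp h x2 t e * cos (y2 t e)
                             - e ^ k * (- sin al * c t)).
Proof.
  intros Hdef Hk Hc Hx Hy Hal. pose proof Hdef as [Hd [Hs _]].
  destruct (deformation_bigO d h Hdef) as [O1 [O2 O3]].
  assert (bigO_eps k (fun t e => y1 t e - y2 t e)) as Hy'.
  { apply bigO_eps_ext with 1
      (fun t e => (y1 t e - y2 t e - e ^ k * c t) + e ^ k * c t); [lra|intros; ring|].
    apply bigO_eps_plus.
    - apply bigO_eps_le with (S k); [lia|exact Hy].
    - replace k with (k + 0)%nat at 1 by lia.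
      apply (bigO_eps_mult k 0 (fun _ e => e ^ k)); [apply bigO_eps_pow|exact Hc]. }
  split.
  - apply bigO_eps_ext with 1 (fun t e =>
      (D1 h (x1 t e) e - D1 h (x2 t e) e) * sin (y1 t e)
      + D1 h (x2 t e) e * (sin (y1 t e) - sin (y2 t e))); [lra| |].
    { intros. unfold dhcomp, D1. ring. }
    apply bigO_eps_plus.
    + replace (S k) with (S k + 0)%nat by lia. apply bigO_eps_mult.
      * apply (bigO_eps_lipschitz d); auto. now apply smooth_on_D1.
      * apply bigO_eps_bounded with 1. intros. apply Rabs_le, SIN_bound.
    + apply (bigO_eps_mult 1 k).
      * now apply bigO_eps_reparam.
      * apply bigO_eps_dom with 1 (fun t e => y1 t e - y2 t e); [|exact Hy'].
        intros. rewrite Rmult_1_l. apply sin_lipschitz.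
  (* Four contributions: psi moves against h', theta moves against h - 1, the second-order remainder
     of the cosine, and the error in y1 - y2 = eps^k c. *)
  - apply bigO_eps_ext with 1 (fun t e =>
      (h (x1 t e) e - h (x2 t e) e) * cos (y1 t e)
      + (h (x2 t e) e - 1) * (cos (y1 t e) - cos (y2 t e))
      + (cos (y1 t e) - cos (y2 t e) + sin al * (y1 t e - y2 t e))
      + (- sin al) * (y1 t e - y2 t e - e ^ k * c t)); [lra| |].
    { intros. unfold hcomp. ring. }
    apply bigO_eps_plus; [apply bigO_eps_plus; [apply bigO_eps_plus|]|].
    + replace (S k) with (S k + 0)%nat by lia. apply bigO_eps_mult.
      * now apply (bigO_eps_lipschitz d).
      * apply bigO_eps_bounded with 1. intros. apply Rabs_le, COS_bound.
    + apply (bigO_eps_mult 1 k).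
      * now apply (bigO_eps_reparam 1 (fun t e => h t e - 1)).
      * apply bigO_eps_dom with 1 (fun t e => y1 t e - y2 t e); [|exact Hy'].
        intros. rewrite Rmult_1_l. apply cos_lipschitz.
    + apply bigO_eps_dom with 1 (fun t e => (y1 t e - y2 t e)
        * (Rabs (y1 t e - y2 t e) + Rabs (y2 t e - al))).
      * intros. rewrite Rmult_1_l, Rabs_mult.
        rewrite (Rabs_pos_eq (Rabs _ + Rabs _)) by (apply Rplus_le_le_0_compat; apply Rabs_pos).
        apply cos_first_order.
      * replace (S k) with (k + 1)%nat by lia. apply bigO_eps_mult; [exact Hy'|].
        apply bigO_eps_plus.
        -- apply bigO_eps_le with k; [exact Hk|].
           apply bigO_eps_dom with 1 (fun t e => y1 t e - y2 t e); [|exact Hy'].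
           intros. rewrite Rabs_Rabsolu. lra.
        -- apply bigO_eps_dom with 1 (fun t e => y2 t e - al); [|exact Hal].
           intros. rewrite Rabs_Rabsolu. lra.
    + now apply bigO_eps_scal.
Qed.

Definition dh_sin (h psi theta : R -> R -> R) (t e : R) : R :=
  dhcomp h psi t e * sin (theta t e).
Definition h_cos (h psi theta : R -> R -> R) (t e : R) : R :=
  hcomp h psi t e * cos (theta t e).
(** Convertible to the expression in the last clause of [cond_F]. *)
Definition defect (p q : nat) (h psi theta : R -> R -> R) (t e : R) : R :=
  sigma p q (fun x => dh_sin h psi theta x e) t - delta p q (fun x => h_cos h psi theta x e) t.

Lemma dh_sin_smooth (d : R) (h psi theta : R -> R -> R) :
  smooth_on d h -> smooth_on d psi -> smooth_on d theta -> smooth_on d (dh_sin h psi theta).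
Proof.
  intros Hh Hpsi Hth. apply smooth_on_mult; [|now apply smooth_on_sin].
  apply (smooth_on_comp d (D1 h)); [now apply smooth_on_D1|exact Hpsi].
Qed.

Lemma h_cos_smooth (d : R) (h psi theta : R -> R -> R) :
  smooth_on d h -> smooth_on d psi -> smooth_on d theta -> smooth_on d (h_cos h psi theta).
Proof.
  intros Hh Hpsi Hth. apply smooth_on_mult; [|now apply smooth_on_cos].
  now apply (smooth_on_comp d h).
Qed.

Lemma defect_smooth (d : R) (p q : nat) (h psi theta : R -> R -> R) :
  smooth_on d h -> smooth_on d psi -> smooth_on d theta ->
  smooth_on d (defect p q h psi theta).
Proof.
  intros Hh Hpsi Hth. pose proof (dh_sin_smooth d h psi theta Hh Hpsi Hth) as SX.
  pose proof (h_cos_smooth d h psi theta Hh Hpsi Hth) as SY.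
  unfold defect, sigma, delta, tau.
  apply smooth_on_minus; [apply smooth_on_plus|apply smooth_on_minus]; auto;
    now apply smooth_on_shift.
Qed.

Lemma dh_sin_h_cos_periodic (d : R) (h psi theta : R -> R -> R) :
  smooth_on d h -> (forall t e, Rabs e < d -> h (t + 2 * PI) e = h t e) ->
  (forall t e, Rabs e < d -> psi (t + 2 * PI) e = psi t e + 2 * PI) ->
  (forall t e, Rabs e < d -> theta (t + 2 * PI) e = theta t e) ->
  forall t e, Rabs e < d ->
    dh_sin h psi theta (t + 2 * PI) e = dh_sin h psi theta t e /\
    h_cos h psi theta (t + 2 * PI) e = h_cos h psi theta t e.
Proof.
  intros Hh Ph Ppsi Pth t e He. unfold dh_sin, h_cos, hcomp.
  change (dhcomp h psi) with (fun t e => D1 h (psi t e) e). cbv beta.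
  rewrite Ppsi, Pth by exact He. rewrite Ph by exact He.
  now rewrite (D1_periodic d h Hh Ph) by exact He.
Qed.

Lemma defect_periodic (d : R) (p q : nat) (h psi theta : R -> R -> R) :
  smooth_on d h -> (forall t e, Rabs e < d -> h (t + 2 * PI) e = h t e) ->
  (forall t e, Rabs e < d -> psi (t + 2 * PI) e = psi t e + 2 * PI) ->
  (forall t e, Rabs e < d -> theta (t + 2 * PI) e = theta t e) ->
  forall t e, Rabs e < d -> defect p q h psi theta (t + 2 * PI) e = defect p q h psi theta t e.
Proof.
  intros Hh Ph Ppsi Pth t e He.
  pose proof (dh_sin_h_cos_periodic d h psi theta Hh Ph Ppsi Pth) as P.
  unfold defect, sigma, delta, tau.
  replace (t + 2 * PI + omega p q) with (t + omega p q + 2 * PI) by ring.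
  destruct (P t e He) as [-> ->]. destruct (P (t + omega p q) e He) as [-> ->].
  reflexivity.
Qed.

Lemma taylor_coef_shift (a : R -> R -> R) (c : R) (k : nat) (t : R) :
  taylor_coef (fun t e => a (t + c) e) k t = taylor_coef a k (t + c).
Proof. reflexivity. Qed.

Lemma taylor_coef_defect (d : R) (p q : nat) (h psi theta : R -> R -> R) (k : nat) (t : R) :
  0 < d -> smooth_on d h -> smooth_on d psi -> smooth_on d theta ->
  taylor_coef (defect p q h psi theta) k t
  = sigma p q (taylor_coef (dh_sin h psi theta) k) t
    - delta p q (taylor_coef (h_cos h psi theta) k) t.
Proof.
  intros Hd Hh Hpsi Hth. pose proof (dh_sin_smooth d h psi theta Hh Hpsi Hth) as SX.
  pose proof (h_cos_smooth d h psi theta Hh Hpsi Hth) as SY.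
  pose proof (smooth_on_shift d (omega p q) _ SX) as SX'.
  pose proof (smooth_on_shift d (omega p q) _ SY) as SY'.
  unfold defect, sigma, delta, tau.
  rewrite (taylor_coef_minus d
    (fun t e => dh_sin h psi theta (t + omega p q) e + dh_sin h psi theta t e)
    (fun t e => h_cos h psi theta (t + omega p q) e - h_cos h psi theta t e)); auto.
  - rewrite (taylor_coef_plus d (fun t e => dh_sin h psi theta (t + omega p q) e)); auto.
    rewrite (taylor_coef_minus d (fun t e => h_cos h psi theta (t + omega p q) e)); auto.
  - now apply smooth_on_plus.
  - now apply smooth_on_minus.
Qed.

Lemma taylor_coef_mu (d : R) (p q : nat) (a : R -> R -> R) (k : nat) (t : R) :
  0 < d -> smooth_on d a ->
  taylor_coef (fun t e => mu p q (fun x => a x e) t) k t = mu p q (taylor_coef a k) t.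
Proof.
  intros Hd Ha. unfold mu. rewrite taylor_coef_scal. f_equal.
  rewrite (taylor_coef_sum d (fun j t e => a (t + INR j * omega p q) e)); [|exact Hd|].
  - reflexivity.
  - intros j _. now apply smooth_on_shift.
Qed.

Lemma truncation_smooth (d : R) (a : nat -> R -> R) (k : nat) :
  (forall j, (j <= pred k)%nat -> forall n t, ex_derive_n (a j) n t) ->
  smooth_on d (truncation a k).
Proof.
  intros H. apply (smooth_on_sum d (fun j t e => e ^ j * a j t)). intros j Hj.
  apply (smooth_on_mult d (fun _ e => e ^ j) (fun t _ => a j t)).
  - apply smooth_on_pow.
  - apply smooth_on_lift. now apply H.
Qed.

Lemma truncation_ext (a b : nat -> R -> R) (k : nat) : (1 <= k)%nat ->
  (forall j, (j < k)%nat -> a j = b j) -> truncation a k = truncation b k.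
Proof.
  intros Hk H. apply functional_extensionality; intros t.
  apply functional_extensionality; intros e. unfold truncation.
  apply sum_n_ext_loc. intros j Hj. rewrite H by lia. reflexivity.
Qed.

Lemma QRcoef_ext (h : R -> R -> R) (psi psi' theta theta' : nat -> R -> R) (k : nat) :
  (1 <= k)%nat ->
  (forall j, (j < k)%nat -> psi j = psi' j /\ theta j = theta' j) ->
  Qcoef h psi theta k = Qcoef h psi' theta' k /\
  Rcoef h psi theta k = Rcoef h psi' theta' k.
Proof.
  intros Hk H. unfold Qcoef, Rcoef.
  rewrite (truncation_ext psi psi' k Hk) by (intros; now apply H).
  rewrite (truncation_ext theta theta' k Hk) by (intros; now apply H). now split.
Qed.

(** All functions are frozen at the given t before [billiard_compare] is applied, so that expansions
    at one point suffice and c is the number theta_k(t). *)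
Lemma taylor_coef_dh_sin_h_cos (d : R) (h psi theta : R -> R -> R) (al : R) (k : nat) (t : R) :
  deformation_on d h -> smooth_on d psi -> smooth_on d theta -> (1 <= k)%nat ->
  (forall t, theta t 0 = al) ->
  taylor_coef (dh_sin h psi theta) k t
  = Qcoef h (taylor_coef psi) (taylor_coef theta) k t /\
  taylor_coef (h_cos h psi theta) k t
  = Rcoef h (taylor_coef psi) (taylor_coef theta) k t - sin al * taylor_coef theta k t.
Proof.
  intros Hdef Hpsi Hth Hk H0. pose proof Hdef as [Hd [Hh _]].
  set (psik := truncation (taylor_coef psi) k).
  set (thk := truncation (taylor_coef theta) k).
  assert (smooth_on d psik) as Spk.
  { apply truncation_smooth. intros j _. now apply (taylor_coef_smooth d). }
  assert (smooth_on d thk) as Stk.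
  { apply truncation_smooth. intros j _. now apply (taylor_coef_smooth d). }
  destruct (billiard_compare d h k al (fun _ e => psi t e) (fun _ e => psik t e)
    (fun _ e => theta t e) (fun _ e => thk t e) (fun _ => taylor_coef theta k t))
    as [BX BY]; auto.
  - apply bigO_eps_const.
  - pose proof (taylor_expansion_slice d psi (pred k) t Hd Hpsi) as T.
    replace (S (pred k)) with k in T by lia. exact T.
  - eapply bigO_eps_ext; [apply Rlt_0_1| |exact (taylor_expansion_slice d theta k t Hd Hth)].
    intros s e _. cbv beta. unfold thk, truncation.
    destruct k as [|k]; [lia|]. rewrite sum_n_Sr. simpl pred. ring.
  - apply bigO_eps_ext with 1 (fun _ e =>
      (theta t e - sum_n (fun j => e ^ j * taylor_coef theta j t) 0)
      - (theta t e - thk t e)); [lra| |].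
    + intros s e _. rewrite sum_O, taylor_coef_0, H0. simpl. ring.
    + apply bigO_eps_minus.
      * now apply (taylor_expansion_slice d).
      * apply bigO_eps_le with k; [exact Hk|].
        pose proof (taylor_expansion_slice d theta (pred k) t Hd Hth) as T.
        replace (S (pred k)) with k in T by lia. exact T.
  - split.
    + destruct (taylor_coef_compare d (dh_sin h psi theta) (dh_sin h psik thk) k t 0)
        as [E _]; auto.
      * now apply dh_sin_smooth.
      * now apply dh_sin_smooth.
      * eapply bigO_eps_ext; [apply Rlt_0_1| |exact BX].
        intros s e _. unfold dh_sin, dhcomp. ring.
      * rewrite E, Rplus_0_r. reflexivity.
    + destruct (taylor_coef_compare d (h_cos h psi theta) (h_cos h psik thk) k t
        (- sin al * taylor_coef theta k t)) as [E _]; auto.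
      * now apply h_cos_smooth.
      * now apply h_cos_smooth.
      * rewrite E. change (Rcoef h (taylor_coef psi) (taylor_coef theta) k t)
          with (taylor_coef (h_cos h psik thk) k t). ring.
Qed.

(** * Coefficients of a parametrized family *)

(** Condition (F) without its equation, on an open strip. These relations hold exactly at every
    order, while the estimate on [defect] is what improves. *)
Definition frame (p q : nat) (d : R) (phi psi theta : R -> R -> R) : Prop :=
  0 < d /\ smooth_on d phi /\ smooth_on d psi /\ smooth_on d theta /\
  (forall t e, Rabs e < d ->
     phi (t + 2 * PI) e = phi t e + 2 * PI /\
     psi (t + 2 * PI) e = psi t e + 2 * PI /\
     theta (t + 2 * PI) e = theta t e) /\
  (forall t e, Rabs e < d ->
     psi t e = phi t e + theta t e /\
     psi t e = sigma p q (fun x => phi x e) t / 2 /\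
     2 * theta t e = delta p q (fun x => phi x e) t /\
     mu p q (fun x => psi x e - x) t = 0 /\
     mu p q (fun x => x - phi x e) t = omega p q / 2 /\
     mu p q (fun x => theta x e) t = omega p q / 2 /\
     0 < Derive (fun x => phi x e) t).

Lemma cond_F_frame (p q m : nat) (h phi psi theta : R -> R -> R) (d : R) : 0 < d ->
  cond_F p q h d m phi psi theta ->
  frame p q d phi psi theta /\ bigO_eps (S m) (defect p q h psi theta).
Proof.
  intros Hd [S1 [S2 [S3 [P1 [P2 [P3 [H HO]]]]]]]. split; [|exact HO].
  split; [exact Hd|]. repeat (split; [now apply smooth_strip_on|]).
  split; [|intros t e He; apply H; lra].
  intros t e He. assert (Rabs e <= d) as He' by lra.
  specialize (P1 t e He'). specialize (P2 t e He'). specialize (P3 t e He').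
  simpl in P1, P2. repeat split; try lra.
Qed.

Lemma frame_cond_F (p q m : nat) (h phi psi theta : R -> R -> R) (d d' : R) : d' < d ->
  frame p q d phi psi theta -> bigO_eps (S m) (defect p q h psi theta) ->
  cond_F p q h d' m phi psi theta.
Proof.
  intros Hd [_ [S1 [S2 [S3 [P H]]]]] HO.
  repeat (split; [now apply smooth_on_strip with d|]).
  split; [|split; [|split; [|split; [|exact HO]]]].
  - intros t e He. destruct (P t e ltac:(lra)) as [E _]. rewrite E. ring.
  - intros t e He. destruct (P t e ltac:(lra)) as [_ [E _]]. rewrite E. ring.
  - intros t e He. now destruct (P t e ltac:(lra)) as [_ [_ E]].
  - intros t e He. apply H. lra.
Qed.

Lemma bigO_eps_at_0 (n : nat) (a : R -> R -> R) (t : R) : bigO_eps (S n) a -> a t 0 = 0.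
Proof.
  intros H. destruct (bigO_eps_elim _ _ H) as [K [d [_ [Hd [_ B]]]]].
  specialize (B t 0). rewrite Rabs_R0 in B. specialize (B Hd).
  rewrite pow_i in B by lia. rewrite Rmult_0_r in B.
  pose proof (Rabs_pos (a t 0)). destruct (Req_dec (a t 0) 0) as [E|E]; [exact E|].
  pose proof (Rabs_pos_lt _ E). lra.
Qed.

(** Any order m >= 0 makes the defect vanish at eps = 0. There h = 1 and h' = 0, and what remains is
    delta (cos theta) = 0. *)
Lemma frame_order_0 (p q m : nat) (h phi psi theta : R -> R -> R) (d : R) :
  (0 < p)%nat -> (2 * p < q)%nat -> deformation_on d h ->
  frame p q d phi psi theta -> bigO_eps (S m) (defect p q h psi theta) ->
  forall t, phi t 0 = t - omega p q / 2 /\ psi t 0 = t /\ theta t 0 = omega p q / 2.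
Proof.
  intros Hp Hq [_ [_ [_ H1]]] [Hd [S1 [S2 [S3 [P H]]]]] HO.
  assert (Rabs 0 < d) as H0 by (rewrite Rabs_R0; exact Hd).
  assert (forall t, theta t 0 = omega p q / 2 /\ phi t 0 = t - omega p q / 2) as R0.
  { apply (order_0_rigid p q (fun t => phi t 0) (fun t => theta t 0)); auto.
    - intros t. split; [now apply (smooth_on_ex_derive_1 d)|]. now apply H.
    - intros t. now apply P.
    - intros t. now apply H.
    - intros t. now apply H.
    - intros t. now apply H.
    - intros t. pose proof (bigO_eps_at_0 m _ t HO) as E.
      unfold defect, sigma, delta, tau, dh_sin, h_cos, hcomp in E.
      change (dhcomp h psi) with (fun t e => D1 h (psi t e) e) in E. cbv beta in E.
      rewrite !(D1_at_0 h 1 H1), !H1 in E. lra. }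
  intros t. destruct (R0 t) as [T F]. split; [exact F|]. split; [|exact T].
  destruct (H t 0 H0) as [-> _]. lra.
Qed.

(** The relations of a frame are affine: for k >= 1 the constants 2 pi and omega/2 and the term t
    drop out of the coefficients. *)
Lemma frame_coef (p q : nat) (phi psi theta : R -> R -> R) (d : R) (k : nat) :
  (0 < q)%nat -> frame p q d phi psi theta -> (1 <= k)%nat ->
  smooth_periodic (taylor_coef phi k) /\ smooth_periodic (taylor_coef psi k) /\
  smooth_periodic (taylor_coef theta k) /\
  forall t,
    taylor_coef psi k t = taylor_coef phi k t + taylor_coef theta k t /\
    delta p q (taylor_coef phi k) t = 2 * taylor_coef theta k t /\
    mu p q (taylor_coef phi k) t = 0 /\ mu p q (taylor_coef theta k) t = 0.
Proof.
  intros Hq [Hd [S1 [S2 [S3 [P H]]]]] Hk.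
  assert (per : forall a : R -> R -> R, smooth_on d a ->
    (forall t e, Rabs e < d -> a (t + 2 * PI) e = a t e + 2 * PI) ->
    periodic (taylor_coef a k)).
  { intros a Ha Pa t.
    transitivity (taylor_coef (fun t e => a t e + 2 * PI) k t).
    - apply (taylor_coef_ext d); [exact Hd|]. intros e He. now apply Pa.
    - rewrite (taylor_coef_plus d a (fun _ _ => 2 * PI)); auto.
      + rewrite (taylor_coef_const (fun _ => 2 * PI)) by exact Hk. ring.
      + apply smooth_on_const. }
  split; [|split; [|split]].
  - split; [apply per; [exact S1|intros; now apply P]|].
    intros n t. now apply (taylor_coef_smooth d).
  - split; [apply per; [exact S2|intros; now apply P]|].
    intros n t. now apply (taylor_coef_smooth d).
  - split; [|intros n t; now apply (taylor_coef_smooth d)].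
    apply (taylor_coef_periodic d); [exact Hd|]. intros; now apply P.
  - intros t. split; [|split; [|split]].
    + rewrite <- (taylor_coef_plus d phi theta) by auto.
      apply (taylor_coef_ext d); [exact Hd|]. intros; now apply H.
    + rewrite <- taylor_coef_scal. unfold delta, tau.
      rewrite <- (taylor_coef_shift phi).
      rewrite <- (taylor_coef_minus d (fun t e => phi (t + omega p q) e) phi); auto.
      * apply (taylor_coef_ext d); [exact Hd|]. intros e He. symmetry.
        now apply H.
      * now apply smooth_on_shift.
    + assert (smooth_on d (fun t e => t - phi t e)) as Sd
        by (apply smooth_on_minus; [apply smooth_on_fst|exact S1]).
      pose proof (taylor_coef_mu d p q (fun x e => x - phi x e) k t Hd Sd) as E.
      rewrite (taylor_coef_ext d _ (fun _ _ => omega p q / 2) k t t Hd) in E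
        by (intros; now apply H).
      rewrite (taylor_coef_const (fun _ => omega p q / 2)) in E by exact Hk.
      rewrite (mu_ext p q (taylor_coef (fun x e => x - phi x e) k)
        (fun x => (-1) * taylor_coef phi k x)) in E.
      * rewrite mu_scal in E. lra.
      * intros s. rewrite (taylor_coef_minus d (fun x _ => x) phi); auto.
        -- rewrite (taylor_coef_const (fun x => x)) by exact Hk. ring.
        -- apply smooth_on_fst.
    + pose proof (taylor_coef_mu d p q theta k t Hd S3) as E.
      rewrite (taylor_coef_ext d _ (fun _ _ => omega p q / 2) k t t Hd) in E
        by (intros; now apply H).
      rewrite (taylor_coef_const (fun _ => omega p q / 2)) in E by exact Hk.
      now symmetry.
Qed.

Lemma frame_defect_coef (p q m : nat) (h phi psi theta : R -> R -> R) (d : R) (k : nat) (t : R) :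
  (0 < p)%nat -> (2 * p < q)%nat -> deformation_on d h ->
  frame p q d phi psi theta -> bigO_eps (S m) (defect p q h psi theta) -> (1 <= k)%nat ->
  taylor_coef (defect p q h psi theta) k t
  = sigma p q (Qcoef h (taylor_coef psi) (taylor_coef theta) k) t
    - delta p q (Rcoef h (taylor_coef psi) (taylor_coef theta) k) t
    + sin (omega p q / 2) * delta p q (taylor_coef theta k) t.
Proof.
  intros Hp Hq Hdef HF HO Hk. pose proof Hdef as [Hd [Hh _]].
  pose proof (frame_order_0 p q m h phi psi theta d Hp Hq Hdef HF HO) as H0.
  destruct HF as [_ [S1 [S2 [S3 _]]]].
  rewrite (taylor_coef_defect d) by auto.
  unfold sigma, delta, tau.
  destruct (taylor_coef_dh_sin_h_cos d h psi theta (omega p q / 2) k t) as [-> ->]; auto.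
  { intros; apply H0. }
  destruct (taylor_coef_dh_sin_h_cos d h psi theta (omega p q / 2) k (t + omega p q))
    as [-> ->]; auto.
  { intros; apply H0. }
  ring.
Qed.

Lemma unique_intro (P : (R -> R) -> Prop) (a : R -> R) : P a ->
  (forall b, P b -> forall t, a t = b t) -> unique P a.
Proof.
  intros Ha Hb. split; [exact Ha|]. intros b Pb. apply functional_extensionality.
  now apply Hb.
Qed.

(** The index [S m] is the next order to be reached: it covers k = 1, ..., m, where the coefficients
    of the defect vanish. Uniqueness is [delta_unique], after division by s > 0. *)
Lemma frame_recurrences (p q m : nat) (h phi psi theta : R -> R -> R) (d : R) :
  (0 < p)%nat -> (2 * p < q)%nat -> deformation_on d h ->
  frame p q d phi psi theta -> bigO_eps (S m) (defect p q h psi theta) ->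
  recurrences p q h (S m) (taylor_coef phi) (taylor_coef psi) (taylor_coef theta).
Proof.
  intros Hp Hq Hdef HF HO. pose proof Hdef as [Hd [Hh [Ph H1]]].
  assert (0 < q)%nat as Hq0 by lia.
  pose proof (sin_half_omega_pos p q Hp Hq) as Hs.
  split.
  - intros t. rewrite !taylor_coef_0. now apply (frame_order_0 p q m h phi psi theta d).
  - intros k Hk. destruct (frame_coef p q phi psi theta d k Hq0 HF ltac:(lia))
      as [C1 [C2 [C3 C]]].
    split; [|split].
    + apply unique_intro.
      * split; [exact C3|]. intros t. split; [|apply C].
        pose proof (frame_defect_coef p q m h phi psi theta d k t Hp Hq Hdef HF HO
          ltac:(lia)) as E.
        rewrite (bigO_eps_taylor_coef d (defect p q h psi theta) m t Hd) in E.
        -- lra.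
        -- destruct HF as [_ [_ [S2 [S3 _]]]]. now apply defect_smooth.
        -- now apply bigO_eps_slice.
        -- lia.
      * intros b [Sb Hb] t. apply (delta_unique p q); [exact Hq0| |].
        -- intros s. destruct (Hb s) as [Eb _].
           pose proof (frame_defect_coef p q m h phi psi theta d k s Hp Hq Hdef HF HO
             ltac:(lia)) as E.
           rewrite (bigO_eps_taylor_coef d (defect p q h psi theta) m s Hd) in E.
           ++ apply Rmult_eq_reg_l with (sin (omega p q / 2)); lra.
           ++ destruct HF as [_ [_ [S2 [S3 _]]]]. now apply defect_smooth.
           ++ now apply bigO_eps_slice.
           ++ lia.
        -- intros s. destruct (Hb s) as [_ ->]. apply C.
    + apply unique_intro.
      * split; [exact C1|]. intros t. split; apply C.
      * intros b [Sb Hb] t. apply (delta_unique p q); [exact Hq0| |].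
        -- intros s. destruct (Hb s) as [-> _]. apply C.
        -- intros s. destruct (Hb s) as [_ ->]. apply C.
    + intros t. apply C.
Qed.

(** The right-hand sides at order k involve only lower orders, hence the strong induction. Different
    persisting families for the same h can thus be compared through their coefficients. *)
Lemma recurrences_unique (p q m : nat) (h : R -> R -> R)
    (phi psi theta phi' psi' theta' : nat -> R -> R) :
  recurrences p q h m phi psi theta -> recurrences p q h m phi' psi' theta' ->
  forall k, (k < m)%nat -> phi k = phi' k /\ psi k = psi' k /\ theta k = theta' k.
Proof.
  intros [H0 H] [H0' H'] k. induction k as [k IH] using lt_wf_ind. intros Hk.
  destruct (Nat.eq_dec k 0) as [->|Hk0].
  - repeat split; apply functional_extensionality; intros t;
      destruct (H0 t) as [E1 [E2 E3]]; destruct (H0' t) as [E1' [E2' E3']]; congruence.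
  - destruct (H k ltac:(lia)) as [[_ U1] [[_ U2] U3]].
    destruct (H' k ltac:(lia)) as [[V1 _] [[V2 _] V3]].
    destruct (QRcoef_ext h psi psi' theta theta' k ltac:(lia)) as [EQ ER].
    { intros j Hj. destruct (IH j Hj ltac:(lia)) as [_ E]. exact E. }
    assert (theta k = theta' k) as Et.
    { apply U1. destruct V1 as [V1 V1']. split; [exact V1|]. rewrite EQ, ER. exact V1'. }
    assert (phi k = phi' k) as Ep.
    { apply U2. rewrite Et. exact V2. }
    split; [exact Ep|]. split; [|exact Et].
    apply functional_extensionality; intros t. now rewrite U3, V3, Ep, Et.
Qed.

(** On periodic functions mu annihilates delta and turns sigma into the factor 2. *)
Lemma frame_mu_Q (p q m : nat) (h phi psi theta : R -> R -> R) (d : R) (t : R) :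
  (0 < p)%nat -> (2 * p < q)%nat -> deformation_on d h ->
  frame p q d phi psi theta -> bigO_eps (S m) (defect p q h psi theta) ->
  mu p q (taylor_coef (defect p q h psi theta) (S m)) t
  = 2 * mu p q (Qcoef h (taylor_coef psi) (taylor_coef theta) (S m)) t.
Proof.
  intros Hp Hq Hdef HF HO. pose proof Hdef as [Hd [Hh [Ph H1]]].
  assert (0 < q)%nat as Hq0 by lia.
  pose proof (frame_order_0 p q m h phi psi theta d Hp Hq Hdef HF HO) as H0.
  destruct HF as [_ [S1 [S2 [S3 [P H]]]]].
  assert (periodic (taylor_coef (dh_sin h psi theta) (S m))) as PX.
  { apply (taylor_coef_periodic d); [exact Hd|]. intros s e He.
    apply (dh_sin_h_cos_periodic d); auto; intros; now apply P. }
  assert (periodic (taylor_coef (h_cos h psi theta) (S m))) as PY.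
  { apply (taylor_coef_periodic d); [exact Hd|]. intros s e He.
    apply (dh_sin_h_cos_periodic d); auto; intros; now apply P. }
  rewrite (mu_ext p q _ (fun t => sigma p q (taylor_coef (dh_sin h psi theta) (S m)) t
    - delta p q (taylor_coef (h_cos h psi theta) (S m)) t))
    by (intros; now apply (taylor_coef_defect d)).
  rewrite mu_minus. rewrite (mu_sigma p q _ t Hq0 PX), (mu_delta p q _ t Hq0 PY).
  rewrite Rminus_0_r. f_equal. apply mu_ext. intros s.
  apply (taylor_coef_dh_sin_h_cos d h psi theta (omega p q / 2)); auto; [lia|]. intros; apply H0.
Qed.

(** * Geometry of one reflection *)

(** With [proj_tangent], the coordinates of z(x) along e^{i phi} and i e^{i phi}. The point z(x)
    lies on the line (phi, lambda) when this value is lambda, and [proj_tangent] is then its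
    arc-length parameter. *)
Definition proj_normal (g : R -> R) (phi x : R) : R :=
  g x * cos (x - phi) - Derive g x * sin (x - phi).
Definition proj_tangent (g : R -> R) (phi x : R) : R :=
  g x * sin (x - phi) + Derive g x * cos (x - phi).

(** Since z'(x) is i e^{ix} times the radius of curvature g + g'', convexity gives this derivative
    the sign of -sin(x - phi). *)
Lemma proj_normal_derive (g : R -> R) (phi x : R) :
  ex_derive g x -> ex_derive (Derive g) x ->
  is_derive (proj_normal g phi) x (- (g x + Derive_n g 2 x) * sin (x - phi)).
Proof.
  intros H1 H2. apply Derive_correct in H1. apply Derive_correct in H2.
  change (Derive (Derive g) x) with (Derive_n g 2 x) in H2.
  revert H1 H2. generalize (Derive_n g 2 x). unfold proj_normal.
  generalize (Derive g) as g1. intros g1 l H1 H2.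
  assert (Dc : is_derive (fun y => cos (y - phi)) x (- sin (x - phi)))
    by (auto_derive; [exact I|unfold Rminus; ring]).
  assert (Ds : is_derive (fun y => sin (y - phi)) x (cos (x - phi)))
    by (auto_derive; [exact I|unfold Rminus; ring]).
  replace (- (g x + l) * sin (x - phi)) with
    ((g1 x * cos (x - phi) + g x * - sin (x - phi))
     - (l * sin (x - phi) + g1 x * cos (x - phi))) by ring.
  apply (is_derive_minus (K := R_AbsRing) (V := R_NormedModule)
    (fun y => g y * cos (y - phi)) (fun y => g1 y * sin (y - phi))).
  - apply (is_derive_mult g (fun y => cos (y - phi))); auto. exact Rmult_comm.
  - apply (is_derive_mult g1 (fun y => sin (y - phi))); auto. exact Rmult_comm.
Qed.

(** With its increasing counterpart: between the two support points of direction phi, each arc of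
    the curve crosses any line normal to e^{i phi} at most once. *)
Lemma proj_normal_decr (g : R -> R) (phi a b : R) :
  (forall x, ex_derive g x) -> (forall x, ex_derive (Derive g) x) ->
  (forall x, 0 < g x + Derive_n g 2 x) ->
  phi <= a -> a < b -> b <= phi + PI -> proj_normal g phi b < proj_normal g phi a.
Proof.
  intros H1 H2 Hc Ha Hab Hb.
  destruct (MVT_cor2 (proj_normal g phi)
    (fun x => - (g x + Derive_n g 2 x) * sin (x - phi)) a b Hab) as [c [E Hcab]].
  { intros c _. apply is_derive_Reals, proj_normal_derive; auto. }
  assert (0 < sin (c - phi)) by (apply sin_gt_0; lra).
  specialize (Hc c). assert (0 < (g c + Derive_n g 2 c) * sin (c - phi)) by nra. nra.
Qed.

Lemma proj_normal_incr (g : R -> R) (phi a b : R) :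
  (forall x, ex_derive g x) -> (forall x, ex_derive (Derive g) x) ->
  (forall x, 0 < g x + Derive_n g 2 x) ->
  phi - PI <= a -> a < b -> b <= phi -> proj_normal g phi a < proj_normal g phi b.
Proof.
  intros H1 H2 Hc Ha Hab Hb.
  destruct (MVT_cor2 (proj_normal g phi)
    (fun x => - (g x + Derive_n g 2 x) * sin (x - phi)) a b Hab) as [c [E Hcab]].
  { intros c _. apply is_derive_Reals, proj_normal_derive; auto. }
  assert (sin (c - phi) < 0) by (apply sin_lt_0_var; lra).
  specialize (Hc c). assert (0 < (g c + Derive_n g 2 c) * (- sin (c - phi))) by nra. nra.
Qed.

Lemma curve_line_point (g : R -> R) (phi x : R) :
  curve g x = line_point (phi, proj_normal g phi x) (proj_tangent g phi x).
Proof.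
  unfold curve, line_point, line_dir, expi, proj_normal, proj_tangent, Cplus, Cmult, RtoC.
  simpl. rewrite !cos_plus, !sin_plus, !cos_minus, !sin_minus, !cos_PI2, !sin_PI2.
  pose proof (sin2_cos2 phi) as E. unfold Rsqr in E.
  apply f_equal2.
  - transitivity ((g x * cos x - Derive g x * sin x)
      * (sin phi * sin phi + cos phi * cos phi)); [rewrite E|]; ring.
  - transitivity ((g x * sin x + Derive g x * cos x)
      * (sin phi * sin phi + cos phi * cos phi)); [rewrite E|]; ring.
Qed.

(** Translates a comparison in the direction phi + th into an order of points along a line with
    normal phi. *)
Lemma proj_normal_rotate (g : R -> R) (phi th x : R) :
  proj_normal g (phi + th) x
  = proj_normal g phi x * cos th + proj_tangent g phi x * sin th.
Proof.
  unfold proj_normal, proj_tangent.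
  replace (x - (phi + th)) with (x - phi - th) by ring.
  rewrite (cos_minus (x - phi)), (sin_minus (x - phi)). ring.
Qed.

Lemma reflect_line_dir (phi th l l1 : R) :
  line_dir (phi + 2 * th, l1) = reflect (expi (phi + th)) (line_dir (phi, l)).
Proof.
  unfold line_dir, reflect, expi, Cminus, Cplus, Copp, Cmult, Cconj, RtoC. simpl fst.
  simpl snd. unfold Re. simpl fst.
  replace (phi + 2 * th + PI / 2) with (phi + th + th + PI / 2) by ring.
  replace (phi + PI / 2) with (phi + th - th + PI / 2) by ring.
  generalize (phi + th) as s. intros s.
  pose proof (sin2_cos2 s) as E. unfold Rsqr in E.
  repeat rewrite ?cos_plus, ?sin_plus, ?cos_minus, ?sin_minus, ?cos_PI2, ?sin_PI2.
  apply f_equal2.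
  - transitivity (- (sin s * cos th - cos s * sin th)
      - 2 * sin th * (sin s * sin s + cos s * cos s) * cos s); [rewrite E|]; ring.
  - transitivity (cos s * cos th + sin s * sin th
      - 2 * sin th * (sin s * sin s + cos s * cos s) * sin s); [rewrite E|]; ring.
Qed.

Lemma billiard_step (g : R -> R) (phi th : R) :
  (forall n x, ex_derive_n g n x) -> periodic g ->
  (forall x, 0 < g x) -> (forall x, 0 < g x + Derive_n g 2 x) ->
  0 < th < PI ->
  billiard_map g
    (phi, g (phi + th) * cos th - Derive g (phi + th) * sin th)
    (phi + 2 * th, g (phi + th) * cos th + Derive g (phi + th) * sin th).
Proof.
  intros Hs Hp Hpos Hc Hth.
  assert (H1 : forall x, ex_derive g x) by (intros; apply (Hs 1%nat)).
  assert (H2 : forall x, ex_derive (Derive g) x) by (intros; apply (Hs 2%nat)).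
  set (la := g (phi + th) * cos th - Derive g (phi + th) * sin th).
  assert (Ela : la = proj_normal g phi (phi + th)).
  { unfold la, proj_normal. replace (phi + th - phi) with th by ring. reflexivity. }
  assert (E0 : forall f, proj_normal g f f = g f).
  { intros f. unfold proj_normal. replace (f - f) with 0 by ring.
    rewrite cos_0, sin_0. ring. }
  assert (Pp : forall f x, proj_normal g f (x + 2 * PI) = proj_normal g f x).
  { intros f x. unfold proj_normal.
    rewrite (Hp x).
    assert (Derive g (x + 2 * PI) = Derive g x) as ->.
    { rewrite <- (Derive_ext (fun y => g (y + 2 * PI)) g x Hp).
      symmetry. apply is_derive_unique, Derive_shift, H1. }
    replace (x + 2 * PI - f) with (x - f + 2 * PI) by ring.
    rewrite cos_plus, sin_plus, cos_2PI, sin_2PI. ring. }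
  assert (EPI : forall f, proj_normal g f (f + PI) = - g (f + PI)).
  { intros f. unfold proj_normal. replace (f + PI - f) with PI by ring.
    rewrite cos_PI, sin_PI. ring. }
  assert (An : - g (phi + PI) < la < g phi).
  { rewrite Ela, <- EPI, <- (E0 phi). split; apply proj_normal_decr; auto; lra. }
  split; [exact An|].
  (* The first intersection lies on the other arc, where [proj_normal] goes from -g(phi + PI) to
     g(phi) and so takes the value la. *)
  destruct (IVT_gen (proj_normal g phi) (phi - PI) phi la) as [x [Hx Ex]].
  { intros x. apply continuity_pt_filterlim.
    apply (ex_derive_continuous (proj_normal g phi)).
    eexists. apply proj_normal_derive; auto. }
  { rewrite E0, <- (Pp phi (phi - PI)).
    replace (phi - PI + 2 * PI) with (phi + PI) by ring. rewrite EPI.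
    rewrite Rmin_left, Rmax_right by lra. lra. }
  rewrite Rmin_left, Rmax_right in Hx by lra.
  assert (phi - PI < x < phi) as Hx'.
  { split.
    - destruct (Req_dec x (phi - PI)) as [->|]; [|lra]. exfalso.
      rewrite <- Pp in Ex. replace (phi - PI + 2 * PI) with (phi + PI) in Ex by ring.
      rewrite EPI in Ex. lra.
    - destruct (Req_dec x phi) as [->|]; [|lra]. exfalso. rewrite E0 in Ex. lra. }
  exists x, (phi + th), (proj_tangent g phi x), (proj_tangent g phi (phi + th)),
    (proj_tangent g (phi + 2 * th) (phi + th)).
  split; [|split; [|split; [|split]]].
  (* z(phi + th) is the support point in the direction phi + th. Both points have the same
     [proj_normal] along phi, so rotating back and using sin th > 0 orders their [proj_tangent]. *)
  - assert (proj_normal g (phi + th) x < proj_normal g (phi + th) (phi + th)) as Hlt.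
    { destruct (Rle_dec (phi + th - PI) x).
      - apply proj_normal_incr; auto; lra.
      - rewrite <- (Pp _ x). apply proj_normal_decr; auto; lra. }
    rewrite !proj_normal_rotate, Ex, <- Ela in Hlt.
    assert (0 < sin th) by (apply sin_gt_0; lra). nra.
  - rewrite <- Ex. apply curve_line_point.
  - rewrite Ela. apply curve_line_point.
  - apply reflect_line_dir.
  - replace (g (phi + th) * cos th + Derive g (phi + th) * sin th)
      with (proj_normal g (phi + 2 * th) (phi + th)); [apply curve_line_point|].
    unfold proj_normal. replace (phi + th - (phi + 2 * th)) with (- th) by ring.
    rewrite cos_neg, sin_neg. ring.
Qed.

(** * Increasing the order *)

Lemma smooth_periodic_bigO (c : R -> R) : smooth_periodic c -> bigO_eps 0 (fun t _ => c t).
Proof.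
  intros H. apply smooth_periodic_iff in H. destruct H as [P S].
  apply (smooth_periodic_bounded 1); [lra|exact S|]. intros; apply P.
Qed.

Lemma bigO_eps_monomial (k : nat) (c : R -> R) : smooth_periodic c ->
  bigO_eps k (fun t e => e ^ k * c t).
Proof.
  intros H. replace k with (k + 0)%nat at 1 by lia.
  apply (bigO_eps_mult k 0 (fun _ e => e ^ k)); [apply bigO_eps_pow|].
  now apply smooth_periodic_bigO.
Qed.

Lemma bigO_eps_shift (n : nat) (c : R) (a : R -> R -> R) :
  bigO_eps n a -> bigO_eps n (fun t e => a (t + c) e).
Proof. apply (bigO_eps_reparam n a (fun t _ => t + c)). Qed.

Lemma bigO_eps_small (a : R -> R -> R) (r : R) : 0 < r -> bigO_eps 1 a ->
  exists d, 0 < d /\ forall t e, Rabs e < d -> Rabs (a t e) < r.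
Proof.
  intros Hr H. destruct (bigO_eps_elim _ _ H) as [K [d [HK [Hd [_ B]]]]].
  exists (Rmin d (r / (K + 1))). split.
  - apply Rmin_pos; [exact Hd|]. apply Rdiv_lt_0_compat; lra.
  - intros t e He. pose proof (Rmin_l d (r / (K + 1))). pose proof (Rmin_r d (r / (K + 1))).
    eapply Rle_lt_trans; [apply B; lra|]. rewrite pow_1.
    assert (Rabs e * (K + 1) < r) as HH.
    { apply Rmult_lt_reg_r with (/ (K + 1)); [apply Rinv_0_lt_compat; lra|].
      rewrite Rmult_assoc, Rinv_r by lra. unfold Rdiv in *. lra. }
    pose proof (Rabs_pos e). nra.
Qed.

Lemma bigO_eps_zero (n : nat) : bigO_eps n (fun _ _ => 0).
Proof. apply bigO_eps_intro with 0 1; [lra|]. intros. rewrite Rabs_R0. lra. Qed.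

Lemma D1_shift (d : R) (a : R -> R -> R) (c t e : R) : smooth_on d a -> Rabs e < d ->
  D1 a (t + c) e = Derive (fun z => a (z + c) e) t.
Proof.
  intros Ha He. symmetry. apply is_derive_unique, (Derive_shift (fun z => a z e)).
  now apply (smooth_on_ex_derive_1 d).
Qed.

Lemma frame_D1_phi_periodic (p q : nat) (phi psi theta : R -> R -> R) (d t e : R) :
  frame p q d phi psi theta -> Rabs e < d -> D1 phi (t + 2 * PI) e = D1 phi t e.
Proof.
  intros [_ [S1 [_ [_ [P _]]]]] He. rewrite (D1_shift d) by assumption.
  rewrite (Derive_ext _ (fun z => phi z e + 2 * PI) t) by (intros; now apply P).
  apply is_derive_unique. rewrite <- (Rplus_0_r (D1 phi t e)).
  apply (is_derive_plus (K := R_AbsRing) (V := R_NormedModule) (fun z => phi z e)).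
  - now apply (smooth_on_is_derive_1 d).
  - apply @is_derive_const.
Qed.

Lemma frame_D1_phi (p q m : nat) (h phi psi theta : R -> R -> R) (d : R) :
  (0 < p)%nat -> (2 * p < q)%nat -> deformation_on d h ->
  frame p q d phi psi theta -> bigO_eps (S m) (defect p q h psi theta) ->
  bigO_eps 1 (fun t e => D1 phi t e - 1).
Proof.
  intros Hp Hq Hdef HF HO.
  pose proof (frame_order_0 p q m h phi psi theta d Hp Hq Hdef HF HO) as H0.
  pose proof HF as [Hd [S1 _]].
  apply (bigO_eps_1_of_zero d); [exact Hd| | |].
  - apply smooth_on_minus; [now apply smooth_on_D1|apply smooth_on_const].
  - intros t e He. now rewrite (frame_D1_phi_periodic p q phi psi theta d).
  - intros t. unfold D1.
    rewrite (Derive_ext (fun z => phi z 0) (fun z => z - omega p q / 2) t)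
      by (intros; now apply H0).
    rewrite (is_derive_unique _ _ 1); [ring|]. auto_derive; [exact I|ring].
Qed.

(** The correction is added to the given functions themselves, not to their truncations. The
    relations of a frame are affine, hence preserved exactly; the strip shrinks to keep phi' > 0. *)
Lemma frame_extend (p q m : nat) (h phi psi theta : R -> R -> R) (d : R) :
  (0 < p)%nat -> (2 * p < q)%nat -> deformation_on d h ->
  frame p q d phi psi theta -> bigO_eps (S m) (defect p q h psi theta) ->
  (forall t, mu p q (Qcoef h (taylor_coef psi) (taylor_coef theta) (S m)) t = 0) ->
  exists (d' : R) (phi' psi' theta' : R -> R -> R), 0 < d' <= d /\
    frame p q d' phi' psi' theta' /\ bigO_eps (S (S m)) (defect p q h psi' theta').
Proof.
  intros Hp Hq Hdef HF HO HQ. assert (0 < q)%nat as Hq0 by lia.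
  pose proof (sin_half_omega_pos p q Hp Hq) as Hs.
  pose proof (frame_order_0 p q m h phi psi theta d Hp Hq Hdef HF HO) as H0.
  pose proof (frame_D1_phi p q m h phi psi theta d Hp Hq Hdef HF HO) as OD.
  pose proof Hdef as [Hd [Hh [Ph _]]].
  pose proof HF as [_ [S1 [S2 [S3 [P H]]]]].
  set (s := sin (omega p q / 2)) in *.
  set (E := taylor_coef (defect p q h psi theta) (S m)).
  pose proof (defect_smooth d p q h psi theta Hh S2 S3) as SE.
  assert (PE : forall t e, Rabs e < d ->
    defect p q h psi theta (t + 2 * PI) e = defect p q h psi theta t e).
  { apply defect_periodic; auto; intros; now apply P. }
  assert (smooth_periodic E) as HE.
  { split; [now apply (taylor_coef_periodic d)|].
    intros n t. now apply (taylor_coef_smooth d). }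
  (* The correction v of theta adds s delta v to the coefficient E of the defect, hence delta v =
     -E/s. The correction u of phi must then satisfy delta u = 2 v, and that of psi is u + v. *)
  destruct (delta_solve p q (fun t => - / s * E t)) as [v [Sv [Dv Mv]]]; [exact Hq0| | |].
  { now apply smooth_periodic_scal. }
  { intros t. rewrite mu_scal. unfold E.
    rewrite (frame_mu_Q p q m h phi psi theta d t Hp Hq Hdef HF HO), HQ. ring. }
  destruct (delta_solve p q (fun t => 2 * v t)) as [u [Su [Du Mu]]]; [exact Hq0| | |].
  { now apply smooth_periodic_scal. }
  { intros t. rewrite mu_scal, Mv. ring. }
  pose proof (smooth_periodic_plus u v Su Sv) as Sw.
  set (phi' := fun t e => phi t e + e ^ S m * u t).
  set (psi' := fun t e => psi t e + e ^ S m * (u t + v t)).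
  set (theta' := fun t e => theta t e + e ^ S m * v t).
  assert (Sc : forall c, smooth_periodic c -> smooth_on d (fun t e => e ^ S m * c t)).
  { intros c Hc. apply (smooth_on_mult d (fun _ e => e ^ S m) (fun t _ => c t)).
    - apply smooth_on_pow.
    - apply smooth_on_lift. intros k t. apply Hc. }
  (* The derivative of the corrected phi is 1 + O(eps), hence positive on a smaller strip. *)
  assert (Od : bigO_eps 1 (fun t e => D1 phi t e - 1 + e ^ S m * Derive u t)).
  { apply bigO_eps_plus; [exact OD|]. apply bigO_eps_le with (S m); [lia|].
    apply bigO_eps_monomial. now apply smooth_periodic_Derive. }
  destruct (bigO_eps_small _ 1 Rlt_0_1 Od) as [d0 [Hd0 Bd]].
  exists (Rmin d d0), phi', psi', theta'.
  assert (0 < Rmin d d0) as Hm by now apply Rmin_pos.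
  pose proof (Rmin_l d d0) as Hl. pose proof (Rmin_r d d0) as Hr.
  assert (smooth_on d phi') as S1' by (apply smooth_on_plus; auto).
  assert (smooth_on d psi') as S2' by (apply smooth_on_plus; auto).
  assert (smooth_on d theta') as S3' by (apply smooth_on_plus; auto).
  split; [lra|]. split.
  - split; [exact Hm|]. repeat (split; [now apply smooth_on_le with d|]).
    split.
    + intros t e He. destruct (P t e ltac:(lra)) as [P1 [P2 P3]].
      unfold phi', psi', theta'. rewrite P1, P2, P3.
      rewrite (proj1 Su t), (proj1 Sv t). repeat split; ring.
    + intros t e He.
      destruct (H t e ltac:(lra)) as [E1 [E2 [E3 [E4 [E5 [E6 E7]]]]]].
      pose proof (Du t) as Du'. unfold sigma, delta, tau in E2, E3, Du' |- *.
      unfold phi', psi', theta'. repeat split.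
      * rewrite E1. ring.
      * rewrite E2. replace (u (t + omega p q)) with (u t + 2 * v t) by lra. field.
      * replace (u (t + omega p q)) with (u t + 2 * v t) by lra.
        rewrite Rmult_plus_distr_l, E3. ring.
      * rewrite (mu_ext p q _ (fun x => (psi x e - x) + e ^ S m * (u x + v x)))
          by (intros; ring).
        rewrite mu_plus, E4, mu_scal, mu_plus, Mu, Mv. ring.
      * rewrite (mu_ext p q _ (fun x => (x - phi x e) + (- e ^ S m) * u x))
          by (intros; ring).
        rewrite mu_plus, E5, mu_scal, Mu. ring.
      * rewrite mu_plus, E6, mu_scal, Mv. ring.
      * specialize (Bd t e ltac:(lra)). apply Rabs_def2 in Bd.
        assert (is_derive (fun x => phi x e + e ^ S m * u x) t
          (D1 phi t e + e ^ S m * Derive u t)) as Hder.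
        { apply (is_derive_plus (K := R_AbsRing) (V := R_NormedModule) (fun z => phi z e)).
          - apply (smooth_on_is_derive_1 d); [exact S1|lra].
          - apply is_derive_scal, Derive_correct. now apply smooth_periodic_ex_derive. }
        apply is_derive_unique in Hder. eapply Rlt_le_trans; [|right; symmetry; exact Hder]. lra.
  - destruct (billiard_compare d h (S m) (omega p q / 2) psi' psi theta' theta v)
      as [BX BY]; auto.
    + lia.
    + now apply smooth_periodic_bigO.
    + apply bigO_eps_ext with 1 (fun t e => e ^ S m * (u t + v t)); [lra| |].
      * intros. unfold psi'. ring.
      * apply (bigO_eps_monomial (S m) (fun t => u t + v t) Sw).
    + apply bigO_eps_ext with 1 (fun _ _ => 0); [lra| |].
      * intros. unfold theta'. ring.
      * apply bigO_eps_zero.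
    + apply (bigO_eps_1_of_zero d); auto.
      * apply smooth_on_minus; [exact S3|apply smooth_on_const].
      * intros t e He. destruct (P t e He) as [_ [_ ->]]. reflexivity.
      * intros t. destruct (H0 t) as [_ [_ ->]]. ring.
    + pose proof (taylor_coef_bigO_eps d (defect p q h psi theta) (S m) Hd SE PE) as TE.
      assert (bigO_eps (S (S m))
        (fun t e => defect p q h psi theta t e - e ^ S m * E t)) as OE.
      { apply TE. intros j t Hj.
        apply (bigO_eps_taylor_coef d _ m t Hd SE); [|lia]. now apply bigO_eps_slice. }
      (* The terms eps^(m+1) E and eps^(m+1) s delta v have been inserted with opposite signs; each
         group is then O(eps^(m+2)). *)
      apply bigO_eps_ext with 1 (fun t e =>
        (defect p q h psi theta t e - e ^ S m * E t)
        + ((dh_sin h psi' theta' (t + omega p q) e - dh_sin h psi theta (t + omega p q) e)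
           + (dh_sin h psi' theta' t e - dh_sin h psi theta t e))
        - ((h_cos h psi' theta' (t + omega p q) e - h_cos h psi theta (t + omega p q) e
            - e ^ S m * (- s * v (t + omega p q)))
           - (h_cos h psi' theta' t e - h_cos h psi theta t e - e ^ S m * (- s * v t))));
        [lra| |].
      * intros t e _. pose proof (Dv t) as Dv'. unfold delta, tau in Dv'.
        assert (E t = - s * (v (t + omega p q) - v t)) as ->
          by (rewrite Dv'; field; lra).
        unfold defect, sigma, delta, tau. ring.
      * apply bigO_eps_minus; [apply bigO_eps_plus; [exact OE|]|].
        -- apply bigO_eps_plus; [|exact BX].
           apply (bigO_eps_shift _ (omega p q) _ BX).
        -- apply bigO_eps_minus; [|exact BY].
           apply (bigO_eps_shift _ (omega p q) _ BY).
Qed.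

(** * The action and the billiard map *)

Definition mean_action (p q : nat) (h psi theta : R -> R -> R) (t e : R) : R :=
  mu p q (fun x => hcomp h psi x e * sin (theta x e)) t.

Lemma frame_D1_psi_theta (p q : nat) (phi psi theta : R -> R -> R) (d t e : R) :
  frame p q d phi psi theta -> Rabs e < d ->
  D1 psi t e = (D1 phi (t + omega p q) e + D1 phi t e) / 2 /\
  D1 theta t e = (D1 phi (t + omega p q) e - D1 phi t e) / 2.
Proof.
  intros [_ [S1 [S2 [S3 [P H]]]]] He.
  pose proof (smooth_on_is_derive_1 d phi t e S1 He) as D0.
  pose proof (smooth_on_is_derive_1 d _ t e (smooth_on_shift d (omega p q) _ S1) He) as D0'.
  change (D1 (fun t e => phi (t + omega p q) e) t e)
    with (Derive (fun z => phi (z + omega p q) e) t) in D0'.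
  rewrite <- (D1_shift d phi (omega p q) t e S1 He) in D0'.
  split; apply is_derive_unique; unfold Rdiv; rewrite Rmult_comm.
  - apply is_derive_ext with (fun x => / 2 * (phi (x + omega p q) e + phi x e)).
    + intros x. destruct (H x e He) as [_ [-> _]]. unfold sigma, tau. req. field.
    + apply is_derive_scal.
      now apply (is_derive_plus (K := R_AbsRing) (V := R_NormedModule)).
  - apply is_derive_ext with (fun x => / 2 * (phi (x + omega p q) e - phi x e)).
    + intros x. destruct (H x e He) as [_ [_ [E _]]]. unfold delta, tau in E. req. lra.
    + apply is_derive_scal.
      now apply (is_derive_minus (K := R_AbsRing) (V := R_NormedModule)).
Qed.

(** As psi' and theta' are half the sum and half the difference of tau phi' and phi', the derivative
    splits into a multiple of tau phi' and one of phi'. Applying tau to the second under mu makes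
    both multiples of tau phi', and their factors add up to the defect. *)
Lemma mean_action_derive (p q : nat) (h phi psi theta : R -> R -> R) (d t e : R) :
  (0 < q)%nat -> deformation_on d h -> frame p q d phi psi theta -> Rabs e < d ->
  is_derive (fun t => mean_action p q h psi theta t e) t
    (/ 2 * mu p q (fun x => D1 phi (x + omega p q) e * defect p q h psi theta x e) t).
Proof.
  intros Hq [Hd [Hh [Ph _]]] HF He. pose proof HF as [_ [S1 [S2 [S3 [P H]]]]].
  assert (DA : forall x, is_derive (fun x => hcomp h psi x e * sin (theta x e)) x
    (/ 2 * (D1 phi (x + omega p q) e * (dh_sin h psi theta x e + h_cos h psi theta x e)
            + D1 phi x e * (dh_sin h psi theta x e - h_cos h psi theta x e)))).
  { intros x.
    replace (/ 2 * _) with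
      ((D1 psi x e * D1 h (psi x e) e) * sin (theta x e)
       + hcomp h psi x e * (D1 theta x e * cos (theta x e))).
    - apply (is_derive_mult (fun x => hcomp h psi x e) (fun x => sin (theta x e)));
        [| |exact Rmult_comm].
      + apply (is_derive_comp (fun z => h z e) (fun x => psi x e)).
        * now apply (smooth_on_is_derive_1 d h).
        * now apply (smooth_on_is_derive_1 d psi).
      + apply (is_derive_comp sin (fun x => theta x e)).
        * auto_derive; [exact I|ring].
        * now apply (smooth_on_is_derive_1 d theta).
    - destruct (frame_D1_psi_theta p q phi psi theta d x e HF He) as [-> ->].
      unfold dh_sin, h_cos. change (dhcomp h psi x e) with (D1 h (psi x e) e). field. }
  pose proof (mu_is_derive p q (fun x => hcomp h psi x e * sin (theta x e)) t) as M.
  assert (PX := dh_sin_h_cos_periodic d h psi theta Hh Ph).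
  assert (forall x, dh_sin h psi theta (x + 2 * PI) e = dh_sin h psi theta x e /\
                    h_cos h psi theta (x + 2 * PI) e = h_cos h psi theta x e) as PXY.
  { intros x. apply PX; auto; intros; now apply P. }
  unfold mean_action.
  replace (/ 2 * mu p q (fun x => D1 phi (x + omega p q) e * defect p q h psi theta x e) t)
    with (mu p q (Derive (fun x => hcomp h psi x e * sin (theta x e))) t).
  { apply M. intros x. eexists. apply DA. }
  rewrite (mu_ext p q _ (fun x => / 2 *
     (D1 phi (x + omega p q) e * (dh_sin h psi theta x e + h_cos h psi theta x e)
      + D1 phi x e * (dh_sin h psi theta x e - h_cos h psi theta x e))))
    by (intros; apply is_derive_unique, DA).
  rewrite mu_scal, mu_plus. f_equal.
  rewrite <- (mu_tau p q (fun x => D1 phi x e * (dh_sin h psi theta x e - h_cos h psi theta x e)));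
    [|exact Hq|].
  - rewrite <- mu_plus. apply mu_ext. intros x. unfold defect, sigma, delta, tau. ring.
  - intros x. destruct (PXY x) as [-> ->].
    now rewrite (frame_D1_phi_periodic p q phi psi theta d).
Qed.

Lemma mean_action_periodic (p q : nat) (h phi psi theta : R -> R -> R) (d t e : R) :
  deformation_on d h -> frame p q d phi psi theta -> Rabs e < d ->
  mean_action p q h psi theta (t + 2 * PI) e = mean_action p q h psi theta t e.
Proof.
  intros [_ [_ [Ph _]]] [_ [_ [_ [_ [P _]]]]] He. unfold mean_action, mu, hcomp. f_equal.
  apply sum_n_ext_r. intros j.
  replace (t + 2 * PI + INR j * omega p q) with (t + INR j * omega p q + 2 * PI) by ring.
  destruct (P (t + INR j * omega p q) e He) as [_ [-> ->]]. now rewrite Ph.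
Qed.

Lemma bigO_eps_primitive (n : nat) (d : R) (a b : R -> R -> R) (M : R) : 0 < d ->
  (forall t e, Rabs e < d -> is_derive (fun z => a z e) t (b t e)) -> bigO_eps n b ->
  exists K d', 0 < d' <= d /\ forall t e, Rabs e < d' -> 0 <= t <= M ->
    Rabs (a t e - a 0 e) <= K * Rabs e ^ n.
Proof.
  intros Hd Hder HO. destruct (bigO_eps_elim _ _ HO) as [K [d' [HK [Hd' [_ B]]]]].
  exists (K * M), (Rmin d d'). pose proof (Rmin_l d d'). pose proof (Rmin_r d d').
  split; [split; [now apply Rmin_pos|lra]|]. intros t e He Ht.
  assert (Rabs e < d) as Hed by lra.
  eapply Rle_trans.
  - apply (mvt_bound (fun z => a z e) (K * Rabs e ^ n)).
    + intros z. eexists. apply Hder. lra.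
    + intros z. pose proof (is_derive_unique _ _ _ (Hder z e Hed)) as E.
      eapply Rle_trans; [right; apply f_equal; exact E|]. apply B. lra.
  - rewrite Rminus_0_r, (Rabs_pos_eq t) by lra.
    replace (K * M * Rabs e ^ n) with (K * Rabs e ^ n * M) by ring.
    apply Rmult_le_compat_l; [|lra].
    apply Rmult_le_pos; [exact HK|apply pow_le, Rabs_pos].
Qed.

Lemma bigO_eps_mu (p q n : nat) (a : R -> R -> R) :
  bigO_eps n a -> bigO_eps n (fun t e => mu p q (fun x => a x e) t).
Proof.
  intros H. apply bigO_eps_scal.
  apply (bigO_eps_sum n (pred q) (fun j t e => a (t + INR j * omega p q) e)).
  intros j _. now apply bigO_eps_shift.
Qed.

(** Since tau phi' = 1 + O(eps), replacing this factor by 1 in front of the defect produces an error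
    one order smaller. *)
Lemma bigO_D1_phi_defect (p q m : nat) (h phi psi theta : R -> R -> R) (d : R) :
  (0 < p)%nat -> (2 * p < q)%nat -> deformation_on d h -> frame p q d phi psi theta ->
  bigO_eps (S m) (defect p q h psi theta) ->
  bigO_eps (S (S m))
    (fun t e => (D1 phi (t + omega p q) e - 1) * defect p q h psi theta t e).
Proof.
  intros Hp Hq Hdef HF HO.
  pose proof (frame_D1_phi p q m h phi psi theta d Hp Hq Hdef HF HO) as OD.
  apply (bigO_eps_mult 1 (S m)); [|exact HO].
  apply (bigO_eps_shift 1 (omega p q) _ OD).
Qed.

Lemma frame_cond_A (p q m : nat) (h phi psi theta : R -> R -> R) (d d' : R) :
  (0 < p)%nat -> (2 * p < q)%nat -> deformation_on d h -> frame p q d phi psi theta ->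
  bigO_eps (S m) (defect p q h psi theta) -> d' < d -> cond_A p q h d' m psi theta.
Proof.
  intros Hp Hq Hdef HF HO Hd'. assert (0 < q)%nat as Hq0 by lia.
  pose proof (sin_half_omega_pos p q Hp Hq) as Hs.
  pose proof (frame_order_0 p q m h phi psi theta d Hp Hq Hdef HF HO) as H0.
  pose proof Hdef as [Hd [Hh [Ph H1]]]. pose proof HF as [_ [S1 [S2 [S3 [P H]]]]].
  set (A0 := fun e => 2 * INR q * mean_action p q h psi theta 0 e).
  (* L is the value of the action at t = 0. The default 1 ensures positivity on the whole interval;
     near eps = 0 the value is close to 2 q s > 0 and the default is not taken. *)
  exists (fun e => if Rlt_dec 0 (A0 e) then A0 e else 1). split.
  { intros e _. destruct (Rlt_dec 0 (A0 e)); lra. }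
  assert (SA : smooth_on d (fun _ e => mean_action p q h psi theta 0 e)).
  { apply (smooth_on_slice d (mean_action p q h psi theta)). unfold mean_action, mu.
    apply smooth_on_scal. apply (smooth_on_sum d (fun j t e =>
      hcomp h psi (t + INR j * omega p q) e * sin (theta (t + INR j * omega p q) e))).
    intros j _.
    apply (smooth_on_shift d _ (fun t e => hcomp h psi t e * sin (theta t e))).
    apply smooth_on_mult; [now apply (smooth_on_comp d h)|now apply smooth_on_sin]. }
  assert (V0 : mean_action p q h psi theta 0 0 = sin (omega p q / 2)).
  { unfold mean_action. rewrite (mu_ext p q _ (fun _ => sin (omega p q / 2))).
    - now apply mu_const.
    - intros x. unfold hcomp. rewrite H1. destruct (H0 x) as [_ [_ ->]]. ring. }
  assert (bigO_eps 1 (fun _ e => mean_action p q h psi theta 0 e - sin (omega p q / 2))) as OA.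
  { apply (bigO_eps_1_of_zero d); [exact Hd| |reflexivity|intros; rewrite V0; ring].
    apply smooth_on_minus; [exact SA|apply smooth_on_const]. }
  destruct (bigO_eps_small _ _ Hs OA) as [d1 [Hd1 B1]].
  destruct (bigO_eps_primitive (S m) d (mean_action p q h psi theta)
    (fun t e => / 2 * mu p q (fun x => D1 phi (x + omega p q) e * defect p q h psi theta x e) t)
    (2 * PI) Hd) as [K [d2 [Hd2 B2]]].
  { intros t e He. now apply (mean_action_derive p q h phi psi theta d). }
  { apply bigO_eps_scal. apply bigO_eps_mu.
    apply bigO_eps_ext with 1 (fun t e =>
      (D1 phi (t + omega p q) e - 1) * defect p q h psi theta t e + defect p q h psi theta t e);
      [lra|intros; ring|].
    apply bigO_eps_plus; [|exact HO]. apply bigO_eps_le with (S (S m)); [lia|].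
    now apply (bigO_D1_phi_defect p q m h phi psi theta d). }
  apply bigO_eps_intro with (2 * INR q * K) (Rmin d1 d2); [apply Rmin_pos; lra|].
  intros t e He. pose proof (Rmin_l d1 d2). pose proof (Rmin_r d1 d2).
  assert (0 < INR q) as Hqp by (apply lt_0_INR; lia).
  destruct (Rlt_dec 0 (A0 e)) as [_|Hn].
  - destruct (periodic_reduce t) as [r [Hr Er]].
    pose proof (Er (fun t => mean_action p q h psi theta t e)) as Et. cbv beta in Et.
    change (mu p q (fun x => hcomp h psi x e * sin (theta x e)) t)
      with (mean_action p q h psi theta t e).
    rewrite Et; [|intros z; apply (mean_action_periodic p q h phi psi theta d); auto; lra].
    unfold A0. rewrite <- Rmult_minus_distr_l, Rabs_mult.
    rewrite (Rabs_pos_eq (2 * INR q)) by lra. rewrite !Rmult_assoc. apply Rmult_le_compat_l; [lra|].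
    apply Rmult_le_compat_l; [lra|]. apply B2; lra.
  - exfalso. apply Hn. specialize (B1 0 e ltac:(lra)). apply Rabs_def2 in B1.
    unfold A0. apply Rmult_lt_0_compat; lra.
Qed.

(** With lambda = h cos theta - h' sin theta one reflection is exact, and lambda1 - tau lambda
    equals the defect identically. *)
Lemma frame_cond_P (p q m : nat) (h phi psi theta : R -> R -> R) (e0 d d' : R) :
  (0 < p)%nat -> (2 * p < q)%nat -> circle_deformation e0 h -> d <= e0 ->
  frame p q d phi psi theta ->
  bigO_eps (S m) (defect p q h psi theta) -> d' < d ->
  exists lambda, cond_P p q h d' m phi lambda.
Proof.
  intros Hp Hq Hc Hde HF HO Hd'.
  pose proof (circle_deformation_on e0 h Hc) as [_ [Hh0 [Ph H1]]].
  destruct Hc as [_ [_ [_ [_ Hpos]]]].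
  assert (Hh := smooth_on_le e0 d h Hde Hh0).
  pose proof HF as [Hd [S1 [S2 [S3 [P H]]]]].
  pose proof (dh_sin_smooth d h psi theta Hh S2 S3) as SX.
  pose proof (h_cos_smooth d h psi theta Hh S2 S3) as SY.
  assert (Step : forall t e, Rabs e <= d' ->
    billiard_map (fun x => h x e)
      (phi t e, h_cos h psi theta t e - dh_sin h psi theta t e)
      (tau p q (fun x => phi x e) t, h_cos h psi theta t e + dh_sin h psi theta t e)).
  { intros t e He. destruct (H t e ltac:(lra)) as [E1 [_ [E3 _]]].
    pose proof (lift_increment_bounds p q (fun x => phi x e) t Hp Hq) as B.
    unfold delta, tau in E3 |- *.
    replace (phi (t + omega p q) e) with (phi t e + 2 * theta t e) by lra.
    unfold dh_sin, h_cos, hcomp. change (dhcomp h psi t e) with (Derive (fun x => h x e) (psi t e)).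
    rewrite E1. apply (billiard_step (fun x => h x e)).
    - intros n x. apply (smooth_on_ex_derive_n_1 d); [exact Hh|lra].
    - intros x. apply Ph. lra.
    - intros x. apply Hpos. lra.
    - intros x. apply Hpos. lra.
    - assert (0 < phi (t + omega p q) e - phi t e < 2 * PI); [|lra]. apply B.
      + intros x. split; [apply (smooth_on_ex_derive_1 d phi); [exact S1|lra]|].
        apply H. lra.
      + intros x. apply P. lra. }
  exists (fun t e => h_cos h psi theta t e - dh_sin h psi theta t e).
  split; [now apply smooth_on_strip with d|].
  split; [apply smooth_on_strip with d; [exact Hd'|now apply smooth_on_minus]|].
  split; [|split; [|split]].
  - intros t e He. destruct (P t e ltac:(lra)) as [-> _]. ring.
  - intros t e He. destruct (dh_sin_h_cos_periodic d h psi theta Hh) with (t := t) (e := e)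
      as [-> ->]; auto; try lra; try (intros; apply P; assumption).
    intros; apply Ph; lra.
  - intros t e He. apply (Step t e He).
  - exists (fun t e => h_cos h psi theta t e + dh_sin h psi theta t e). split; [exact Step|].
    eapply bigO_eps_ext; [apply Rlt_0_1| |exact HO].
    intros t e _. unfold defect, sigma, delta, tau. ring.
Qed.

Lemma deformation_on_le (d d' : R) (h : R -> R -> R) : 0 < d' <= d ->
  deformation_on d h -> deformation_on d' h.
Proof.
  intros Hd [_ [S [P H1]]]. split; [lra|]. split; [now apply smooth_on_le with d|].
  split; [|exact H1]. intros; apply P; lra.
Qed.

(** (P) and (A) follow from (F) for the same functions, so persistence amounts to a frame with small
    defect. Halving d passes from the open strip to a closed one inside it. *)
Lemma persists_iff_frame (p q m : nat) (e0 : R) (h : R -> R -> R) :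
  (0 < p)%nat -> (2 * p < q)%nat -> circle_deformation e0 h ->
  persists p q e0 h m <->
  exists (d : R) (phi psi theta : R -> R -> R), 0 < d <= e0 /\
    frame p q d phi psi theta /\ bigO_eps (S m) (defect p q h psi theta).
Proof.
  intros Hp Hq Hc. split.
  - intros [d [phi [psi [theta [Hd [HF _]]]]]]. exists d, phi, psi, theta.
    split; [exact Hd|]. now apply cond_F_frame.
  - intros [d [phi [psi [theta [Hd [HF HO]]]]]]. exists (d / 2), phi, psi, theta.
    split; [lra|]. split; [apply frame_cond_F with d; [lra|exact HF|exact HO]|].
    split.
    + apply (frame_cond_P p q m h phi psi theta e0 d); auto; lra.
    + apply (frame_cond_A p q m h phi psi theta d); auto; [|lra].
      apply deformation_on_le with e0; [exact Hd|]. now apply circle_deformation_on.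
Qed.

(** * The mean of Q and the dependence on the deformation *)

Lemma smooth_continuous (a : R -> R) (t : R) : (forall n t, ex_derive_n a n t) ->
  continuous a t.
Proof. intros H. apply (ex_derive_continuous a t). apply (H 1%nat). Qed.

Lemma smooth_primitive (a : R -> R) : (forall n t, ex_derive_n a n t) ->
  exists Z : R -> R, (forall t, is_derive Z t (a t)) /\ (forall n t, ex_derive_n Z n t).
Proof.
  intros Ha.
  assert (D : forall t, is_derive (fun x => RInt a 0 x) t (a t)).
  { intros t. apply (is_derive_RInt a (fun x => RInt a 0 x) 0 t).
    - apply filter_forall. intros x. apply (RInt_correct (V := R_CompleteNormedModule)).
      apply (ex_RInt_continuous (V := R_CompleteNormedModule)).
      intros z _. now apply smooth_continuous.
    - now apply smooth_continuous. }
  exists (fun x => RInt a 0 x). split; [exact D|].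
  intros [|n] t; [exact I|]. destruct n as [|n].
  - exists (a t). apply D.
  - simpl. apply ex_derive_ext with (Derive_n a n); [|apply (Ha (S n) t)].
    intros x. symmetry.
    etransitivity; [|apply (Derive_n_ext (Derive (fun x => RInt a 0 x)) a n x);
      intros; apply is_derive_unique, D].
    pose proof (Derive_n_comp (fun x => RInt a 0 x) n 1 x) as E.
    rewrite Nat.add_comm in E. symmetry. exact E.
Qed.

Lemma zero_derive_constant (f : R -> R) (x y : R) :
  (forall t, is_derive f t 0) -> f x = f y.
Proof.
  intros H. assert (Rabs (f x - f y) <= 0 * Rabs (x - y)) as B.
  { apply mvt_bound.
    - intros z. eexists. apply H.
    - intros z. rewrite (is_derive_unique _ _ _ (H z)), Rabs_R0. lra. }
  rewrite Rmult_0_l in B. pose proof (Rabs_pos (f x - f y)).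
  destruct (Req_dec (f x) (f y)) as [E|E]; [exact E|].
  assert (f x - f y <> 0) as E' by lra. pose proof (Rabs_pos_lt _ E'). lra.
Qed.

(* The mean of Q_{m+1} vanishes because its mu-average is, up to a factor, the
   eps^(m+1) coefficient of the t-derivative of the periodic action. *)
Lemma frame_Q_primitive (p q m : nat) (h phi psi theta : R -> R -> R) (d : R) :
  (0 < p)%nat -> (2 * p < q)%nat -> deformation_on d h ->
  frame p q d phi psi theta -> bigO_eps (S m) (defect p q h psi theta) ->
  exists Z : R -> R, smooth_periodic Z /\ forall t,
    is_derive Z t (Qcoef h (taylor_coef psi) (taylor_coef theta) (S m) t).
Proof.
  intros Hp Hq Hdef HF HO. assert (0 < q)%nat as Hq0 by lia.
  pose proof (frame_order_0 p q m h phi psi theta d Hp Hq Hdef HF HO) as H0.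
  pose proof Hdef as [Hd [Hh [Ph _]]].
  pose proof HF as [_ [S1 [S2 [S3 [P H]]]]].
  pose proof (dh_sin_smooth d h psi theta Hh S2 S3) as SX.
  pose proof (defect_smooth d p q h psi theta Hh S2 S3) as SE.
  set (Q := taylor_coef (dh_sin h psi theta) (S m)).
  assert (EQ : forall t, Qcoef h (taylor_coef psi) (taylor_coef theta) (S m) t = Q t).
  { intros t. symmetry.
    apply (taylor_coef_dh_sin_h_cos d h psi theta (omega p q / 2)); auto; [lia|].
    intros; apply H0. }
  assert (PQ : periodic Q).
  { apply (taylor_coef_periodic d); [exact Hd|]. intros t e He.
    apply (dh_sin_h_cos_periodic d); auto; intros; now apply P. }
  destruct (smooth_primitive Q) as [Z [DZ SZ]].
  { intros n t. now apply (taylor_coef_smooth d). }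
  (* J is the integral of Q over a period; the increment of Z over any period is J, and so is that
     of its mu-average B. *)
  set (J := Z (2 * PI) - Z 0).
  assert (EJ : forall t, Z (t + 2 * PI) - Z t = J).
  { intros t. unfold J. replace (2 * PI) with (0 + 2 * PI) at 2 by ring.
    apply (zero_derive_constant (fun t => Z (t + 2 * PI) - Z t) t 0). intros x.
    replace 0 with (Q (x + 2 * PI) - Q x) by (rewrite PQ; ring).
    apply (is_derive_minus (K := R_AbsRing) (V := R_NormedModule)
      (fun x => Z (x + 2 * PI))); [|apply DZ].
    rewrite <- (is_derive_unique _ _ _ (DZ (x + 2 * PI))).
    apply Derive_shift. eexists. apply DZ. }
  set (B := mu p q Z).
  assert (DB : forall t, is_derive B t (mu p q Q t)).
  { intros t. rewrite <- (mu_ext p q (Derive Z) Q)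
      by (intros; now apply is_derive_unique).
    apply mu_is_derive. intros x. eexists. apply DZ. }
  assert (BJ : B (2 * PI) - B 0 = J).
  { unfold B, mu. rewrite <- Rmult_minus_distr_l.
    rewrite (sum_n_ext_r (fun j => Z (2 * PI + INR j * omega p q))
      (fun j => Z (0 + INR j * omega p q) + J)).
    - rewrite sum_n_plus_r, sum_n_const_r. replace (S (pred q)) with q by lia.
      field. apply not_0_INR. lia.
    - intros j. rewrite <- (EJ (0 + INR j * omega p q)).
      replace (0 + INR j * omega p q + 2 * PI) with (2 * PI + INR j * omega p q) by ring.
      ring. }
  set (E := taylor_coef (defect p q h psi theta) (S m)).
  (* The mean action minus eps^(m+1) B has a derivative of order eps^(m+2): tau phi' is replaced by
     1 and the defect by eps^(m+1) E, with mu E = 2 mu Q. *)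
  destruct (bigO_eps_primitive (S (S m)) d
    (fun t e => mean_action p q h psi theta t e - e ^ S m * B t)
    (fun t e => / 2 * mu p q (fun x =>
        (D1 phi (x + omega p q) e - 1) * defect p q h psi theta x e
        + (defect p q h psi theta x e - e ^ S m * E x)) t) (2 * PI) Hd)
    as [K [d' [Hd' HK]]].
  { intros t e He.
    replace (/ 2 * _) with
      (/ 2 * mu p q (fun x => D1 phi (x + omega p q) e * defect p q h psi theta x e) t
       - e ^ S m * mu p q Q t).
    - apply (is_derive_minus (K := R_AbsRing) (V := R_NormedModule)
        (fun t => mean_action p q h psi theta t e) (fun t => e ^ S m * B t)).
      + now apply (mean_action_derive p q h phi psi theta d).
      + apply is_derive_scal, DB.
    - rewrite (mu_ext p q (fun x => (_ - 1) * _ + _) (fun x =>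
        D1 phi (x + omega p q) e * defect p q h psi theta x e + (- e ^ S m) * E x))
        by (intros; ring).
      rewrite mu_plus, mu_scal. unfold E.
      rewrite (frame_mu_Q p q m h phi psi theta d t Hp Hq Hdef HF HO).
      rewrite (mu_ext p q _ _ t EQ). field. }
  { apply bigO_eps_scal.
    apply (bigO_eps_mu p q (S (S m)) (fun x e =>
      (D1 phi (x + omega p q) e - 1) * defect p q h psi theta x e
      + (defect p q h psi theta x e - e ^ S m * E x))).
    apply bigO_eps_plus; [now apply (bigO_D1_phi_defect p q m h phi psi theta d)|].
    apply (taylor_coef_bigO_eps d); auto.
    - apply defect_periodic; auto; intros; now apply P.
    - intros j t Hj. apply (bigO_eps_taylor_coef d _ m t Hd SE); [|lia].
      now apply bigO_eps_slice. }
  (* Over a full period the mean action does not change, so the increment is -eps^(m+1) J, which is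
     O(eps^(m+2)). *)
  assert (J = 0) as J0.
  { apply (bigO_eps_monomial_zero J (S m)). apply bigO_eps_intro with K d'; [lra|].
    intros t e He. specialize (HK (2 * PI) e He).
    assert (Rabs e < d) as Hed by lra.
    pose proof (mean_action_periodic p q h phi psi theta d 0 e Hdef HF Hed) as EA.
    rewrite Rplus_0_l in EA. rewrite EA in HK.
    rewrite <- Rabs_Ropp.
    replace (- (e ^ S m * J)) with (mean_action p q h psi theta 0 e - e ^ S m * B (2 * PI)
      - (mean_action p q h psi theta 0 e - e ^ S m * B 0)) by (rewrite <- BJ; ring).
    apply HK. pose proof PI_RGT_0. lra. }
  exists Z. split.
  - split; [|exact SZ]. intros t. specialize (EJ t). lra.
  - intros t. rewrite EQ. apply DZ.
Qed.

Lemma truncation_0 (a : nat -> R -> R) (k : nat) (t : R) : truncation a k t 0 = a 0%nat t.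
Proof. apply (sum_n_pow_0 (fun j => a j t)). Qed.

(** The difference g = h - h' and its derivative are O(eps^m), so no coefficient below order m
    changes. At order m only g_m'(t) sin al enters Q, which is exactly what subtracting sin al h_m'
    removes. *)
Lemma QRcoef_dependence (d al : R) (h h' : R -> R -> R) (psi theta : nat -> R -> R)
    (m k : nat) (t : R) :
  deformation_on d h -> deformation_on d h' -> (1 <= k <= m)%nat ->
  (forall j t, (1 <= j < m)%nat -> taylor_coef h j t = taylor_coef h' j t) ->
  (forall j n t, (j < k)%nat -> ex_derive_n (psi j) n t /\ ex_derive_n (theta j) n t) ->
  (forall t, psi 0%nat t = t /\ theta 0%nat t = al) ->
  ((k < m)%nat -> Qcoef h psi theta k t = Qcoef h' psi theta k t /\
                  Rcoef h psi theta k t = Rcoef h' psi theta k t) /\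
  (k = m -> Qcoef h psi theta m t - sin al * Derive (taylor_coef h m) t
            = Qcoef h' psi theta m t - sin al * Derive (taylor_coef h' m) t).
Proof.
  intros [Hd [Hh [Ph H1]]] [_ [Hh' [Ph' H1']]] Hk Hc Hs H0.
  set (g := fun t e => h t e - h' t e).
  assert (Sg : smooth_on d g) by now apply smooth_on_minus.
  assert (Pg : forall t e, Rabs e < d -> g (t + 2 * PI) e = g t e).
  { intros s e He. unfold g. now rewrite Ph, Ph'. }
  assert (Cg : forall j s, (j < m)%nat -> taylor_coef g j s = 0).
  { intros j s Hj. unfold g. rewrite (taylor_coef_minus d) by auto.
    destruct j as [|j].
    - rewrite !taylor_coef_0, H1, H1'. ring.
    - rewrite Hc by lia. ring. }
  pose proof (smooth_on_D1 d g Sg) as Sg1.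
  pose proof (D1_periodic d g Sg Pg) as Pg1.
  assert (Cg1 : forall j s, (j < m)%nat -> taylor_coef (D1 g) j s = 0).
  { intros j s Hj. rewrite (taylor_coef_D1 d) by auto.
    rewrite (Derive_ext _ (fun _ => 0) s) by (intros; now apply Cg).
    apply Derive_const. }
  pose proof (taylor_coef_bigO_eps d g m Hd Sg Pg Cg) as Og.
  pose proof (taylor_coef_bigO_eps d (D1 g) m Hd Sg1 Pg1 Cg1) as Og1.
  set (G := taylor_coef (D1 g) m) in *.
  assert (SG : smooth_periodic G).
  { split; [now apply (taylor_coef_periodic d)|].
    intros n s. now apply (taylor_coef_smooth d). }
  assert (Sg0 : smooth_periodic (taylor_coef g m)).
  { split; [now apply (taylor_coef_periodic d)|].
    intros n s. now apply (taylor_coef_smooth d). }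
  assert (Og' : bigO_eps m g).
  { apply bigO_eps_ext with 1 (fun t e => (g t e - e ^ m * taylor_coef g m t)
      + e ^ m * taylor_coef g m t); [lra|intros; ring|].
    apply bigO_eps_plus; [|now apply bigO_eps_monomial].
    apply bigO_eps_le with (S m); [lia|exact Og]. }
  assert (Og1' : bigO_eps m (D1 g)).
  { apply bigO_eps_ext with 1 (fun t e => (D1 g t e - e ^ m * G t) + e ^ m * G t);
      [lra|intros; ring|].
    apply bigO_eps_plus; [|now apply bigO_eps_monomial].
    apply bigO_eps_le with (S m); [lia|exact Og1]. }
  set (x := truncation psi k). set (y := truncation theta k).
  assert (Sx : smooth_on d x).
  { apply truncation_smooth. intros j Hj n s. apply (proj1 (Hs j n s ltac:(lia))). }
  assert (Sy : smooth_on d y).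
  { apply truncation_smooth. intros j Hj n s. apply (proj2 (Hs j n s ltac:(lia))). }
  assert (ED : forall s e, Rabs e < d ->
    dhcomp h x s e - dhcomp h' x s e = D1 g (x s e) e).
  { intros s e He. symmetry. apply (is_derive_unique (fun z => g z e)).
    apply (is_derive_minus (K := R_AbsRing) (V := R_NormedModule)
      (fun z => h z e) (fun z => h' z e)).
    - now apply (smooth_on_is_derive_1 d h).
    - now apply (smooth_on_is_derive_1 d h'). }
  assert (Osin : bigO_eps 0 (fun t e => sin (y t e))).
  { apply bigO_eps_bounded with 1. intros. apply Rabs_le, SIN_bound. }
  assert (Ocos : bigO_eps 0 (fun t e => cos (y t e))).
  { apply bigO_eps_bounded with 1. intros. apply Rabs_le, COS_bound. }
  split.
  - intros Hkm. split.
    + destruct (taylor_coef_compare d (dh_sin h x y) (dh_sin h' x y) k t 0) as [E _]; auto.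
      * now apply dh_sin_smooth.
      * now apply dh_sin_smooth.
      * apply (bigO_eps_slice (S k) (fun t e => dh_sin h x y t e - dh_sin h' x y t e - e ^ k * 0)).
        apply bigO_eps_ext with d (fun t e => D1 g (x t e) e * sin (y t e)); [exact Hd| |].
        -- intros s e He. rewrite <- ED by exact He. unfold dh_sin. ring.
        -- apply bigO_eps_le with (m + 0)%nat; [lia|]. apply bigO_eps_mult; [|exact Osin].
           now apply bigO_eps_reparam.
      * rewrite Rplus_0_r in E. exact E.
    + destruct (taylor_coef_compare d (h_cos h x y) (h_cos h' x y) k t 0) as [E _]; auto.
      * now apply h_cos_smooth.
      * now apply h_cos_smooth.
      * apply (bigO_eps_slice (S k) (fun t e => h_cos h x y t e - h_cos h' x y t e - e ^ k * 0)).
        apply bigO_eps_ext with d (fun t e => g (x t e) e * cos (y t e)); [exact Hd| |].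
        -- intros s e He. unfold h_cos, hcomp, g. ring.
        -- apply bigO_eps_le with (m + 0)%nat; [lia|]. apply bigO_eps_mult; [|exact Ocos].
           now apply bigO_eps_reparam.
      * rewrite Rplus_0_r in E. exact E.
  - intros Hkm.
    assert (EG : G t = Derive (taylor_coef h m) t - Derive (taylor_coef h' m) t).
    { unfold G. rewrite (taylor_coef_D1 d) by auto. unfold g.
      rewrite (Derive_ext _ (fun s => taylor_coef h m s - taylor_coef h' m s))
        by (intros; now apply (taylor_coef_minus d)).
      apply Derive_minus; [apply (taylor_coef_smooth d h m Hd Hh 1)
                          |apply (taylor_coef_smooth d h' m Hd Hh' 1)]. }
    destruct (taylor_coef_compare d (dh_sin h x y) (dh_sin h' x y) k t (sin al * G t)) as [E _];
      auto.
    + now apply dh_sin_smooth.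
    + now apply dh_sin_smooth.
    (* [F] is the factor of eps^m; only its value at eps = 0, namely G(t) sin al, counts at this
       order. *)
    + set (F := fun t e => G (x t e) * sin (y t e)).
      assert (SF : smooth_on d F).
      { apply smooth_on_mult; [|now apply smooth_on_sin].
        apply (smooth_on_comp d (fun z _ => G z)); [|exact Sx].
        apply smooth_on_lift. intros n z. apply SG. }
      pose proof (taylor_expansion_slice d F 0 t Hd SF) as OF.
      apply bigO_eps_ext with d (fun _ e =>
        (D1 g (x t e) e - e ^ m * G (x t e)) * sin (y t e)
        + e ^ m * (F t e - sum_n (fun j => e ^ j * taylor_coef F j t) 0)); [exact Hd| |].
      * intros s e He. rewrite sum_O, taylor_coef_0.
        unfold F, x at 4, y at 3. rewrite !truncation_0.
        destruct (H0 t) as [-> ->]. rewrite <- ED by exact He.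
        unfold dh_sin. fold x y. rewrite Hkm. simpl (e ^ 0). ring.
      * rewrite Hkm. apply bigO_eps_plus.
        -- replace (S m) with (S m + 0)%nat by lia.
           apply (bigO_eps_slice (S m + 0)
             (fun t e => (D1 g (x t e) e - e ^ m * G (x t e)) * sin (y t e))).
           apply bigO_eps_mult; [|exact Osin].
           apply (bigO_eps_reparam (S m) (fun t e => D1 g t e - e ^ m * G t) x Og1).
        -- replace (S m) with (m + 1)%nat by lia.
           apply (bigO_eps_mult m 1 (fun _ e => e ^ m)); [apply bigO_eps_pow|exact OF].
    + rewrite EG in E.
      change (taylor_coef (dh_sin h x y) k t) with (Qcoef h psi theta k t) in E.
      change (taylor_coef (dh_sin h' x y) k t) with (Qcoef h' psi theta k t) in E.
      rewrite Hkm in E. lra.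
Qed.

(** * Persistence at consecutive orders *)

Lemma recurrences_smooth (p q m : nat) (h : R -> R -> R)
    (phi psi theta : nat -> R -> R) (j : nat) :
  recurrences p q h m phi psi theta -> (j < m)%nat -> forall n t,
  ex_derive_n (psi j) n t /\ ex_derive_n (theta j) n t.
Proof.
  intros [H0 H] Hj n t. destruct (Nat.eq_dec j 0) as [->|Hj0].
  - split.
    + apply ex_derive_n_ext with (fun x => x); [intros; symmetry; apply H0|].
      apply (smooth_on_ex_derive_n_1 1 (fun t _ => t) n t 0); [apply smooth_on_fst|].
      rewrite Rabs_R0. lra.
    + apply ex_derive_n_ext with (fun x => omega p q / 2); [intros; symmetry; apply H0|].
      apply ex_derive_n_const.
  - destruct (H j ltac:(lia)) as [[[[_ U1] _] _] [[[[_ U2] _] _] U3]].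
    split; [|apply U1].
    apply ex_derive_n_ext with (fun x => phi j x + theta j x); [intros; symmetry; apply U3|].
    apply ex_derive_n_plus; apply filter_forall; auto.
Qed.

Definition coefs_agree (m : nat) (h h' : R -> R -> R) : Prop :=
  forall j t, (1 <= j < m)%nat -> taylor_coef h j t = taylor_coef h' j t.

Lemma recurrences_transfer (p q m : nat) (d : R) (h h' : R -> R -> R)
    (phi psi theta : nat -> R -> R) :
  deformation_on d h -> deformation_on d h' -> coefs_agree m h h' ->
  recurrences p q h m phi psi theta -> recurrences p q h' m phi psi theta.
Proof.
  intros Hh Hh' Hc HR. pose proof HR as [H0 H]. split; [exact H0|].
  intros k Hk.
  assert (forall t, Qcoef h psi theta k t = Qcoef h' psi theta k t /\
                    Rcoef h psi theta k t = Rcoef h' psi theta k t) as QR.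
  { intros t. apply (QRcoef_dependence d (omega p q / 2) h h' psi theta m k t); auto;
      [lia| | |lia].
    - intros j n s Hj. apply (recurrences_smooth p q m h phi psi theta); [exact HR|lia].
    - intros s. destruct (H0 s) as [_ E]. exact E. }
  rewrite <- (functional_extensionality (Qcoef h psi theta k) _ (fun t => proj1 (QR t))).
  rewrite <- (functional_extensionality (Rcoef h psi theta k) _ (fun t => proj2 (QR t))).
  now apply H.
Qed.

(** Deformations with the same h_1, ..., h_(m-1) admit the same functions zeta_m, so one choice can
    serve them all. *)
Lemma zeta_transfer (p q m : nat) (d : R) (h h' : R -> R -> R) (z : R -> R) :
  (1 <= m)%nat -> deformation_on d h -> deformation_on d h' -> coefs_agree m h h' ->
  zeta_by_recurrences p q h m z -> zeta_by_recurrences p q h' m z.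
Proof.
  intros Hm Hh Hh' Hc [phi [psi [theta [HR Hz]]]]. exists phi, psi, theta.
  split; [now apply (recurrences_transfer p q m d h h')|].
  intros t. rewrite Hz.
  apply (QRcoef_dependence d (omega p q / 2) h h' psi theta m m t); auto.
  - intros j n s Hj. now apply (recurrences_smooth p q m h phi psi theta).
  - intros s. destruct (proj1 HR s) as [_ E]. exact E.
Qed.

Lemma persists_recurrences (p q m : nat) (e0 : R) (h : R -> R -> R) :
  (0 < p)%nat -> (2 * p < q)%nat -> circle_deformation e0 h -> persists p q e0 h m ->
  exists phi psi theta, recurrences p q h (S m) phi psi theta /\
    exists Z : R -> R, smooth_periodic Z /\
      forall t, is_derive Z t (Qcoef h psi theta (S m) t).
Proof.
  intros Hp Hq Hc HP. pose proof (circle_deformation_on e0 h Hc) as Hdef0.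
  apply persists_iff_frame in HP; auto.
  destruct HP as [d [phi [psi [theta [Hd [HF HO]]]]]].
  assert (Hdef := deformation_on_le e0 d h Hd Hdef0).
  exists (taylor_coef phi), (taylor_coef psi), (taylor_coef theta). split.
  - now apply (frame_recurrences p q m h phi psi theta d).
  - now apply (frame_Q_primitive p q m h phi psi theta d).
Qed.

(** The families realizing the orders m and m + 1 may differ. Q_(m+1) is nevertheless common to
    them, as it involves coefficients up to order m only, and these are unique. *)
Lemma persists_succ (p q m : nat) (e0 : R) (h : R -> R -> R)
    (phi psi theta : nat -> R -> R) :
  (0 < p)%nat -> (2 * p < q)%nat -> circle_deformation e0 h -> persists p q e0 h m ->
  recurrences p q h (S m) phi psi theta ->
  persists p q e0 h (S m) <-> forall t, mu p q (Qcoef h psi theta (S m)) t = 0.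
Proof.
  intros Hp Hq Hc HP HR. pose proof (circle_deformation_on e0 h Hc) as Hdef0.
  split.
  - intros HP'. apply persists_iff_frame in HP'; auto.
    destruct HP' as [d [phi' [psi' [theta' [Hd [HF HO]]]]]].
    assert (Hdef := deformation_on_le e0 d h Hd Hdef0).
    assert (HO' := bigO_eps_le (S m) (S (S m)) _ ltac:(lia) HO).
    pose proof (frame_recurrences p q m h phi' psi' theta' d Hp Hq Hdef HF HO') as HR'.
    pose proof (recurrences_unique p q (S m) h _ _ _ _ _ _ HR HR') as U.
    destruct (QRcoef_ext h psi (taylor_coef psi') theta (taylor_coef theta') (S m))
      as [-> _]; [lia|intros j Hj; apply (U j Hj)|].
    intros t.
    pose proof (frame_mu_Q p q m h phi' psi' theta' d t Hp Hq Hdef HF HO') as E.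
    rewrite (mu_ext p q _ (fun _ => 0)) in E.
    + rewrite mu_const in E by lia. lra.
    + intros s. destruct HF as [Hd0 [_ [S2 [S3 _]]]].
      apply (bigO_eps_taylor_coef d _ (S m) s Hd0); [|now apply bigO_eps_slice|lia].
      apply defect_smooth; auto. apply Hdef.
  - intros HQ. apply persists_iff_frame in HP; auto.
    destruct HP as [d [phi' [psi' [theta' [Hd [HF HO]]]]]].
    assert (Hdef := deformation_on_le e0 d h Hd Hdef0).
    pose proof (frame_recurrences p q m h phi' psi' theta' d Hp Hq Hdef HF HO) as HR'.
    pose proof (recurrences_unique p q (S m) h _ _ _ _ _ _ HR HR') as U.
    destruct (QRcoef_ext h psi (taylor_coef psi') theta (taylor_coef theta') (S m))
      as [EQ _]; [lia|intros j Hj; apply (U j Hj)|].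
    rewrite EQ in HQ.
    destruct (frame_extend p q m h phi' psi' theta' d Hp Hq Hdef HF HO HQ)
      as [d' [phi2 [psi2 [theta2 [Hd' [HF' HO']]]]]].
    apply persists_iff_frame; auto. exists d', phi2, psi2, theta2.
    split; [lra|]. now split.
Qed.

Lemma persists_pred (p q m : nat) (e0 : R) (h : R -> R -> R) :
  (0 < p)%nat -> (2 * p < q)%nat -> circle_deformation e0 h ->
  persists p q e0 h (S m) -> persists p q e0 h m.
Proof.
  intros Hp Hq Hc HP. apply persists_iff_frame in HP; auto. apply persists_iff_frame; auto.
  destruct HP as [d [phi [psi [theta [Hd [HF HO]]]]]]. exists d, phi, psi, theta.
  split; [exact Hd|]. split; [exact HF|]. now apply bigO_eps_le with (S (S m)); [lia|].
Qed.

(** The parametrization of the circular caustic, kept constant in eps, already has a defect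
    O(eps). *)
Lemma persists_0 (p q : nat) (e0 : R) (h : R -> R -> R) :
  (0 < p)%nat -> (2 * p < q)%nat -> circle_deformation e0 h -> persists p q e0 h 0.
Proof.
  intros Hp Hq Hc. pose proof (circle_deformation_on e0 h Hc) as Hdef.
  pose proof Hdef as [Hd [Hh [Ph H1]]]. assert (0 < q)%nat as Hq0 by lia.
  apply persists_iff_frame; auto.
  exists e0, (fun t _ => t - omega p q / 2), (fun t _ => t), (fun _ _ => omega p q / 2).
  split; [lra|]. split.
  - split; [exact Hd|].
    split; [apply smooth_on_minus; [apply smooth_on_fst|apply smooth_on_const]|].
    split; [apply smooth_on_fst|]. split; [apply smooth_on_const|].
    split; [intros; repeat split; ring|].
    intros t e He. unfold sigma, delta, tau. repeat split; try field.
    + rewrite (mu_ext p q _ (fun _ => 0)) by (intros; ring). now apply mu_const.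
    + rewrite (mu_ext p q _ (fun _ => omega p q / 2)) by (intros; ring). now apply mu_const.
    + now apply mu_const.
    + rewrite (is_derive_unique _ _ 1); [lra|]. auto_derive; [exact I|ring].
  - apply (bigO_eps_1_of_zero e0); [exact Hd| | |].
    + apply defect_smooth; [exact Hh|apply smooth_on_fst|apply smooth_on_const].
    + apply defect_periodic; auto.
    + intros t. unfold defect, sigma, delta, tau, dh_sin, h_cos, hcomp.
      change (dhcomp h (fun t _ => t)) with (D1 h).
      rewrite !(D1_at_0 h 1 H1), !H1. ring.
Qed.

Lemma taylor_coef_smooth_periodic (e0 : R) (h : R -> R -> R) (k : nat) :
  deformation_on e0 h -> smooth_periodic (taylor_coef h k).
Proof.
  intros [Hd [Hh [Ph _]]]. split; [now apply (taylor_coef_periodic e0)|].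
  intros n t. now apply (taylor_coef_smooth e0).
Qed.

(** At the next order, zeta is a periodic primitive of Q divided by s, minus the coefficient of
    h. *)
Lemma persists_zeta_exists (p q m : nat) (e0 : R) (h : R -> R -> R) :
  (0 < p)%nat -> (2 * p < q)%nat -> circle_deformation e0 h -> persists p q e0 h m ->
  exists z, smooth_periodic z /\ zeta_by_recurrences p q h (S m) z.
Proof.
  intros Hp Hq Hc HP. pose proof (sin_half_omega_pos p q Hp Hq) as Hs.
  destruct (persists_recurrences p q m e0 h Hp Hq Hc HP)
    as [phi [psi [theta [HR [Z [SZ DZ]]]]]].
  pose proof (taylor_coef_smooth_periodic e0 h (S m) (circle_deformation_on _ _ Hc)) as Sh.
  exists (fun t => / sin (omega p q / 2) * Z t - taylor_coef h (S m) t). split.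
  - apply smooth_periodic_minus; [now apply smooth_periodic_scal|exact Sh].
  - exists phi, psi, theta. split; [exact HR|]. intros t.
    rewrite (is_derive_unique _ _ (/ sin (omega p q / 2) * Qcoef h psi theta (S m) t
      - Derive (taylor_coef h (S m)) t)).
    + field. lra.
    + apply (is_derive_minus (K := R_AbsRing) (V := R_NormedModule)
        (fun t => / sin (omega p q / 2) * Z t)).
      * apply is_derive_scal, DZ.
      * apply Derive_correct. now apply smooth_periodic_ex_derive.
Qed.

Lemma mu_Derive_eq_0 (p q : nat) (c : R) (a b : R -> R) : c <> 0 ->
  (forall t, mu p q a t = c * mu p q b t) ->
  ((forall t, mu p q a t = 0) <-> (forall t, mu p q b t = 0)).
Proof.
  intros Hc E. split; intros H t.
  - apply Rmult_eq_reg_l with c; [|exact Hc]. rewrite <- E, H. ring.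
  - rewrite E, H. ring.
Qed.

(** By definition of zeta, Q_(m+1) = s (h_(m+1) + zeta_(m+1))'. The additive constant in zeta
    disappears with the derivative. *)
Lemma persists_succ_zeta (p q m : nat) (e0 : R) (h : R -> R -> R) (z : R -> R) :
  (0 < p)%nat -> (2 * p < q)%nat -> circle_deformation e0 h -> persists p q e0 h m ->
  smooth_periodic z -> zeta_by_recurrences p q h (S m) z ->
  persists p q e0 h (S m) <->
  forall t, mu p q (Derive (fun x => taylor_coef h (S m) x + z x)) t = 0.
Proof.
  intros Hp Hq Hc HP Sz [phi [psi [theta [HR Hz]]]].
  pose proof (sin_half_omega_pos p q Hp Hq) as Hs.
  pose proof (taylor_coef_smooth_periodic e0 h (S m) (circle_deformation_on _ _ Hc)) as Sh.
  rewrite (persists_succ p q m e0 h phi psi theta Hp Hq Hc HP HR).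
  apply (mu_Derive_eq_0 p q (sin (omega p q / 2))); [lra|]. intros t.
  rewrite <- mu_scal. apply mu_ext. intros x.
  rewrite Derive_plus by now apply smooth_periodic_ex_derive.
  rewrite Rmult_plus_distr_l. specialize (Hz x).
  change (Derive (fun x => z x) x) with (Derive z x).
  change (Derive (fun x => taylor_coef h (S m) x) x) with (Derive (taylor_coef h (S m)) x).
  lra.
Qed.

(** * The coefficients Q_1 and Q_2 *)

Lemma Qcoef_1 (d : R) (p q : nat) (h : R -> R -> R) (psi theta : nat -> R -> R) (t : R) :
  deformation_on d h ->
  (forall t, psi 0%nat t = t /\ theta 0%nat t = omega p q / 2) ->
  Qcoef h psi theta 1 t = sin (omega p q / 2) * Derive (taylor_coef h 1) t /\
  Rcoef h psi theta 1 t = cos (omega p q / 2) * taylor_coef h 1 t.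
Proof.
  intros [Hd [Hh _]] H0. destruct (H0 t) as [E1 E2]. split.
  - rewrite <- (taylor_coef_D1 d) by auto. rewrite <- taylor_coef_scal.
    apply (taylor_coef_ext d); [exact Hd|]. intros e _. unfold truncation, dhcomp, D1.
    simpl pred. rewrite !sum_O, E1, E2. simpl. rewrite !Rmult_1_l. apply Rmult_comm.
  - rewrite <- taylor_coef_scal.
    apply (taylor_coef_ext d); [exact Hd|]. intros e _. unfold truncation, hcomp.
    simpl pred. rewrite !sum_O, E1, E2. simpl. rewrite !Rmult_1_l. apply Rmult_comm.
Qed.

Lemma taylor_coef_linear (c : R -> R) (t : R) : taylor_coef (fun t e => e * c t) 2 t = 0.
Proof.
  unfold taylor_coef. simpl Derive_n.
  rewrite (Derive_ext _ (fun _ => c t)).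
  - rewrite Derive_const. unfold Rdiv. ring.
  - intros x. apply is_derive_unique. auto_derive; [exact I|ring].
Qed.

(** Insert h' = eps a + eps^2 b + O(eps^3) at psi = t + eps psi_1. The factor of eps is needed to
    first order and that of eps^2 to order zero. *)
Lemma Qcoef_2 (d : R) (p q : nat) (h : R -> R -> R) (psi theta : nat -> R -> R) (t : R) :
  deformation_on d h ->
  (forall t, psi 0%nat t = t /\ theta 0%nat t = omega p q / 2) ->
  (forall n t, ex_derive_n (psi 1%nat) n t) ->
  (forall n t, ex_derive_n (theta 1%nat) n t) ->
  Qcoef h psi theta 2 t
  = sin (omega p q / 2) * Derive (taylor_coef h 2) t
    + sin (omega p q / 2) * Derive_n (taylor_coef h 1) 2 t * psi 1%nat t
    + cos (omega p q / 2) * Derive (taylor_coef h 1) t * theta 1%nat t.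
Proof.
  intros Hdef H0 Spsi Sth. pose proof Hdef as [Hd [Hh [Ph H1]]].
  set (al := omega p q / 2) in *.
  set (a := taylor_coef (D1 h) 1). set (b := taylor_coef (D1 h) 2).
  pose proof (smooth_on_D1 d h Hh) as Sh1. pose proof (D1_periodic d h Hh Ph) as Ph1.
  assert (Sa : forall n t, ex_derive_n a n t)
    by (intros; now apply (taylor_coef_smooth d)).
  assert (Sb : forall n t, ex_derive_n b n t)
    by (intros; now apply (taylor_coef_smooth d)).
  assert (Ea : forall s, a s = Derive (taylor_coef h 1) s)
    by (intros; now apply (taylor_coef_D1 d)).
  assert (Eb : b t = Derive (taylor_coef h 2) t) by now apply (taylor_coef_D1 d).
  assert (Eda : Derive a t = Derive_n (taylor_coef h 1) 2 t)
    by (simpl; apply Derive_ext, Ea).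
  rewrite <- Eda, <- Ea, <- Eb.
  set (x := fun s e => s + e * psi 1%nat s). set (y := fun s e => al + e * theta 1%nat s).
  assert (Sx : smooth_on d x).
  { apply smooth_on_plus; [apply smooth_on_fst|].
    apply (smooth_on_mult d (fun _ e => e) (fun s _ => psi 1%nat s)).
    - apply smooth_on_snd.
    - now apply smooth_on_lift. }
  assert (Sy : smooth_on d y).
  { apply smooth_on_plus; [apply smooth_on_const|].
    apply (smooth_on_mult d (fun _ e => e) (fun s _ => theta 1%nat s)).
    - apply smooth_on_snd.
    - now apply smooth_on_lift. }
  assert (EQ : Qcoef h psi theta 2 t = taylor_coef (dh_sin h x y) 2 t).
  { apply (taylor_coef_ext d); [exact Hd|]. intros e _.
    unfold dh_sin, dhcomp, truncation, x, y. simpl pred. rewrite !sum_n_Sr, !sum_O.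
    destruct (H0 t) as [-> ->]. simpl. now rewrite !Rmult_1_l, !Rmult_1_r. }
  rewrite EQ.
  set (F := fun s e => a (x s e) * sin (y s e)).
  set (Gf := fun s e => b (x s e) * sin (y s e)).
  assert (SF : smooth_on d F).
  { apply smooth_on_mult; [|now apply smooth_on_sin].
    apply (smooth_on_comp d (fun z _ => a z)); [|exact Sx]. now apply smooth_on_lift. }
  assert (SG : smooth_on d Gf).
  { apply smooth_on_mult; [|now apply smooth_on_sin].
    apply (smooth_on_comp d (fun z _ => b z)); [|exact Sx]. now apply smooth_on_lift. }
  assert (F0 : F t 0 = a t * sin al).
  { unfold F, x, y. now rewrite !Rmult_0_l, !Rplus_0_r. }
  assert (G0 : Gf t 0 = b t * sin al).
  { unfold Gf, x, y. now rewrite !Rmult_0_l, !Rplus_0_r. }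
  set (c1 := Derive a t * psi 1%nat t * sin al + a t * (theta 1%nat t * cos al)).
  assert (F1 : taylor_coef F 1 t = c1).
  { unfold taylor_coef. simpl. rewrite Rdiv_1_r. apply is_derive_unique.
    unfold F, c1.
    assert (is_derive (fun e => a (x t e)) 0 (Derive a t * psi 1%nat t)) as Da.
    { rewrite Rmult_comm.
      apply (is_derive_comp a (fun e => x t e) 0 (Derive a t) (psi 1%nat t)).
      - unfold x. rewrite Rmult_0_l, Rplus_0_r. apply Derive_correct, (Sa 1%nat).
      - unfold x. auto_derive; [exact I|ring]. }
    assert (is_derive (fun e => sin (y t e)) 0 (theta 1%nat t * cos al)) as Dy.
    { unfold y. auto_derive; [exact I|]. rewrite Rmult_0_l, Rplus_0_r. ring. }
    replace (a t) with (a (x t 0)) by (unfold x; now rewrite Rmult_0_l, Rplus_0_r).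
    replace (sin al) with (sin (y t 0)) by (unfold y; now rewrite Rmult_0_l, Rplus_0_r).
    apply (is_derive_mult (fun e => a (x t e)) (fun e => sin (y t e))); auto.
    exact Rmult_comm. }
  pose proof (taylor_expansion_slice d F 1 t Hd SF) as OF.
  pose proof (taylor_expansion_slice d Gf 0 t Hd SG) as OG.
  pose proof (taylor_expansion d (D1 h) 2 Hd Sh1 Ph1) as OH.
  (* The comparison function is the leading term, linear in eps, whose second coefficient is 0. *)
  destruct (taylor_coef_compare d (dh_sin h x y) (fun s e => e * (a s * sin al)) 2 t
    (c1 + b t * sin al)) as [E _]; auto.
  - now apply dh_sin_smooth.
  - apply (smooth_on_mult d (fun _ e => e) (fun s _ => a s * sin al)).
    + apply smooth_on_snd.
    + apply (smooth_on_mult d (fun s _ => a s) (fun _ _ => sin al)).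
      * now apply smooth_on_lift.
      * apply smooth_on_const.
  - apply bigO_eps_ext with 1 (fun _ e =>
      (D1 h (x t e) e - sum_n (fun j => e ^ j * taylor_coef (D1 h) j (x t e)) 2)
        * sin (y t e)
      + (e ^ 1 * (F t e - sum_n (fun j => e ^ j * taylor_coef F j t) 1)
      + e ^ 2 * (Gf t e - sum_n (fun j => e ^ j * taylor_coef Gf j t) 0))); [lra| |].
    + intros s e _. rewrite !sum_n_Sr, !sum_O.
      rewrite !taylor_coef_0, (D1_at_0 h 1 H1), F0, F1, G0. fold a b.
      unfold F, Gf, dh_sin. change (dhcomp h x t e) with (D1 h (x t e) e). simpl. ring.
    + apply bigO_eps_plus; [|apply bigO_eps_plus].
      * apply (bigO_eps_slice 3 (fun t e => (D1 h (x t e) e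
          - sum_n (fun j => e ^ j * taylor_coef (D1 h) j (x t e)) 2) * sin (y t e))).
        apply (bigO_eps_mult 3 0).
        -- apply (bigO_eps_reparam 3 (fun t e => D1 h t e
             - sum_n (fun j => e ^ j * taylor_coef (D1 h) j t) 2) x OH).
        -- apply bigO_eps_bounded with 1. intros. apply Rabs_le, SIN_bound.
      * apply (bigO_eps_mult 1 2 (fun _ e => e ^ 1)); [apply bigO_eps_pow|exact OF].
      * apply (bigO_eps_mult 2 1 (fun _ e => e ^ 2)); [apply bigO_eps_pow|exact OG].
  - rewrite E, taylor_coef_linear. unfold c1. ring.
Qed.

(* The difference of the two integrands is delta W with
   W = (c a - s theta' - s a') phi / 2. *)
Lemma mu_order_2 (p q : nat) (s c : R) (a phi psi theta : R -> R) (t : R) :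
  (0 < q)%nat -> smooth_periodic a -> smooth_periodic phi -> smooth_periodic theta ->
  (forall t, psi t = phi t + theta t) -> (forall t, delta p q phi t = 2 * theta t) ->
  (forall t, s * delta p q (Derive theta) t
             = c * delta p q a t - s * sigma p q (Derive a) t) ->
  mu p q (fun x => s * Derive a x * psi x + c * a x * theta x) t
  = s * mu p q (fun x => theta x * Derive theta x) t.
Proof.
  intros Hq Sa Sphi Sth Epsi Dphi Dth.
  set (W := fun x => / 2 * ((c * a x - s * Derive theta x - s * Derive a x) * phi x)).
  assert (PW : smooth_periodic W).
  { apply smooth_periodic_scal, smooth_periodic_mult; [|exact Sphi].
    apply smooth_periodic_minus; [apply smooth_periodic_minus|];
      apply smooth_periodic_scal; auto; now apply smooth_periodic_Derive. }
  rewrite <- mu_scal.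
  enough (mu p q (fun x => s * Derive a x * psi x + c * a x * theta x
    - s * (theta x * Derive theta x)) t = 0) as E by (rewrite mu_minus in E; lra).
  rewrite (mu_ext p q _ (delta p q W)); [apply mu_delta; [exact Hq|apply PW]|].
  intros x. specialize (Dphi x). specialize (Dth x).
  unfold W, delta, sigma, tau in *. rewrite Epsi.
  replace (phi (x + omega p q)) with (phi x + 2 * theta x) by lra.
  assert (s * Derive theta (x + omega p q) = s * Derive theta x
    + c * (a (x + omega p q) - a x)
    - s * (Derive a (x + omega p q) + Derive a x)) as -> by lra.
  field.
Qed.

(** * Pointwise convergence of Fourier series *)

Lemma ex_RInt_cont (f : R -> R) (a b : R) :
  (forall z, Rmin a b <= z <= Rmax a b -> continuous f z) -> ex_RInt f a b.
Proof. apply (ex_RInt_continuous (V := R_CompleteNormedModule)). Qed.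

(** [RInt] with all types fixed to R, which keeps equations between integrals within reach of
    [ring]. *)
Definition integral (f : R -> R) (a b : R) : R := RInt f a b.

Lemma integral_const (c a b : R) : integral (fun _ => c) a b = (b - a) * c.
Proof. apply (RInt_const (V := R_CompleteNormedModule) a b c). Qed.

Lemma integral_primitive (f Z : R -> R) (a b : R) :
  (forall x, is_derive Z x (f x)) -> (forall x, continuous f x) -> integral f a b = Z b - Z a.
Proof.
  intros HZ Hf. apply (is_RInt_unique (V := R_CompleteNormedModule)).
  apply (is_RInt_derive Z f); intros; auto.
Qed.

Lemma smooth_periodic_continuous (f : R -> R) (x : R) : smooth_periodic f -> continuous f x.
Proof. intros [_ H]. now apply smooth_continuous. Qed.

(** The increment of a primitive of f over a period does not depend on where the period starts. *)
Lemma integral_period_shift (f : R -> R) (c a : R) : smooth_periodic f ->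
  integral f 0 (2 * PI) = integral (fun u => f (c + u)) a (a + 2 * PI).
Proof.
  intros Hf. destruct (smooth_primitive f (proj2 Hf)) as [Z [DZ _]].
  rewrite (integral_primitive f Z); [|exact DZ|intros; now apply smooth_periodic_continuous].
  rewrite (integral_primitive (fun u => f (c + u)) (fun u => Z (c + u))).
  - replace (2 * PI) with (0 + 2 * PI) at 1 by ring.
    replace (c + (a + 2 * PI)) with (c + a + 2 * PI) by ring.
    apply (zero_derive_constant (fun x => Z (x + 2 * PI) - Z x)). intros x.
    replace 0 with (f (x + 2 * PI) - f x) by (rewrite (proj1 Hf); ring).
    apply (is_derive_minus (K := R_AbsRing) (V := R_NormedModule)
      (fun x => Z (x + 2 * PI))); [|apply DZ].
    rewrite <- (is_derive_unique _ _ _ (DZ (x + 2 * PI))).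
    apply Derive_shift. eexists. apply DZ.
  - intros x. apply is_derive_ext with (fun u => Z (u + c)).
    { intros u. f_equal. ring. }
    replace (c + x) with (x + c) by ring.
    rewrite <- (is_derive_unique _ _ _ (DZ (x + c))).
    apply Derive_shift. eexists. apply DZ.
  - intros x. apply continuous_ext with (fun u => f (u + c)).
    { intros u. f_equal. ring. }
    apply smooth_periodic_continuous. now apply smooth_periodic_shift.
Qed.

Lemma sin_int_PI (l : Z) : sin (IZR l * PI) = 0.
Proof. apply sin_eq_0_1. now exists l. Qed.

Lemma cos_int_2PI (l : Z) (x : R) : cos (x + IZR l * (2 * PI)) = cos x.
Proof.
  rewrite Rmult_comm. apply (periodic_mult_Z cos l x).
  intros y. rewrite cos_plus, cos_2PI, sin_2PI. ring.
Qed.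

Lemma sin_int_2PI (l : Z) (x : R) : sin (x + IZR l * (2 * PI)) = sin x.
Proof.
  rewrite Rmult_comm. apply (periodic_mult_Z sin l x).
  intros y. rewrite sin_plus, cos_2PI, sin_2PI. ring.
Qed.

Lemma smooth_periodic_cos (l : Z) (c : R) :
  smooth_periodic (fun x => cos (IZR l * x + c)).
Proof.
  apply smooth_periodic_iff. split.
  - intros x. rewrite <- (cos_int_2PI l (IZR l * x + c)). f_equal. ring.
  - apply smooth_on_cos, (smooth_on_plus 1 (fun x _ => IZR l * x)); [|apply smooth_on_const].
    apply smooth_on_scal, smooth_on_fst.
Qed.

Lemma smooth_periodic_sin (l : Z) (c : R) :
  smooth_periodic (fun x => sin (IZR l * x + c)).
Proof.
  apply smooth_periodic_iff. split.
  - intros x. rewrite <- (sin_int_2PI l (IZR l * x + c)). f_equal. ring.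
  - apply smooth_on_sin, (smooth_on_plus 1 (fun x _ => IZR l * x)); [|apply smooth_on_const].
    apply smooth_on_scal, smooth_on_fst.
Qed.

Lemma integral_cos_int (l : Z) : l <> 0%Z ->
  integral (fun u => cos (IZR l * u)) (- PI) PI = 0.
Proof.
  intros Hl. assert (IZR l <> 0) as Hl' by now apply eq_IZR_contrapositive.
  rewrite (integral_primitive _ (fun u => sin (IZR l * u) / IZR l)).
  - replace (IZR l * - PI) with (IZR (- l) * PI) by (rewrite opp_IZR; ring).
    rewrite !sin_int_PI. unfold Rdiv. ring.
  - intros x. auto_derive; [exact I|]. field. exact Hl'.
  - intros x. apply (ex_derive_continuous (fun u => cos (IZR l * u))). auto_derive. exact I.
Qed.

Lemma integral_plus (f g : R -> R) (a b : R) :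
  (forall z, Rmin a b <= z <= Rmax a b -> continuous f z) ->
  (forall z, Rmin a b <= z <= Rmax a b -> continuous g z) ->
  integral (fun x => f x + g x) a b = integral f a b + integral g a b.
Proof.
  intros Hf Hg. apply (RInt_plus (V := R_CompleteNormedModule)); now apply ex_RInt_cont.
Qed.

Lemma integral_scal (f : R -> R) (c a b : R) :
  (forall z, Rmin a b <= z <= Rmax a b -> continuous f z) ->
  integral (fun x => c * f x) a b = c * integral f a b.
Proof. intros Hf. apply (RInt_scal (V := R_CompleteNormedModule)). now apply ex_RInt_cont. Qed.

Lemma integral_ext (f g : R -> R) (a b : R) :
  (forall x, Rmin a b < x < Rmax a b -> f x = g x) -> integral f a b = integral g a b.
Proof. apply (RInt_ext f g). Qed.

Lemma continuous_mult_r (f g : R -> R) (x : R) :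
  continuous f x -> continuous g x -> continuous (fun y => f y * g y) x.
Proof. apply (continuous_mult f g x). Qed.

Lemma continuous_plus_r (f g : R -> R) (x : R) :
  continuous f x -> continuous g x -> continuous (fun y => f y + g y) x.
Proof. apply (continuous_plus (V := R_NormedModule) f g x). Qed.

Lemma continuous_scal_const (c : R) (g : R -> R) (x : R) :
  continuous g x -> continuous (fun y => c * g y) x.
Proof. apply (continuous_mult_r (fun _ => c)). apply continuous_const. Qed.

(** * Bessel's inequality for the numerators of the Dirichlet kernels *)

Definition half_sin (n : nat) (u : R) : R := sin ((INR n + / 2) * u).

Lemma half_sin_continuous (n : nat) (u : R) : continuous (half_sin n) u.
Proof. apply (ex_derive_continuous (half_sin n)). unfold half_sin. auto_derive. exact I. Qed.

Lemma half_sin_prod (n m : nat) (u : R) :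
  half_sin n u * half_sin m u
  = / 2 * (cos (IZR (Z.of_nat n - Z.of_nat m) * u)
           + (-1) * cos (IZR (Z.of_nat n + Z.of_nat m + 1) * u)).
Proof.
  unfold half_sin. rewrite minus_IZR, !plus_IZR, <- !INR_IZR_INZ.
  replace ((INR n - INR m) * u) with ((INR n + / 2) * u - (INR m + / 2) * u) by ring.
  replace ((INR n + INR m + 1) * u) with ((INR n + / 2) * u + (INR m + / 2) * u) by field.
  rewrite cos_minus, cos_plus. field.
Qed.

(** The half-integers combine into the integer frequencies n - m and n + m + 1; the second is never
    0, so only n = m leaves a nonzero integral. *)
Lemma integral_half_sin (n m : nat) :
  integral (fun u => half_sin n u * half_sin m u) (- PI) PI = if Nat.eqb n m then PI else 0.
Proof.
  rewrite (integral_ext _ _ _ _ (fun u _ => half_sin_prod n m u)).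
  assert (C : forall l z, continuous (fun u => cos (IZR l * u)) z).
  { intros l z. apply (ex_derive_continuous (fun u => cos (IZR l * u))). auto_derive. exact I. }
  rewrite integral_scal, integral_plus, integral_scal; auto.
  - rewrite (integral_cos_int (Z.of_nat n + Z.of_nat m + 1)) by lia.
    destruct (Nat.eqb_spec n m) as [->|Hne].
    + rewrite Z.sub_diag. rewrite (integral_ext _ (fun _ => 1)).
      * rewrite integral_const. field.
      * intros x _. rewrite Rmult_0_l. apply cos_0.
    + rewrite integral_cos_int by lia. ring.
  - intros z _. now apply continuous_scal_const.
  - intros z _. apply continuous_plus_r; [|apply continuous_scal_const]; auto.
Qed.

Definition bessel_coef (g : R -> R) (n : nat) : R :=
  / PI * integral (fun u => g u * half_sin n u) (- PI) PI.

(** The remainder of g after subtracting its projections onto the first n half-integer sines, one at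
    a time, so that consecutive norms differ by one square. *)
Fixpoint bessel_rest (g : R -> R) (n : nat) : R -> R :=
  match n with
  | O => g
  | S n => fun u => bessel_rest g n u + (- bessel_coef g n) * half_sin n u
  end.

Lemma bessel_range (z : R) : Rmin (- PI) PI <= z <= Rmax (- PI) PI -> - PI <= z <= PI.
Proof. pose proof PI_RGT_0. rewrite Rmin_left, Rmax_right by lra. auto. Qed.

Lemma bessel_rest_continuous (g : R -> R) (n : nat) (z : R) :
  (forall z, - PI <= z <= PI -> continuous g z) -> - PI <= z <= PI ->
  continuous (bessel_rest g n) z.
Proof.
  intros Hg Hz. induction n as [|n IH]; [now apply Hg|].
  simpl. apply continuous_plus_r; [exact IH|]. apply continuous_scal_const, half_sin_continuous.
Qed.

Lemma bessel_rest_coef (g : R -> R) (n m : nat) :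
  (forall z, - PI <= z <= PI -> continuous g z) -> (n <= m)%nat ->
  integral (fun u => bessel_rest g n u * half_sin m u) (- PI) PI = PI * bessel_coef g m.
Proof.
  pose proof PI_RGT_0. intros Hg Hnm. induction n as [|n IH].
  - unfold bessel_coef. simpl. field. lra.
  - rewrite (integral_ext _ (fun u => bessel_rest g n u * half_sin m u
      + (- bessel_coef g n) * (half_sin n u * half_sin m u))) by (intros; simpl; ring).
    assert (C : forall z, Rmin (- PI) PI <= z <= Rmax (- PI) PI ->
      continuous (fun u => half_sin n u * half_sin m u) z).
    { intros z _. apply continuous_mult_r; apply half_sin_continuous. }
    rewrite integral_plus, integral_scal, IH, integral_half_sin; [|lia|exact C| |].
    2: { intros z Hz. apply continuous_mult_r; [|apply half_sin_continuous].
         now apply bessel_rest_continuous, bessel_range. }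
    2: { intros z Hz. now apply continuous_scal_const, C. }
    rewrite (proj2 (Nat.eqb_neq n m)) by lia. ring.
Qed.

Lemma bessel_rest_norm (g : R -> R) (n : nat) :
  (forall z, - PI <= z <= PI -> continuous g z) ->
  integral (fun u => bessel_rest g (S n) u * bessel_rest g (S n) u) (- PI) PI
  = integral (fun u => bessel_rest g n u * bessel_rest g n u) (- PI) PI
    - PI * (bessel_coef g n * bessel_coef g n).
Proof.
  intros Hg.
  rewrite (integral_ext _ (fun u => bessel_rest g n u * bessel_rest g n u
      + ((-2 * bessel_coef g n) * (bessel_rest g n u * half_sin n u)
      + (bessel_coef g n * bessel_coef g n) * (half_sin n u * half_sin n u))))
    by (intros; simpl; ring).
  assert (Cr : forall z, Rmin (- PI) PI <= z <= Rmax (- PI) PI ->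
    continuous (bessel_rest g n) z).
  { intros z Hz. now apply bessel_rest_continuous, bessel_range. }
  assert (C1 : forall z, Rmin (- PI) PI <= z <= Rmax (- PI) PI ->
    continuous (fun u => bessel_rest g n u * half_sin n u) z).
  { intros z Hz. apply continuous_mult_r; [now apply Cr|apply half_sin_continuous]. }
  assert (C2 : forall z, Rmin (- PI) PI <= z <= Rmax (- PI) PI ->
    continuous (fun u => half_sin n u * half_sin n u) z).
  { intros z _. apply continuous_mult_r; apply half_sin_continuous. }
  rewrite integral_plus, integral_plus, !integral_scal, bessel_rest_coef,
    integral_half_sin; auto.
  - rewrite Nat.eqb_refl. ring.
  - intros z Hz. now apply continuous_scal_const, C1.
  - intros z Hz. now apply continuous_scal_const, C2.
  - intros z Hz. apply continuous_mult_r; now apply Cr.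
  - intros z Hz.
    apply continuous_plus_r; apply continuous_scal_const; [now apply C1|now apply C2].
Qed.

(** The squared norms of the remainders decrease and are nonnegative, hence converge; their
    successive differences, PI times the squared coefficients, tend to 0. *)
Lemma bessel_coef_lim (g : R -> R) :
  (forall z, - PI <= z <= PI -> continuous g z) -> is_lim_seq (bessel_coef g) 0.
Proof.
  intros Hg. pose proof PI_RGT_0 as HP.
  set (v := fun n => integral (fun u => bessel_rest g n u * bessel_rest g n u) (- PI) PI).
  assert (V : forall n, v (S n) = v n - PI * (bessel_coef g n * bessel_coef g n))
    by (intros; now apply bessel_rest_norm).
  destruct (ex_finite_lim_seq_decr v 0) as [l Hl].
  - intros n. rewrite V. pose proof (Rle_0_sqr (bessel_coef g n)). unfold Rsqr in *. nra.
  - intros n. unfold v. apply RInt_ge_0; [lra| |].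
    + apply ex_RInt_cont. intros z Hz. apply bessel_range in Hz.
      apply continuous_mult_r; now apply bessel_rest_continuous.
    + intros x _. apply Rle_0_sqr.
  - apply is_lim_seq_abs_0.
    apply is_lim_seq_ext with (fun n => sqrt (/ PI * (v n - v (S n)))).
    + intros n. rewrite V.
      replace (/ PI * _) with (Rsqr (bessel_coef g n)) by (unfold Rsqr; field; lra).
      apply sqrt_Rsqr_abs.
    + rewrite <- sqrt_0. replace 0 with (/ PI * (l - l)) by ring.
      apply (is_lim_seq_continuous sqrt).
      * apply continuity_pt_sqrt. right. ring.
      * apply (is_lim_seq_scal_l (fun n => v n - v (S n)) (/ PI) (l - l)).
        apply is_lim_seq_minus'; [exact Hl|]. now apply is_lim_seq_incr_1 in Hl.
Qed.

(** * Divided differences and the Dirichlet kernel *)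

Definition slope (f : R -> R) (u : R) : R := if Req_dec_T u 0 then Derive f 0 else f u / u.

Lemma slope_mult (f : R -> R) (u : R) : f 0 = 0 -> u * slope f u = f u.
Proof.
  intros H0. unfold slope. destruct (Req_dec_T u 0) as [->|Hu].
  - rewrite H0. ring.
  - field. exact Hu.
Qed.

(** At 0 this is the definition of the derivative. A quotient of two slopes replaces a quotient of
    functions both vanishing at 0. *)
Lemma slope_continuous (f : R -> R) (u : R) : (forall u, ex_derive f u) -> f 0 = 0 ->
  continuity_pt (slope f) u.
Proof.
  intros Hf H0. destruct (Req_dec u 0) as [->|Hu].
  - intros eps Heps.
    pose proof (Derive_correct f 0 (Hf 0)) as D. apply is_derive_Reals in D.
    destruct (D eps Heps) as [del Hdel]. exists del. split; [apply cond_pos|].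
    intros x [[_ Hx0] Hx]. simpl in Hx |- *. unfold Rdist in *. rewrite Rminus_0_r in Hx.
    unfold slope. destruct (Req_dec_T x 0) as [->|_]; [now elim Hx0|].
    destruct (Req_dec_T 0 0) as [_|Hn]; [|now elim Hn].
    specialize (Hdel x (fun E => Hx0 (eq_sym E)) Hx).
    rewrite Rplus_0_l, H0, Rminus_0_r in Hdel. exact Hdel.
  - apply continuity_pt_ext_loc with (fun u => f u / u).
    + assert (0 < Rabs u) as Hp by now apply Rabs_pos_lt.
      exists (mkposreal _ Hp). intros y Hy. unfold slope.
      destruct (Req_dec_T y 0) as [->|_]; [|reflexivity].
      change (Rabs (0 - u) < Rabs u) in Hy.
      rewrite Rminus_0_l, Rabs_Ropp in Hy. lra.
    + apply continuity_pt_div; [| |exact Hu].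
      * apply continuity_pt_filterlim. apply (ex_derive_continuous f u (Hf u)).
      * apply continuity_pt_id.
Qed.

(** Each k >= 1 stands for the two frequencies k and -k. *)
Definition dir_weight (k : nat) : R := match k with O => 1 | S _ => 2 end.

(** Telescoping: 2 sin(u/2) cos(k u) is the difference of two consecutive half-integer sines. The
    denominator is kept on the left, so that u = 0 is allowed. *)
Lemma dirichlet_kernel (n : nat) (u : R) :
  sin (u / 2) * sum_n (fun k => dir_weight k * cos (INR k * u)) n = half_sin n u.
Proof.
  induction n as [|n IH].
  - rewrite sum_O. unfold half_sin. simpl. rewrite Rmult_0_l, cos_0.
    replace ((0 + / 2) * u) with (u / 2) by field. ring.
  - rewrite sum_n_Sr, Rmult_plus_distr_l, IH. unfold half_sin, dir_weight.
    rewrite S_INR.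
    replace ((INR n + / 2) * u) with ((INR n + 1) * u - u / 2) by field.
    replace ((INR n + 1 + / 2) * u) with ((INR n + 1) * u + u / 2) by field.
    rewrite sin_plus, sin_minus. ring.
Qed.

Lemma integral_sum (f : nat -> R -> R) (a b : R) (n : nat) :
  (forall k z, continuous (f k) z) ->
  integral (fun x => sum_n (fun k => f k x) n) a b = sum_n (fun k => integral (f k) a b) n.
Proof.
  intros Hf.
  assert (Hs : forall n z, continuous (fun x => sum_n (fun k => f k x) n) z).
  { clear n. induction n as [|n IH]; intros z.
    - apply continuous_ext with (f 0%nat); [intros; now rewrite sum_O|apply Hf].
    - apply continuous_ext with (fun x => sum_n (fun k => f k x) n + f (S n) x);
        [intros; now rewrite sum_n_Sr|]. now apply continuous_plus_r. }
  induction n as [|n IH].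
  - rewrite sum_O. apply integral_ext. intros. now rewrite sum_O.
  - rewrite sum_n_Sr, <- IH. rewrite <- integral_plus by auto.
    apply integral_ext. intros. now rewrite sum_n_Sr.
Qed.

(** The partial sum minus a(t) is half the Bessel coefficient of (a(t + u) - a(t)) / sin(u/2), a
    continuous function on [-PI, PI] because a is differentiable. *)
Lemma dirichlet_limit (a : R -> R) (t : R) : smooth_periodic a ->
  is_lim_seq (fun n => sum_n (fun k => dir_weight k *
    (/ (2 * PI) * integral (fun u => a (t + u) * cos (INR k * u)) (- PI) PI)) n) (a t).
Proof.
  intros Ha. pose proof PI_RGT_0 as HP.
  set (F := fun u => a (t + u) - a t).
  assert (DF : forall u, ex_derive F u).
  { intros u. unfold F. apply (ex_derive_minus (K := R_AbsRing) (V := R_NormedModule)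
      (fun u => a (t + u)) (fun _ => a t)); [|apply ex_derive_const].
    apply ex_derive_comp; [now apply smooth_periodic_ex_derive|].
    auto_derive. exact I. }
  assert (DS : forall u, ex_derive (fun u => sin (u / 2)) u)
    by (intros; auto_derive; exact I).
  assert (F0 : F 0 = 0) by (unfold F; rewrite Rplus_0_r; ring).
  assert (S0 : sin (0 / 2) = 0) by (unfold Rdiv; rewrite Rmult_0_l; apply sin_0).
  (* On the closed interval sin(u/2) vanishes only at 0, where its slope is 1/2. *)
  assert (SN : forall u, - PI <= u <= PI -> slope (fun u => sin (u / 2)) u <> 0).
  { intros u Hu. unfold slope. destruct (Req_dec_T u 0) as [_|Hn].
    - rewrite (is_derive_unique _ _ (/ 2)); [lra|]. auto_derive; [exact I|].
      unfold Rdiv. rewrite Rmult_0_l, cos_0. field.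
    - assert (sin (u / 2) <> 0).
      { destruct (Rdichotomy u 0 Hn) as [Hl|Hl].
        - apply Rlt_not_eq. apply sin_lt_0_var; lra.
        - apply Rgt_not_eq. apply sin_gt_0; lra. }
      intros E. apply H. apply Rmult_eq_reg_r with (/ u).
      + rewrite Rmult_0_l. exact E.
      + now apply Rinv_neq_0_compat. }
  set (g := fun u => slope F u / slope (fun u => sin (u / 2)) u).
  assert (Hg : forall z, - PI <= z <= PI -> continuous g z).
  { intros z Hz. apply continuity_pt_filterlim. apply continuity_pt_div.
    - now apply slope_continuous.
    - now apply slope_continuous.
    - now apply SN. }
  assert (gF : forall u, - PI <= u <= PI -> F u = g u * sin (u / 2)).
  { intros u Hu. rewrite <- (slope_mult F u F0).
    rewrite <- (slope_mult (fun u => sin (u / 2)) u S0). unfold g. field. now apply SN. }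
  pose proof (bessel_coef_lim g Hg) as L.
  assert (Ca : forall z, continuous (fun u => a (t + u)) z).
  { intros z. apply continuous_ext with (fun u => a (u + t)); [intros; f_equal; ring|].
    apply smooth_periodic_continuous. now apply smooth_periodic_shift. }
  assert (Cc : forall k z, continuous (fun u => cos (INR k * u)) z).
  { intros k z. apply (ex_derive_continuous (fun u => cos (INR k * u))).
    auto_derive. exact I. }
  apply is_lim_seq_ext with (fun n => / 2 * bessel_coef g n + a t).
  - intros n. unfold bessel_coef.
    rewrite (integral_ext _ (fun u => sum_n (fun k =>
      dir_weight k * (a (t + u) * cos (INR k * u) + (- a t) * cos (INR k * u))) n)).
    + rewrite (integral_sum (fun k u =>
        dir_weight k * (a (t + u) * cos (INR k * u) + (- a t) * cos (INR k * u)))).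
      (* Subtracting the constant a(t) affects only k = 0, the other cosines having mean 0. *)
      * assert (forall k, integral (fun u => dir_weight k *
          (a (t + u) * cos (INR k * u) + (- a t) * cos (INR k * u))) (- PI) PI
          = 2 * PI * (dir_weight k * (/ (2 * PI) *
              integral (fun u => a (t + u) * cos (INR k * u)) (- PI) PI))
            + (if Nat.eqb k 0 then - (2 * PI * a t) else 0)) as Ek.
        { intros k. rewrite integral_scal, integral_plus, integral_scal.
          - destruct k as [|k].
            + simpl dir_weight. simpl Nat.eqb. cbv iota.
              rewrite (integral_ext (fun u => cos (INR 0 * u)) (fun _ => 1))
                by (intros; simpl; rewrite Rmult_0_l; apply cos_0).
              rewrite integral_const. field. lra.
            + rewrite INR_IZR_INZ, (integral_cos_int (Z.of_nat (S k))) by lia. simpl. field. lra.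
          - auto.
          - intros; now apply continuous_mult_r.
          - intros; now apply continuous_scal_const.
          - intros; apply continuous_plus_r;
              [now apply continuous_mult_r|now apply continuous_scal_const]. }
        rewrite (sum_n_ext_r _ _ n Ek), sum_n_plus_r, sum_n_scal_r.
        assert (forall n, sum_n (fun k => if Nat.eqb k 0 then - (2 * PI * a t) else 0) n
          = - (2 * PI * a t)) as ->.
        { clear. induction n as [|n IH]; [now rewrite sum_O|].
          rewrite sum_n_Sr, IH. simpl. ring. }
        field. lra.
      * intros k z. apply continuous_scal_const, continuous_plus_r;
          [now apply continuous_mult_r|now apply continuous_scal_const].
    + intros u Hu. rewrite Rmin_left, Rmax_right in Hu by lra.
      rewrite <- dirichlet_kernel, <- Rmult_assoc, <- gF by lra.
      rewrite <- sum_n_scal_r. apply sum_n_ext_r. intros k. unfold F. ring.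
  - replace (a t) with (/ 2 * 0 + a t) at 1 by ring.
    apply is_lim_seq_plus'; [|apply is_lim_seq_const].
    apply (is_lim_seq_scal_l _ (/ 2) 0 L).
Qed.

(** * Fourier coefficients *)

(** Not normalized: the Fourier coefficient of order l is ([cos_coef] - i [sin_coef]) / (2 pi). *)
Definition cos_coef (a : R -> R) (l : Z) : R :=
  integral (fun x => a x * cos (IZR l * x)) 0 (2 * PI).
Definition sin_coef (a : R -> R) (l : Z) : R :=
  integral (fun x => a x * sin (IZR l * x)) 0 (2 * PI).

Lemma continuous_cos_lin (l x : R) : continuous (fun u => cos (l * u)) x.
Proof. apply (ex_derive_continuous (fun u => cos (l * u))). auto_derive. exact I. Qed.

Lemma continuous_sin_lin (l x : R) : continuous (fun u => sin (l * u)) x.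
Proof. apply (ex_derive_continuous (fun u => sin (l * u))). auto_derive. exact I. Qed.

Lemma Cdiv_RtoC (x y r : R) : r <> 0 -> ((x, y) / RtoC r)%C = (x / r, y / r).
Proof.
  intros Hr. unfold Cdiv, Cinv, Cmult, RtoC. simpl. apply f_equal2; field; exact Hr.
Qed.

Lemma fourier_coef_real (a : R -> R) (l : Z) : (forall x, continuous a x) ->
  fourier_coef (fun x => RtoC (a x)) l
  = (cos_coef a l / (2 * PI), - sin_coef a l / (2 * PI)).
Proof.
  intros Ha. pose proof PI_RGT_0. unfold fourier_coef.
  rewrite <- Cdiv_RtoC by lra. f_equal.
  apply (is_RInt_unique (V := C_R_CompleteNormedModule)).
  apply (is_RInt_fct_extend_pair (U := R_NormedModule) (V := R_NormedModule)).
  - apply is_RInt_ext with (fun x => a x * cos (IZR l * x)).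
    { intros x _. unfold Cmult, RtoC, expi. simpl. rewrite cos_neg. req. ring. }
    apply (RInt_correct (V := R_CompleteNormedModule)). apply ex_RInt_cont. intros z _.
    apply continuous_mult_r; [apply Ha|apply continuous_cos_lin].
  - replace (- sin_coef a l)
      with (integral (fun x => (-1) * (a x * sin (IZR l * x))) 0 (2 * PI)).
    + apply is_RInt_ext with (fun x => (-1) * (a x * sin (IZR l * x))).
      { intros x _. unfold Cmult, RtoC, expi. simpl. rewrite sin_neg. req. ring. }
      apply (RInt_correct (V := R_CompleteNormedModule)). apply ex_RInt_cont. intros z _.
      apply continuous_scal_const, continuous_mult_r; [apply Ha|apply continuous_sin_lin].
    + rewrite integral_scal; [unfold sin_coef; ring|]. intros z _.
      apply continuous_mult_r; [apply Ha|apply continuous_sin_lin].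
Qed.

Lemma symmetric_sum (u : Z -> R) (n : nat) :
  sum_n (fun j => u (Z.of_nat j - Z.of_nat n)%Z) (2 * n)
  = sum_n (fun k => dir_weight k * ((u (Z.of_nat k) + u (- Z.of_nat k)%Z) / 2)) n.
Proof.
  induction n as [|n IH].
  - simpl. rewrite !sum_O. simpl. req. field.
  - rewrite sum_n_Sr, <- IH. replace (2 * S n)%nat with (S (S (2 * n))) by lia.
    rewrite sum_n_Sr.
    (* Passing to n + 1 moves the origin of the index by one and adds a term at each end. *)
    pose proof (sum_n_shift_r (fun j => u (Z.of_nat j - Z.of_nat (S n))%Z) (2 * n)) as E.
    rewrite <- sum_n_Sr in E.
    rewrite (sum_n_ext_r _ (fun j => u (Z.of_nat j - Z.of_nat n)%Z)) in E
      by (intros; f_equal; lia).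
    replace (Z.of_nat 0 - Z.of_nat (S n))%Z with (- Z.of_nat (S n))%Z in E by lia.
    replace (Z.of_nat (S (S (2 * n))) - Z.of_nat (S n))%Z with (Z.of_nat (S n)) by lia.
    simpl dir_weight.
    set (X := sum_n (fun j => u (Z.of_nat j - Z.of_nat (S n))%Z) (S (2 * n))) in *.
    set (Y := sum_n (fun j => u (Z.of_nat j - Z.of_nat n)%Z) (2 * n)) in *.
    clearbody X Y. req. change (Y = X - u (- Z.of_nat (S n))%Z) in E. lra.
Qed.

Lemma Re_sum_n (f : nat -> C) (n : nat) : Re (sum_n f n) = sum_n (fun j => Re (f j)) n.
Proof.
  induction n as [|n IH]; [now rewrite !sum_O|]. rewrite sum_Sn, sum_n_Sr, <- IH. reflexivity.
Qed.

Lemma Im_sum_n (f : nat -> C) (n : nat) : Im (sum_n f n) = sum_n (fun j => Im (f j)) n.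
Proof.
  induction n as [|n IH]; [now rewrite !sum_O|]. rewrite sum_Sn, sum_n_Sr, <- IH. reflexivity.
Qed.

Lemma cos_coef_opp (a : R -> R) (l : Z) : cos_coef a (- l) = cos_coef a l.
Proof.
  apply integral_ext. intros x _. rewrite opp_IZR, Ropp_mult_distr_l_reverse, cos_neg.
  reflexivity.
Qed.

Lemma sin_coef_opp (a : R -> R) (l : Z) : (forall x, continuous a x) ->
  sin_coef a (- l) = - sin_coef a l.
Proof.
  intros Ha. transitivity ((-1) * sin_coef a l); [|ring]. unfold sin_coef.
  rewrite <- integral_scal.
  - apply integral_ext. intros x _. rewrite opp_IZR, Ropp_mult_distr_l_reverse, sin_neg. ring.
  - intros z _. apply continuous_mult_r; [apply Ha|apply continuous_sin_lin].
Qed.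

(** The translation moves from a to the trigonometric factor, where it becomes the phase -l c. *)
Lemma coef_shift (a : R -> R) (c : R) (l : Z) : smooth_periodic a ->
  integral (fun u => a (c + u) * cos (IZR l * u)) 0 (2 * PI)
  = cos (IZR l * c) * cos_coef a l + sin (IZR l * c) * sin_coef a l /\
  integral (fun u => a (c + u) * sin (IZR l * u)) 0 (2 * PI)
  = cos (IZR l * c) * sin_coef a l - sin (IZR l * c) * cos_coef a l.
Proof.
  intros Ha. assert (Ca : forall x, continuous a x)
    by (intros; now apply smooth_periodic_continuous).
  assert (C1 : forall z, continuous (fun x => a x * cos (IZR l * x)) z)
    by (intros; apply continuous_mult_r; [apply Ca|apply continuous_cos_lin]).
  assert (C2 : forall z, continuous (fun x => a x * sin (IZR l * x)) z)
    by (intros; apply continuous_mult_r; [apply Ca|apply continuous_sin_lin]).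
  split.
  - pose proof (integral_period_shift (fun x => a x * cos (IZR l * x + - (IZR l * c))) c 0)
      as E.
    rewrite Rplus_0_l in E. cbv beta in E.
    rewrite (integral_ext (fun u => a (c + u) * cos (IZR l * u))
      (fun u => a (c + u) * cos (IZR l * (c + u) + - (IZR l * c)))).
    + rewrite <- E.
      * unfold cos_coef, sin_coef. rewrite <- !integral_scal by auto.
        rewrite <- integral_plus by (intros; apply continuous_scal_const; auto).
        apply integral_ext. intros x _. rewrite cos_plus, cos_neg, sin_neg. ring.
      * apply smooth_periodic_mult; [exact Ha|apply smooth_periodic_cos].
    + intros x _. f_equal. f_equal. ring.
  - pose proof (integral_period_shift (fun x => a x * sin (IZR l * x + - (IZR l * c))) c 0)
      as E.
    rewrite Rplus_0_l in E. cbv beta in E.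
    rewrite (integral_ext (fun u => a (c + u) * sin (IZR l * u))
      (fun u => a (c + u) * sin (IZR l * (c + u) + - (IZR l * c)))).
    + rewrite <- E.
      * transitivity (cos (IZR l * c) * sin_coef a l + (- sin (IZR l * c)) * cos_coef a l);
          [|ring].
        unfold cos_coef, sin_coef. rewrite <- !integral_scal by auto.
        rewrite <- integral_plus by (intros; apply continuous_scal_const; auto).
        apply integral_ext. intros x _. rewrite sin_plus, cos_neg, sin_neg. ring.
      * apply smooth_periodic_mult; [exact Ha|apply smooth_periodic_sin].
    + intros x _. f_equal. f_equal. ring.
Qed.

Lemma cos_sin_coef_shift (a : R -> R) (c : R) (l : Z) : smooth_periodic a ->
  cos_coef (fun x => a (x + c)) l
  = cos (IZR l * c) * cos_coef a l + sin (IZR l * c) * sin_coef a l /\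
  sin_coef (fun x => a (x + c)) l
  = cos (IZR l * c) * sin_coef a l - sin (IZR l * c) * cos_coef a l.
Proof.
  intros Ha. destruct (coef_shift a c l Ha) as [<- <-].
  split; apply integral_ext; intros x _; now rewrite Rplus_comm.
Qed.

Lemma cos_sin_coef_lin (r s : R) (a b : R -> R) (l : Z) :
  (forall x, continuous a x) -> (forall x, continuous b x) ->
  cos_coef (fun x => r * a x + s * b x) l = r * cos_coef a l + s * cos_coef b l /\
  sin_coef (fun x => r * a x + s * b x) l = r * sin_coef a l + s * sin_coef b l.
Proof.
  intros Ca Cb. unfold cos_coef, sin_coef.
  split; rewrite <- !integral_scal by
    (intros; apply continuous_mult_r; auto using continuous_cos_lin, continuous_sin_lin);
    rewrite <- integral_plus by (intros; apply continuous_scal_const, continuous_mult_r;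
      auto using continuous_cos_lin, continuous_sin_lin);
    apply integral_ext; intros x _; ring.
Qed.

(** Integration by parts, with boundary terms that cancel by periodicity. *)
Lemma cos_sin_coef_Derive (a : R -> R) (l : Z) : smooth_periodic a ->
  cos_coef (Derive a) l = IZR l * sin_coef a l /\
  sin_coef (Derive a) l = - IZR l * cos_coef a l.
Proof.
  intros Ha. pose proof (smooth_periodic_Derive a Ha) as Hd.
  assert (Ca : forall x, continuous a x) by (intros; now apply smooth_periodic_continuous).
  assert (Cd : forall x, continuous (Derive a) x)
    by (intros; now apply smooth_periodic_continuous).
  assert (Da : forall x, is_derive a x (Derive a x))
    by (intros; apply Derive_correct; now apply smooth_periodic_ex_derive).
  assert (Dcos : forall x, is_derive (fun x => cos (IZR l * x)) x (- IZR l * sin (IZR l * x)))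
    by (intros; auto_derive; [exact I|ring]).
  assert (Dsin : forall x, is_derive (fun x => sin (IZR l * x)) x (IZR l * cos (IZR l * x)))
    by (intros; auto_derive; [exact I|ring]).
  assert (P : a (2 * PI) = a 0) by (rewrite <- (proj1 Ha 0); f_equal; ring).
  assert (E1 : cos (IZR l * (2 * PI)) = cos (IZR l * 0)).
  { rewrite <- (cos_int_2PI l (IZR l * 0)). f_equal. ring. }
  assert (E2 : sin (IZR l * (2 * PI)) = sin (IZR l * 0)).
  { rewrite <- (sin_int_2PI l (IZR l * 0)). f_equal. ring. }
  assert (C1 : forall f z, (forall x, continuous f x) ->
    continuous (fun x => f x * cos (IZR l * x)) z)
    by (intros; apply continuous_mult_r; [auto|apply continuous_cos_lin]).
  assert (C2 : forall f z, (forall x, continuous f x) ->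
    continuous (fun x => f x * sin (IZR l * x)) z)
    by (intros; apply continuous_mult_r; [auto|apply continuous_sin_lin]).
  split.
  - assert (integral (fun x => Derive a x * cos (IZR l * x)
      + (- IZR l) * (a x * sin (IZR l * x))) 0 (2 * PI) = 0) as E.
    { rewrite (integral_primitive _ (fun x => a x * cos (IZR l * x))).
      - rewrite P, E1. ring.
      - intros x. replace (Derive a x * _ + _)
          with (Derive a x * cos (IZR l * x) + a x * (- IZR l * sin (IZR l * x))) by ring.
        apply (is_derive_mult a (fun x => cos (IZR l * x))); auto. exact Rmult_comm.
      - intros x. apply continuous_plus_r; [|apply continuous_scal_const]; auto. }
    rewrite integral_plus, integral_scal in E by
      (intros; try apply continuous_scal_const; auto).
    unfold cos_coef, sin_coef. lra.
  - assert (integral (fun x => Derive a x * sin (IZR l * x)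
      + IZR l * (a x * cos (IZR l * x))) 0 (2 * PI) = 0) as E.
    { rewrite (integral_primitive _ (fun x => a x * sin (IZR l * x))).
      - rewrite P, E2. ring.
      - intros x. replace (Derive a x * _ + _)
          with (Derive a x * sin (IZR l * x) + a x * (IZR l * cos (IZR l * x))) by ring.
        apply (is_derive_mult a (fun x => sin (IZR l * x))); auto. exact Rmult_comm.
      - intros x. apply continuous_plus_r; [|apply continuous_scal_const]; auto. }
    rewrite integral_plus, integral_scal in E by
      (intros; try apply continuous_scal_const; auto).
    unfold cos_coef, sin_coef. lra.
Qed.

(** Reduces the identification of a formal sum to its coefficients: since b is smooth, the symmetric
    partial sums converge to it at every point. *)
Lemma fourier_sum_eq (A : Z -> Prop) (c : Z -> C) (b : R -> R) (t : R) :
  smooth_periodic b ->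
  (forall l, (if excluded_middle_informative (A l) then c l else RtoC 0)
             = fourier_coef (fun x => RtoC (b x)) l) ->
  fourier_sum A c t = RtoC (b t).
Proof.
  intros Hb Hc. pose proof PI_RGT_0 as HP.
  assert (Cb : forall x, continuous b x) by (intros; now apply smooth_periodic_continuous).
  set (ur := fun l => (cos_coef b l * cos (IZR l * t) + sin_coef b l * sin (IZR l * t))
                      / (2 * PI)).
  set (ui := fun l => (cos_coef b l * sin (IZR l * t) - sin_coef b l * cos (IZR l * t))
                      / (2 * PI)).
  assert (T : forall l, (if excluded_middle_informative (A l)
      then (c l * expi (IZR l * t))%C else RtoC 0) = (ur l, ui l)).
  { intros l. specialize (Hc l). rewrite (fourier_coef_real b l Cb) in Hc.
    transitivity (((cos_coef b l / (2 * PI))%R, (- sin_coef b l / (2 * PI))%R)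
      * expi (IZR l * t))%C.
    - rewrite <- Hc. destruct (excluded_middle_informative (A l)); [reflexivity|].
      now rewrite Cmult_0_l.
    - unfold ur, ui, expi, Cmult. simpl. apply f_equal2; field; lra. }
  unfold fourier_sum, Clim_seq. unfold RtoC. apply f_equal2.
  - rewrite (is_lim_seq_unique _ (b t)); [reflexivity|].
    apply is_lim_seq_ext with (fun n => sum_n (fun k => dir_weight k *
      (/ (2 * PI) * integral (fun u => b (t + u) * cos (INR k * u)) (- PI) PI)) n);
      [|now apply dirichlet_limit].
    intros n. symmetry. rewrite Re_sum_n.
    rewrite (sum_n_ext_r _ (fun j => ur (Z.of_nat j - Z.of_nat n)%Z))
      by (intros j; exact (f_equal Re (T (Z.of_nat j - Z.of_nat n)%Z))).
    rewrite symmetric_sum. apply sum_n_ext_r. intros k. f_equal.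
    unfold ur. rewrite opp_IZR, cos_coef_opp, (sin_coef_opp b _ Cb).
    rewrite Ropp_mult_distr_l_reverse, cos_neg, sin_neg.
    rewrite INR_IZR_INZ.
    destruct (coef_shift b t (Z.of_nat k) Hb) as [E _].
    pose proof (integral_period_shift (fun u => b (t + u) * cos (IZR (Z.of_nat k) * u))
      0 (- PI)) as Es.
    replace (- PI + 2 * PI) with PI in Es by ring.
    rewrite (integral_ext (fun u => b (t + (0 + u)) * cos (IZR (Z.of_nat k) * (0 + u)))
      (fun u => b (t + u) * cos (IZR (Z.of_nat k) * u)) (- PI) PI) in Es
      by (intros; now rewrite Rplus_0_l).
    rewrite <- Es, E; [field; lra|].
    apply smooth_periodic_mult.
    + pose proof (smooth_periodic_shift t b Hb) as Hs.
      destruct Hs as [P S]. split.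
      * intros x. rewrite <- (proj1 Hb (t + x)). f_equal. ring.
      * intros m x. apply ex_derive_n_ext with (fun x => b (x + t)); [|apply S].
        intros y. f_equal. ring.
    + pose proof (smooth_periodic_cos (Z.of_nat k) 0) as Hs.
      destruct Hs as [P S]. split.
      * intros x. specialize (P x). cbv beta in P. now rewrite !Rplus_0_r in P.
      * intros m x. apply ex_derive_n_ext with (fun x => cos (IZR (Z.of_nat k) * x + 0));
          [|apply S]. intros y. now rewrite Rplus_0_r.
  (* For real b the terms of orders k and -k are conjugate, so every symmetric partial sum is
     real. *)
  - rewrite (is_lim_seq_unique _ 0); [reflexivity|].
    apply is_lim_seq_ext with (fun _ => 0); [|apply is_lim_seq_const].
    intros n. symmetry. rewrite Im_sum_n.
    rewrite (sum_n_ext_r _ (fun j => ui (Z.of_nat j - Z.of_nat n)%Z))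
      by (intros j; exact (f_equal Im (T (Z.of_nat j - Z.of_nat n)%Z))).
    rewrite symmetric_sum. rewrite (sum_n_ext_r _ (fun _ => 0)).
    + rewrite sum_n_const_r. ring.
    + intros k. unfold ui. rewrite opp_IZR, cos_coef_opp, (sin_coef_opp b _ Cb).
      rewrite Ropp_mult_distr_l_reverse, cos_neg, sin_neg. field. lra.
Qed.

(** * Harmonics in q Z *)

Lemma Z_gcd_of_nat_1 (p q : nat) : (0 < q)%nat -> Nat.gcd p q = 1%nat ->
  Z.gcd (Z.of_nat q) (Z.of_nat p) = 1%Z.
Proof.
  intros Hq Hg. set (g := Z.gcd (Z.of_nat q) (Z.of_nat p)).
  assert (0 < g)%Z as Hpos.
  { pose proof (Z.gcd_nonneg (Z.of_nat q) (Z.of_nat p)).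
    assert (g <> 0)%Z; [|unfold g in *; lia].
    intros E. apply Z.gcd_eq_0_l in E. lia. }
  assert (D : forall n, (g | Z.of_nat n)%Z -> Nat.divide (Z.to_nat g) n).
  { intros n [k Hk]. exists (Z.to_nat k). apply Nat2Z.inj.
    rewrite Nat2Z.inj_mul, !Z2Nat.id by nia. exact Hk. }
  assert (Nat.divide (Z.to_nat g) 1) as D1.
  { rewrite <- Hg. apply Nat.gcd_greatest; apply D; [apply Z.gcd_divide_r|apply Z.gcd_divide_l]. }
  apply Nat.divide_1_r in D1. lia.
Qed.

(** The angle is PI l p / q, and by coprimality q divides l p only if it divides l. *)
Lemma sin_half_omega_zero (p q : nat) (l : Z) : (0 < q)%nat -> Nat.gcd p q = 1%nat ->
  sin (IZR l * (omega p q / 2)) = 0 <-> (Z.of_nat q | l)%Z.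
Proof.
  intros Hq Hg. pose proof PI_RGT_0 as HP.
  assert (0 < INR q) as Hq' by (apply lt_0_INR; lia).
  split.
  - intros H. apply sin_eq_0_0 in H. destruct H as [k Hk].
    assert (IZR (l * Z.of_nat p) = IZR (k * Z.of_nat q)) as E.
    { rewrite !mult_IZR, <- !INR_IZR_INZ.
      apply Rmult_eq_reg_r with (PI / INR q).
      - transitivity (IZR l * (omega p q / 2)); [unfold omega; field; lra|].
        rewrite Hk. field. lra.
      - apply Rgt_not_eq, Rdiv_lt_0_compat; lra. }
    apply eq_IZR in E. apply (Z.gauss _ (Z.of_nat p)).
    + exists k. lia.
    + now apply Z_gcd_of_nat_1.
  - intros [k ->]. apply sin_eq_0_1. exists (k * Z.of_nat p)%Z.
    rewrite !mult_IZR, <- !INR_IZR_INZ. unfold omega. field. lra.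
Qed.

Lemma cos_sin_omega (p q : nat) (l : Z) :
  let b := IZR l * (omega p q / 2) in
  cos (IZR l * omega p q) = cos b * cos b - sin b * sin b /\
  sin (IZR l * omega p q) = 2 * sin b * cos b.
Proof.
  intros b. replace (IZR l * omega p q) with (2 * b) by (unfold b; field).
  split; [apply cos_2a|apply sin_2a].
Qed.

(** For l in q Z, each shift by j omega multiplies the coefficient by the exponential of a multiple
    of 2 pi i, so averaging changes nothing. *)
Lemma cos_sin_coef_mu (p q : nat) (a : R -> R) (l : Z) : (0 < q)%nat ->
  smooth_periodic a -> (Z.of_nat q | l)%Z ->
  cos_coef (mu p q a) l = cos_coef a l /\ sin_coef (mu p q a) l = sin_coef a l.
Proof.
  intros Hq Ha [k ->]. assert (0 < INR q) as Hq' by (apply lt_0_INR; lia).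
  assert (Ca : forall c x, continuous (fun x => a (x + c)) x).
  { intros. apply (smooth_periodic_continuous (fun x => a (x + c))).
    now apply smooth_periodic_shift. }
  assert (E : forall j, cos_coef (fun x => a (x + INR j * omega p q)) (k * Z.of_nat q)
      = cos_coef a (k * Z.of_nat q) /\
    sin_coef (fun x => a (x + INR j * omega p q)) (k * Z.of_nat q)
      = sin_coef a (k * Z.of_nat q)).
  { intros j. destruct (cos_sin_coef_shift a (INR j * omega p q) (k * Z.of_nat q) Ha)
      as [-> ->].
    replace (IZR (k * Z.of_nat q) * (INR j * omega p q))
      with (0 + IZR (k * Z.of_nat p * Z.of_nat j) * (2 * PI))
      by (rewrite !mult_IZR, <- !INR_IZR_INZ; unfold omega; field; lra).
    rewrite cos_int_2PI, sin_int_2PI, cos_0, sin_0. split; ring. }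
  set (l := (k * Z.of_nat q)%Z) in *.
  assert (C1 : forall j z, continuous (fun x => a (x + INR j * omega p q) * cos (IZR l * x)) z)
    by (intros; apply continuous_mult_r; [apply Ca|apply continuous_cos_lin]).
  assert (C2 : forall j z, continuous (fun x => a (x + INR j * omega p q) * sin (IZR l * x)) z)
    by (intros; apply continuous_mult_r; [apply Ca|apply continuous_sin_lin]).
  assert (Cs : forall (f : nat -> R -> R) z, (forall j z, continuous (f j) z) ->
    continuous (fun x => sum_n (fun j => f j x) (pred q)) z).
  { intros f z Hf. induction (pred q) as [|n IH].
    - apply continuous_ext with (f 0%nat); [intros; now rewrite sum_O|apply Hf].
    - apply continuous_ext with (fun x => sum_n (fun j => f j x) n + f (S n) x);
        [intros; now rewrite sum_n_Sr|]. now apply continuous_plus_r. }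
  split.
  - unfold cos_coef at 1.
    rewrite (integral_ext _ (fun x => / INR q *
      sum_n (fun j => a (x + INR j * omega p q) * cos (IZR l * x)) (pred q))).
    + rewrite integral_scal by (intros; apply (Cs _ _ C1)).
      rewrite (integral_sum (fun j x => a (x + INR j * omega p q) * cos (IZR l * x))) by
        exact C1.
      rewrite (sum_n_ext_r _ (fun _ => cos_coef a l)) by exact (fun j => proj1 (E j)).
      rewrite sum_n_const_r. replace (S (pred q)) with q by lia. field. lra.
    + intros x _. unfold mu. rewrite Rmult_assoc. f_equal.
      rewrite Rmult_comm, <- sum_n_scal_r. apply sum_n_ext_r. intros; apply Rmult_comm.
  - unfold sin_coef at 1.
    rewrite (integral_ext _ (fun x => / INR q *
      sum_n (fun j => a (x + INR j * omega p q) * sin (IZR l * x)) (pred q))).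
    + rewrite integral_scal by (intros; apply (Cs _ _ C2)).
      rewrite (integral_sum (fun j x => a (x + INR j * omega p q) * sin (IZR l * x))) by
        exact C2.
      rewrite (sum_n_ext_r _ (fun _ => sin_coef a l)) by exact (fun j => proj2 (E j)).
      rewrite sum_n_const_r. replace (S (pred q)) with q by lia. field. lra.
    + intros x _. unfold mu. rewrite Rmult_assoc. f_equal.
      rewrite Rmult_comm, <- sum_n_scal_r. apply sum_n_ext_r. intros; apply Rmult_comm.
Qed.

Lemma cos_sin_coef_ext (a b : R -> R) (l : Z) : (forall x, a x = b x) ->
  cos_coef a l = cos_coef b l /\ sin_coef a l = sin_coef b l.
Proof.
  intros E. unfold cos_coef, sin_coef.
  split; apply integral_ext; intros x _; rewrite E; reflexivity.
Qed.

Lemma cos_sin_coef_const (c : R) (l : Z) :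
  cos_coef (fun _ => c) l = (if Z.eq_dec l 0 then 2 * PI * c else 0) /\
  sin_coef (fun _ => c) l = 0.
Proof.
  pose proof PI_RGT_0 as HP. destruct (Z.eq_dec l 0) as [->|Hl].
  - split.
    + unfold cos_coef. rewrite (integral_ext _ (fun _ => c)).
      * rewrite integral_const. ring.
      * intros x _. rewrite Rmult_0_l, cos_0. ring.
    + unfold sin_coef. rewrite (integral_ext _ (fun _ => 0)).
      * rewrite integral_const. ring.
      * intros x _. rewrite Rmult_0_l, sin_0. ring.
  - assert (IZR l <> 0) as Hl' by now apply eq_IZR_contrapositive.
    destruct (cos_sin_coef_Derive (fun _ => c) l (smooth_periodic_const c)) as [E1 E2].
    destruct (cos_sin_coef_ext (Derive (fun _ => c)) (fun _ => 0) l
      (fun x => Derive_const c x)) as [F1 F2].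
    assert (Z1 : cos_coef (fun _ => 0) l = 0 /\ sin_coef (fun _ => 0) l = 0).
    { split; [unfold cos_coef|unfold sin_coef]; rewrite (integral_ext _ (fun _ => 0));
        try (rewrite integral_const; ring); intros; ring. }
    destruct Z1 as [Z1 Z2]. rewrite E1, Z1 in F1. rewrite E2, Z2 in F2.
    split; apply Rmult_eq_reg_l with (IZR l); lra.
Qed.

(** The pair of coefficients is fixed by a rotation of angle l omega. Rotation minus identity is 2
    sin(l omega/2) times an orthogonal matrix, invertible when q does not divide l. *)
Lemma cos_sin_coef_invariant (p q : nat) (b : R -> R) (l : Z) : (0 < q)%nat ->
  Nat.gcd p q = 1%nat -> smooth_periodic b -> (forall t, delta p q b t = 0) ->
  ~ (Z.of_nat q | l)%Z -> cos_coef b l = 0 /\ sin_coef b l = 0.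
Proof.
  intros Hq Hg Hb Hd Hl. rewrite <- (sin_half_omega_zero p q l Hq Hg) in Hl.
  destruct (cos_sin_coef_shift b (omega p q) l Hb) as [E1 E2].
  destruct (cos_sin_coef_ext (fun x => b (x + omega p q)) b l) as [F1 F2].
  { intros x. specialize (Hd x). unfold delta, tau in Hd. lra. }
  rewrite F1 in E1. rewrite F2 in E2.
  destruct (cos_sin_omega p q l) as [Ec Es]. rewrite Ec, Es in E1, E2.
  set (sb := sin (IZR l * (omega p q / 2))) in *.
  set (cb := cos (IZR l * (omega p q / 2))) in *.
  assert (sb * sb + cb * cb = 1) as T by apply sin2_cos2.
  set (x := cos_coef b l) in *. set (y := sin_coef b l) in *.
  assert (G1 : 2 * sb * (cb * y - sb * x) = 0).
  { replace x with ((sb * sb + cb * cb) * x) in E1 at 1 by (rewrite T; ring). lra. }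
  assert (G2 : 2 * sb * (- (sb * y) - cb * x) = 0).
  { replace y with ((sb * sb + cb * cb) * y) in E2 at 1 by (rewrite T; ring). lra. }
  apply Rmult_integral in G1. destruct G1 as [G1|G1]; [exfalso; apply Hl; lra|].
  apply Rmult_integral in G2. destruct G2 as [G2|G2]; [exfalso; apply Hl; lra|].
  split.
  - replace x with ((sb * sb + cb * cb) * x) by (rewrite T; ring).
    replace ((sb * sb + cb * cb) * x)
      with (- sb * (cb * y - sb * x) - cb * (- (sb * y) - cb * x)) by ring.
    rewrite G1, G2. ring.
  - replace y with ((sb * sb + cb * cb) * y) by (rewrite T; ring).
    replace ((sb * sb + cb * cb) * y)
      with (cb * (cb * y - sb * x) - sb * (- (sb * y) - cb * x)) by ring.
    rewrite G1, G2. ring.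
Qed.

Lemma mu_harm_qZstar (p q : nat) (a : R -> R) (t : R) : (0 < q)%nat ->
  Nat.gcd p q = 1%nat -> smooth_periodic a ->
  mu_harm (qZstar q) (fun x => RtoC (a x)) t
  = RtoC (mu p q a t - cos_coef a 0 / (2 * PI)).
Proof.
  intros Hq Hg Ha. pose proof PI_RGT_0 as HP. unfold mu_harm.
  set (M := cos_coef a 0 / (2 * PI)).
  pose proof (mu_smooth_periodic p q a Ha) as Hm.
  assert (Ca : forall x, continuous a x) by (intros; now apply smooth_periodic_continuous).
  assert (Cm : forall x, continuous (mu p q a) x)
    by (intros; now apply smooth_periodic_continuous).
  apply (fourier_sum_eq _ _ (fun t => mu p q a t - M)).
  { apply smooth_periodic_minus; [exact Hm|apply smooth_periodic_const]. }
  intros l. rewrite (fourier_coef_real (fun t => mu p q a t - M) l).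
  2: { intros x. apply (smooth_periodic_continuous (fun t => mu p q a t - M)).
       apply smooth_periodic_minus; [exact Hm|apply smooth_periodic_const]. }
  destruct (cos_sin_coef_ext (fun x => mu p q a x - M)
    (fun x => 1 * mu p q a x + (-1) * M) l) as [-> ->]; [intros; ring|].
  destruct (cos_sin_coef_lin 1 (-1) (mu p q a) (fun _ => M) l Cm) as [-> ->].
  { intros x. apply continuous_const. }
  destruct (cos_sin_coef_const M l) as [-> ->].
  destruct (excluded_middle_informative (qZstar q l)) as [[Hd Hl]|Hn].
  - rewrite fourier_coef_real by exact Ca.
    destruct (cos_sin_coef_mu p q a l Hq Ha Hd) as [-> ->].
    destruct (Z.eq_dec l 0) as [E|_]; [now elim Hl|]. apply f_equal2; field; lra.
  (* Outside q Z^star: at l = 0 the constant M removes the mean, and elsewhere the coefficients of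
     the invariant function mu a vanish. *)
  - unfold RtoC. destruct (Z.eq_dec l 0) as [->|Hl].
    + destruct (cos_sin_coef_mu p q a 0 Hq Ha) as [-> ->]; [apply Z.divide_0_r|].
      assert (sin_coef a 0 = 0) as ->.
      { unfold sin_coef. rewrite (integral_ext _ (fun _ => 0)).
        - rewrite integral_const. ring.
        - intros x _. rewrite Rmult_0_l, sin_0. ring. }
      unfold M. apply f_equal2; field; lra.
    + destruct (cos_sin_coef_invariant p q (mu p q a) l Hq Hg Hm) as [-> ->].
      * intros s. unfold delta, tau. rewrite mu_shift; [ring|exact Hq|apply Ha].
      * intros Hd. apply Hn. now split.
      * apply f_equal2; field; lra.
Qed.

(** Dropping l = 0 amounts to working modulo constants, that is, to differentiating. *)
Lemma mu_harm_zero_iff (p q : nat) (a : R -> R) : (0 < q)%nat ->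
  Nat.gcd p q = 1%nat -> smooth_periodic a ->
  (forall t, mu_harm (qZstar q) (fun x => RtoC (a x)) t = RtoC 0) <->
  (forall t, mu p q (Derive a) t = 0).
Proof.
  intros Hq Hg Ha. pose proof PI_RGT_0 as HP.
  set (M := cos_coef a 0 / (2 * PI)).
  assert (D : forall t, is_derive (mu p q a) t (mu p q (Derive a) t))
    by (intros; apply mu_is_derive; intros; now apply smooth_periodic_ex_derive).
  split; intros H t.
  - assert (E : forall s, mu p q a s = M).
    { intros s. specialize (H s). rewrite (mu_harm_qZstar p q) in H by assumption.
      unfold RtoC in H. injection H as H. fold M in H. lra. }
    rewrite <- (is_derive_unique _ _ _ (D t)).
    rewrite (Derive_ext _ (fun _ => M) t E). apply Derive_const.
  - rewrite (mu_harm_qZstar p q) by assumption. fold M. f_equal.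
    assert (E : forall s, mu p q a s = mu p q a t).
    { intros s. apply zero_derive_constant. intros x. rewrite <- (H x). apply D. }
    destruct (cos_sin_coef_mu p q a 0 Hq Ha) as [E0 _]; [apply Z.divide_0_r|].
    destruct (cos_sin_coef_ext (mu p q a) (fun _ => mu p q a t) 0 E) as [E1 _].
    destruct (cos_sin_coef_const (mu p q a t) 0) as [E2 _].
    destruct (Z.eq_dec 0 0) as [_|Hn]; [|now elim Hn].
    unfold M. rewrite <- E0, E1, E2. field. lra.
Qed.

(** On the coefficient of order l, delta acts as 2 i sin b e^{ib}, sigma as 2 cos b e^{ib} and the
    derivative as i l. The common factor 2 i e^{ib} cancels; in real form this elimination uses
    sin^2 + cos^2 = 1. *)
Lemma theta1_coef (p q : nat) (h1 th : R -> R) (l : Z) (s c : R) :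
  smooth_periodic h1 -> smooth_periodic th ->
  (forall t, s * delta p q th t = c * delta p q h1 t - s * sigma p q (Derive h1) t) ->
  let b := IZR l * (omega p q / 2) in sin b <> 0 ->
  s * sin b * cos_coef th l = (c * sin b - s * IZR l * cos b) * cos_coef h1 l /\
  s * sin b * sin_coef th l = (c * sin b - s * IZR l * cos b) * sin_coef h1 l.
Proof.
  intros Hh Ht E b Hb.
  pose proof (smooth_periodic_Derive h1 Hh) as Hd.
  set (o := omega p q) in *.
  assert (Cn : forall a x, smooth_periodic a -> continuous a x)
    by (intros; now apply smooth_periodic_continuous).
  assert (Cs : forall a x, smooth_periodic a -> continuous (fun x => a (x + o)) x)
    by (intros a x Ha; now apply (Cn (fun x => a (x + o))), smooth_periodic_shift).
  destruct (cos_sin_coef_ext (fun x => s * th (x + o) + (-s) * th x)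
    (fun x => 1 * (c * h1 (x + o) + (- c) * h1 x)
              + (- s) * (1 * Derive h1 (x + o) + 1 * Derive h1 x)) l) as [E1 E2].
  { intros x. specialize (E x). unfold delta, sigma, tau in E. fold o in E. lra. }
  destruct (cos_sin_coef_lin s (-s) (fun x => th (x + o)) th l) as [F1 F2]; auto.
  destruct (cos_sin_coef_lin 1 (- s) (fun x => c * h1 (x + o) + (- c) * h1 x)
    (fun x => 1 * Derive h1 (x + o) + 1 * Derive h1 x) l) as [F3 F4].
  { intros x. apply continuous_plus_r; apply continuous_scal_const; auto. }
  { intros x. apply continuous_plus_r; apply continuous_scal_const; auto. }
  destruct (cos_sin_coef_lin c (- c) (fun x => h1 (x + o)) h1 l) as [F5 F6]; auto.
  destruct (cos_sin_coef_lin 1 1 (fun x => Derive h1 (x + o)) (Derive h1) l) as [F7 F8]; auto.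
  rewrite F1, F3, F5, F7 in E1. rewrite F2, F4, F6, F8 in E2.
  destruct (cos_sin_coef_shift th o l Ht) as [G1 G2].
  destruct (cos_sin_coef_shift h1 o l Hh) as [G3 G4].
  destruct (cos_sin_coef_shift (Derive h1) o l Hd) as [G5 G6].
  destruct (cos_sin_coef_Derive h1 l Hh) as [G7 G8].
  rewrite G1, G3, G5, G7, G8 in E1. rewrite G2, G4, G6, G7, G8 in E2.
  destruct (cos_sin_omega p q l) as [Ec Es]. fold o in Ec, Es. fold b in Ec, Es.
  rewrite Ec, Es in E1, E2.
  assert (T : sin b * sin b = 1 - cos b * cos b)
    by (pose proof (sin2_cos2 b); unfold Rsqr in *; lra).
  clear - E1 E2 T Hb. revert E1 E2 T Hb.
  generalize (sin b) as x, (cos b) as y, (cos_coef th l) as ct, (sin_coef th l) as st,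
    (cos_coef h1 l) as ch, (sin_coef h1 l) as sh, (IZR l) as k.
  intros x y ct st ch sh k E1 E2 T _.
  split; nsatz.
Qed.

(** * The factors nu and the functions zeta *)

(** Written with sines and cosines, nu_l is cot al - l cot b. This form includes the half-integer
    case, where cos b = 0; the infinite value is excluded because q does not divide l. *)
Lemma nu_spec (p q : nat) (l : Z) : (0 < p)%nat -> (2 * p < q)%nat ->
  Nat.gcd p q = 1%nat -> ~ (Z.of_nat q | l)%Z ->
  let b := IZR l * (omega p q / 2) in
  let al := omega p q / 2 in
  sin al * sin b * real (nu l (INR p / INR q)) = cos al * sin b - sin al * IZR l * cos b.
Proof.
  intros Hp Hq Hg Hl b al. pose proof PI_RGT_0 as HP.
  assert (0 < q)%nat as Hq0 by lia.
  assert (0 < INR q) as Hq' by (apply lt_0_INR; lia).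
  pose proof (sin_half_omega_pos p q Hp Hq) as Hs. fold al in Hs.
  assert (Hb : sin b <> 0).
  { intros E. apply Hl. now apply (sin_half_omega_zero p q). }
  assert (Hc : 0 < cos al).
  { pose proof (half_omega_bounds p q Hp Hq). unfold al. apply cos_gt_0; lra. }
  assert (Eal : PI * (INR p / INR q) = al) by (unfold al, omega; field; lra).
  assert (Eb : IZR l * PI * (INR p / INR q) = b) by (unfold b, omega; field; lra).
  unfold nu. destruct (excluded_middle_informative _) as [[k Hk]|_].
  { exfalso. apply Hb. apply sin_eq_0_1. exists k. rewrite <- Hk, <- Eb. ring. }
  rewrite Eb, Eal. unfold tan.
  destruct (excluded_middle_informative _) as [[k Hk]|Hn]; unfold real.
  - assert (cos b = 0) as ->.
    { assert (sin (2 * b) = 0) as E.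
      { apply sin_eq_0_1. exists k. rewrite <- Hk, <- Eb. ring. }
      rewrite sin_2a in E. apply Rmult_integral in E. destruct E as [E|E]; [|exact E].
      exfalso. apply Hb. lra. }
    field. lra.
  - assert (cos b <> 0).
    { intros E. apply Hn. assert (sin (2 * b) = 0) as E2 by (rewrite sin_2a, E; ring).
      apply sin_eq_0_0 in E2. destruct E2 as [k Hk]. exists k.
      apply Rmult_eq_reg_r with PI; [|lra]. rewrite <- Hk, <- Eb. ring. }
    field. repeat split; lra || assumption.
Qed.

(** The omitted orders are those where theta_1 has no harmonic: for l in q Z because mu theta_1 = 0,
    and for l = 1 or -1 because c sin b - s l cos b = 0. *)
Lemma theta1_series_eq (p q : nat) (h1 th : R -> R) (t : R) :
  (0 < p)%nat -> (2 * p < q)%nat -> Nat.gcd p q = 1%nat ->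
  smooth_periodic h1 -> smooth_periodic th ->
  (forall t, sin (omega p q / 2) * delta p q th t
     = cos (omega p q / 2) * delta p q h1 t
       - sin (omega p q / 2) * sigma p q (Derive h1) t) ->
  (forall t, mu p q th t = 0) ->
  theta1_series p q h1 t = RtoC (th t).
Proof.
  intros Hp Hq Hg Hh Ht Heq Hmu. assert (0 < q)%nat as Hq0 by lia.
  pose proof PI_RGT_0 as HP.
  pose proof (sin_half_omega_pos p q Hp Hq) as Hs.
  set (al := omega p q / 2) in *.
  apply (fourier_sum_eq _ _ th); [exact Ht|]. intros l.
  rewrite !fourier_coef_real by (intros; now apply smooth_periodic_continuous).
  pose proof (theta1_coef p q h1 th l (sin al) (cos al) Hh Ht Heq) as TC. cbv zeta in TC.
  fold al in TC. set (b := IZR l * al) in *.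
  destruct (excluded_middle_informative _) as [[Hl _]|Hn].
  - assert (Hb : sin b <> 0).
    { intros E. apply Hl. now apply (sin_half_omega_zero p q). }
    destruct (TC Hb) as [E1 E2].
    pose proof (nu_spec p q l Hp Hq Hg Hl) as N. cbv zeta in N. fold al in N. fold b in N.
    rewrite <- N in E1, E2. set (v := real (nu l (INR p / INR q))) in *.
    assert (Hsb : sin al * sin b <> 0) by (apply Rmult_integral_contrapositive; lra).
    assert (cos_coef th l = v * cos_coef h1 l) as ->.
    { apply Rmult_eq_reg_l with (sin al * sin b); [|exact Hsb]. rewrite E1. ring. }
    assert (sin_coef th l = v * sin_coef h1 l) as ->.
    { apply Rmult_eq_reg_l with (sin al * sin b); [|exact Hsb]. rewrite E2. ring. }
    unfold Cmult, RtoC. simpl. apply f_equal2; field; lra.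
  - assert (cos_coef th l = 0 /\ sin_coef th l = 0) as [-> ->].
    { destruct (classic (Z.of_nat q | l)%Z) as [Hd|Hd].
      - destruct (cos_sin_coef_mu p q th l Hq0 Ht Hd) as [<- <-].
        destruct (cos_sin_coef_ext (mu p q th) (fun _ => 0) l Hmu) as [-> ->].
        destruct (cos_sin_coef_const 0 l) as [-> ->].
        destruct (Z.eq_dec l 0); split; ring.
      - assert (Hb : sin b <> 0).
        { intros E. apply Hd. now apply (sin_half_omega_zero p q). }
        destruct (TC Hb) as [E1 E2].
        assert (cos al * sin b - sin al * IZR l * cos b = 0) as Z0.
        { destruct (Z.eq_dec l 1) as [->|H1]; [unfold b; rewrite Rmult_1_l; ring|].
          destruct (Z.eq_dec l (-1)) as [->|H2].
          - unfold b. replace (-1 * al) with (- al) by ring. rewrite sin_neg, cos_neg. ring.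
          - exfalso. apply Hn. now repeat split. }
        rewrite Z0 in E1, E2.
        assert (Hsb : sin al * sin b <> 0) by (apply Rmult_integral_contrapositive; lra).
        split; apply Rmult_eq_reg_l with (sin al * sin b); auto; lra. }
    unfold RtoC. apply f_equal2; field; lra.
Qed.

(* zeta_m is chosen among the functions that the recurrences compute for some persisting
   deformation with the prescribed lower coefficients; by [zeta_transfer] the choice
   is then right for every such deformation. *)
Definition zeta_pred (p q m : nat) (H : nat -> R -> R) (z : R -> R) : Prop :=
  smooth_periodic z /\ exists e0 h,
    circle_deformation e0 h /\ persists p q e0 h (m - 1) /\
    (forall j t, (1 <= j < m)%nat -> taylor_coef h j t = H j t) /\
    zeta_by_recurrences p q h m z.

(** The value 0 serves coefficient sequences for which no zeta is available, so that smoothness and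
    periodicity hold for every H. *)
Definition zeta_choice (p q m : nat) (H : nat -> R -> R) : R -> R :=
  match excluded_middle_informative (exists z, zeta_pred p q m H z) with
  | left _ => epsilon (inhabits (fun _ => 0)) (zeta_pred p q m H)
  | right _ => fun _ => 0
  end.

(** The two predicates are equal by extensionality, and [epsilon] returns the same function for
    equal predicates. *)
Lemma zeta_choice_ext (p q m : nat) (H H' : nat -> R -> R) :
  (forall j, (1 <= j < m)%nat -> forall t, H j t = H' j t) ->
  zeta_choice p q m H = zeta_choice p q m H'.
Proof.
  intros E. assert (zeta_pred p q m H = zeta_pred p q m H') as EP.
  { apply functional_extensionality; intros z. apply propositional_extensionality.
    split; intros [Sz [e0 [h [H1 [H2 [H3 H4]]]]]]; (split; [exact Sz|]); exists e0, h;
      (split; [exact H1|]); (split; [exact H2|]); (split; [|exact H4]);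
      intros j t Hj; rewrite H3 by exact Hj; [|symmetry]; now apply E. }
  unfold zeta_choice. now rewrite EP.
Qed.

Lemma zeta_choice_smooth (p q m : nat) (H : nat -> R -> R) :
  smooth_periodic (zeta_choice p q m H).
Proof.
  unfold zeta_choice. destruct (excluded_middle_informative _) as [Hex|_].
  - apply (epsilon_spec (inhabits (fun _ : R => 0)) _ Hex).
  - apply smooth_periodic_const.
Qed.

(** The chosen function may come from another deformation h' with the same h_1, ..., h_m. Both are
    restricted to the narrower of their strips before the transfer. *)
Lemma zeta_choice_spec (p q m : nat) (e0 : R) (h : R -> R -> R) :
  (0 < p)%nat -> (2 * p < q)%nat -> circle_deformation e0 h -> persists p q e0 h m ->
  zeta_by_recurrences p q h (S m) (zeta_choice p q (S m) (taylor_coef h)).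
Proof.
  intros Hp Hq Hc HP. unfold zeta_choice.
  destruct (excluded_middle_informative _) as [Hex|Hn].
  - destruct (epsilon_spec (inhabits (fun _ : R => 0)) _ Hex)
      as [_ [e1 [h' [Hc' [_ [HE Hz]]]]]].
    pose proof (circle_deformation_on e0 h Hc) as D.
    pose proof (circle_deformation_on e1 h' Hc') as D'.
    apply (zeta_transfer p q (S m) (Rmin e0 e1) h' h); auto; [lia| |].
    + apply deformation_on_le with e1; [|exact D'].
      split; [apply Rmin_pos; [apply D|apply D']|apply Rmin_r].
    + apply deformation_on_le with e0; [|exact D].
      split; [apply Rmin_pos; [apply D|apply D']|apply Rmin_l].
  - exfalso. apply Hn.
    destruct (persists_zeta_exists p q m e0 h Hp Hq Hc HP) as [z [Sz Hz]].
    exists z. split; [exact Sz|]. exists e0, h. split; [exact Hc|].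
    split; [|now split]. now replace (S m - 1)%nat with m by lia.
Qed.

(** * Persistence to orders one and two *)

Lemma persists_1 (p q : nat) (e0 : R) (h : R -> R -> R) :
  (0 < p)%nat -> (2 * p < q)%nat -> circle_deformation e0 h ->
  persists p q e0 h 1 <-> forall t, mu p q (Derive (taylor_coef h 1)) t = 0.
Proof.
  intros Hp Hq Hc. pose proof (persists_0 p q e0 h Hp Hq Hc) as HP.
  pose proof (sin_half_omega_pos p q Hp Hq) as Hs.
  destruct (persists_recurrences p q 0 e0 h Hp Hq Hc HP) as [phi [psi [theta [HR _]]]].
  rewrite (persists_succ p q 0 e0 h phi psi theta Hp Hq Hc HP HR).
  apply (mu_Derive_eq_0 p q (sin (omega p q / 2))); [lra|]. intros t.
  rewrite <- mu_scal. apply mu_ext. intros x.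
  apply (Qcoef_1 e0 p q h psi theta x (circle_deformation_on _ _ Hc)).
  intros s. destruct (proj1 HR s) as [_ E]. exact E.
Qed.

(** With a = h_1', [mu_order_2] turns the part of mu Q_2 containing psi_1 and theta_1 into s
    mu(theta_1 theta_1'), the derivative of theta_1^2/2 under mu. Only the mu-means agree, which is
    all that the criterion sees. *)
Lemma persists_2 (p q : nat) (e0 : R) (h : R -> R -> R) :
  (0 < p)%nat -> (2 * p < q)%nat -> Nat.gcd p q = 1%nat -> circle_deformation e0 h ->
  persists p q e0 h 1 ->
  exists th, smooth_periodic th /\
    (forall t, theta1_series p q (taylor_coef h 1) t = RtoC (th t)) /\
    (persists p q e0 h 2 <->
     forall t, mu p q (Derive (fun x => taylor_coef h 2 x + / 2 * (th x * th x))) t = 0).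
Proof.
  intros Hp Hq Hg Hc HP. assert (0 < q)%nat as Hq0 by lia.
  pose proof (circle_deformation_on _ _ Hc) as Hdef.
  pose proof (sin_half_omega_pos p q Hp Hq) as Hs.
  destruct (persists_recurrences p q 1 e0 h Hp Hq Hc HP) as [phi [psi [theta [HR _]]]].
  pose proof HR as [H0 Hrec].
  assert (H0' : forall t, psi 0%nat t = t /\ theta 0%nat t = omega p q / 2).
  { intros s. destruct (H0 s) as [_ E]. exact E. }
  destruct (Hrec 1%nat ltac:(lia)) as [[[Sth Eth] _] [[[Sphi Ephi] _] Epsi]].
  pose proof (taylor_coef_smooth_periodic e0 h 1 Hdef) as Sh1.
  pose proof (taylor_coef_smooth_periodic e0 h 2 Hdef) as Sh2.
  pose proof (smooth_periodic_Derive _ Sh1) as Sa.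
  set (h1 := taylor_coef h 1) in *. set (h2 := taylor_coef h 2) in *.
  set (th := theta 1%nat) in *. set (al := omega p q / 2) in *.
  assert (Eq1 : forall t, sin al * delta p q th t
    = cos al * delta p q h1 t - sin al * sigma p q (Derive h1) t).
  { intros t. destruct (Eth t) as [-> _]. unfold delta, sigma, tau.
    destruct (Qcoef_1 e0 p q h psi theta t Hdef H0') as [-> ->].
    destruct (Qcoef_1 e0 p q h psi theta (t + omega p q) Hdef H0') as [-> ->].
    fold h1 al. ring. }
  exists th. split; [exact Sth|]. split.
  { intros t. apply theta1_series_eq; auto. intros s. apply Eth. }
  rewrite (persists_succ p q 1 e0 h phi psi theta Hp Hq Hc HP HR).
  apply (mu_Derive_eq_0 p q (sin al)); [lra|]. intros t.
  assert (Dth : forall x, is_derive th x (Derive th x))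
    by (intros; apply Derive_correct; now apply smooth_periodic_ex_derive).
  assert (D2 : forall x, Derive (fun x => h2 x + / 2 * (th x * th x)) x
    = Derive h2 x + th x * Derive th x).
  { intros x. apply is_derive_unique.
    apply (is_derive_plus (K := R_AbsRing) (V := R_NormedModule) h2).
    - apply Derive_correct. now apply smooth_periodic_ex_derive.
    - replace (th x * Derive th x) with (/ 2 * (Derive th x * th x + th x * Derive th x))
        by field.
      apply is_derive_scal.
      apply (is_derive_mult th th); auto. exact Rmult_comm. }
  rewrite (mu_ext p q _ _ t D2), mu_plus.
  rewrite (mu_ext p q _ (fun x => sin al * Derive h2 x
    + (sin al * Derive (Derive h1) x * psi 1%nat x + cos al * Derive h1 x * th x))).
  2: { intros x. rewrite (Qcoef_2 e0 p q h psi theta x Hdef H0').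
       - fold h1 h2 th al. change (Derive_n h1 2 x) with (Derive (Derive h1) x). ring.
       - intros n s. apply (recurrences_smooth p q 2 h phi psi theta 1 HR ltac:(lia) n s).
       - apply Sth. }
  rewrite mu_plus, mu_scal.
  rewrite (mu_order_2 p q (sin al) (cos al) (Derive h1) (phi 1%nat) (psi 1%nat) th t); auto.
  - ring.
  - intros s. apply Ephi.
  - intros s.
    assert (Dd : forall f, smooth_periodic f -> forall x,
      is_derive (fun x => f (x + omega p q)) x (Derive f (x + omega p q))).
    { intros f Hf x. apply Derive_shift. now apply smooth_periodic_ex_derive. }
    assert (Dc : forall f, smooth_periodic f -> forall x, is_derive f x (Derive f x)).
    { intros f Hf x. apply Derive_correct. now apply smooth_periodic_ex_derive. }
    (* [mu_order_2] needs the equation of theta_1 differentiated in t: both of its sides are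
       differentiated here. *)
    assert (L : is_derive (fun t => sin al * delta p q th t) s
      (sin al * delta p q (Derive th) s)).
    { apply is_derive_scal.
      apply (is_derive_minus (K := R_AbsRing) (V := R_NormedModule)
        (fun x => th (x + omega p q))); auto. }
    assert (Rr : is_derive (fun t => sin al * delta p q th t) s
      (cos al * delta p q (Derive h1) s - sin al * sigma p q (Derive (Derive h1)) s)).
    { apply is_derive_ext with
        (fun t => cos al * delta p q h1 t - sin al * sigma p q (Derive h1) t).
      { intros; symmetry; apply Eq1. }
      apply (is_derive_minus (K := R_AbsRing) (V := R_NormedModule)
        (fun t => cos al * delta p q h1 t)); apply is_derive_scal.
      - apply (is_derive_minus (K := R_AbsRing) (V := R_NormedModule)
          (fun x => h1 (x + omega p q))); auto.
      - apply (is_derive_plus (K := R_AbsRing) (V := R_NormedModule)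
          (fun x => Derive h1 (x + omega p q))); auto. }
    rewrite <- (is_derive_unique _ _ _ L). apply is_derive_unique, Rr.
Qed.

Theorem theorem1 :
  forall p q : nat, (0 < p)%nat -> (2 * p < q)%nat -> Nat.gcd p q = 1%nat ->
  exists zeta : nat -> (nat -> R -> R) -> R -> R,
    (* zeta m depends only on the coefficients h_1, ..., h_{m-1} *)
    (forall (m : nat) (H H' : nat -> R -> R), (3 <= m)%nat ->
       (forall j : nat, (1 <= j < m)%nat -> forall t, H j t = H' j t) ->
       forall t, zeta m H t = zeta m H' t) /\
    forall (e0 : R) (h : R -> R -> R), circle_deformation e0 h ->
      (* (a) *)
      (persists p q e0 h 1 <->
       forall t, mu_harm (qZstar q) (fun x => RtoC (taylor_coef h 1 x)) t = RtoC 0) /\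
      (* (b) *)
      (persists p q e0 h 2 <->
       persists p q e0 h 1 /\
       forall t, mu_harm (qZstar q)
         (fun x => RtoC (taylor_coef h 2 x)
            + theta1_series p q (taylor_coef h 1) x
              * theta1_series p q (taylor_coef h 1) x / RtoC 2)%C t = RtoC 0) /\
      (* (c) *)
      (forall m : nat, (3 <= m)%nat ->
         smooth_periodic (zeta m (taylor_coef h)) /\
         (persists p q e0 h (m - 1) ->
          zeta_by_recurrences p q h m (zeta m (taylor_coef h))) /\
         (persists p q e0 h m <->
          persists p q e0 h (m - 1) /\
          forall t, mu_harm (qZstar q)
            (fun x => RtoC (taylor_coef h m x + zeta m (taylor_coef h) x)) t
            = RtoC 0)).
Proof.
  intros p q Hp Hq Hg. assert (0 < q)%nat as Hq0 by lia.
  exists (zeta_choice p q). split.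
  { intros m H H' _ E t. now rewrite (zeta_choice_ext p q m H H' E). }
  intros e0 h Hc. pose proof (circle_deformation_on _ _ Hc) as Hdef.
  split; [|split].
  - rewrite (persists_1 p q e0 h Hp Hq Hc). symmetry.
    apply mu_harm_zero_iff; auto. now apply (taylor_coef_smooth_periodic e0).
  - assert (Key : persists p q e0 h 1 ->
      (persists p q e0 h 2 <-> forall t, mu_harm (qZstar q)
         (fun x => RtoC (taylor_coef h 2 x)
            + theta1_series p q (taylor_coef h 1) x
              * theta1_series p q (taylor_coef h 1) x / RtoC 2)%C t = RtoC 0)).
    { intros HP. destruct (persists_2 p q e0 h Hp Hq Hg Hc HP) as [th [Sth [Eth ->]]].
      rewrite <- mu_harm_zero_iff; auto.
      - rewrite (functional_extensionality
          (fun x => RtoC (taylor_coef h 2 x)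
            + theta1_series p q (taylor_coef h 1) x
              * theta1_series p q (taylor_coef h 1) x / RtoC 2)%C
          (fun x => RtoC (taylor_coef h 2 x + / 2 * (th x * th x)))); [reflexivity|].
        intros x. rewrite Eth. rewrite RtoC_plus, !RtoC_mult.
        rewrite RtoC_inv by lra. unfold Cdiv. now rewrite Cmult_comm.
      - apply smooth_periodic_plus; [now apply (taylor_coef_smooth_periodic e0)|].
        apply smooth_periodic_scal. now apply smooth_periodic_mult. }
    split.
    + intros HP2. assert (HP1 := persists_pred p q 1 e0 h Hp Hq Hc HP2).
      split; [exact HP1|]. now apply Key.
    + intros [HP1 HM]. now apply Key.
  - intros m Hm. destruct m as [|m]; [lia|]. replace (S m - 1)%nat with m by lia.
    pose proof (zeta_choice_smooth p q (S m) (taylor_coef h)) as Sz.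
    split; [exact Sz|]. split; [intros HP; now apply (zeta_choice_spec p q m e0)|].
    assert (Key : persists p q e0 h m ->
      (persists p q e0 h (S m) <-> forall t, mu_harm (qZstar q)
        (fun x => RtoC (taylor_coef h (S m) x + zeta_choice p q (S m) (taylor_coef h) x)) t
        = RtoC 0)).
    { intros HP.
      rewrite (persists_succ_zeta p q m e0 h (zeta_choice p q (S m) (taylor_coef h))
        Hp Hq Hc HP Sz (zeta_choice_spec p q m e0 h Hp Hq Hc HP)).
      symmetry. apply mu_harm_zero_iff; auto.
      apply smooth_periodic_plus; [now apply (taylor_coef_smooth_periodic e0)|exact Sz]. }
    split.
    + intros HPS. assert (HP := persists_pred p q m e0 h Hp Hq Hc HPS).
      split; [exact HP|]. now apply Key.
    + intros [HP HM]. now apply Key.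
Qed.
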